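(* Let $B(k)=[-k,k]^d\cap\mathbb{Z}^d$, where $k\ge 1$ is an integer, and let $E$ be a cylinder event depending only on the heights in $B(k)$, i.e. $E=\{\eta:\ (\eta_x)_{x\in B(k)}\in E_0\}$ for some Borel set $E_0\subset[0,2d)^{B(k)}$. Let $m^{(\gamma)}$, $\gamma\ge 0$, be the infinite-volume sandpile measures on $\mathbb{Z}^d$ defined in the context. (1) If $d=3$, there exist constants $C<\infty$, $\eta>0$ (not depending on $k$, $E$, $\gamma$) such that for all $0<\gamma<1$ $$\left|m^{(\gamma)}(E)-m^{(0)}(E)\right|\le C k^2\gamma^{\eta}+C k^5(\log k)\,\gamma .$$ (2) If $d=2$, there exist constants $c_0>0$ and $C,C_0<\infty$ (not depending on $k$, $E$, $\gamma$) such that for all $0<\gamma\le c_0k^{-C_0}$ $$\left|m^{(\gamma)}(E)-m^{(0)}(E)\right|\le C k^{21/23}\gamma^{1/46-o(1)},$$ where $o(1)$ denotes a positive quantity, depending only on $\gamma$, that approaches $0$ as $\gamma\to0$.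
   Context: For finite $\Lambda\subset\mathbb{Z}^d$ and $\gamma\ge0$ let $\Omega^{(\gamma)}_\Lambda=[0,2d+\gamma)^\Lambda$ (stable configurations). Write $x\sim y$ if $x,y$ are nearest neighbours in $\mathbb{Z}^d$. For $\eta\in\Omega^{(\gamma)}_\Lambda$ and $\emptyset\ne W\subset\Lambda$, the restriction $\eta_W$ is a forbidden subconfiguration if $\eta_y<|\{z\in W: z\sim y\}|$ for all $y\in W$. The configuration $\eta$ is allowed if no such $W$ gives a forbidden subconfiguration. Let $\mathcal{R}^{(\gamma)}_\Lambda$ be the set of allowed configurations in $\Omega^{(\gamma)}_\Lambda$ (these are exactly the recurrent configurations of the continuous-height sandpile Markov chain with toppling matrix having diagonal entries $2d+\gamma$, entries $-1$ for neighbouring sites and $0$ otherwise, where at each step unit height is added at a random site and the configuration is stabilized). Let $m^{(\gamma)}_\Lambda$ be normalized Lebesgue measure on $\mathcal{R}^{(\gamma)}_\Lambda$, which is invariant for this chain. For all $d\ge2$ and $\gamma\ge0$ the weak limit $m^{(\gamma)}=\lim_{\Lambda\uparrow\mathbb{Z}^d}m^{(\gamma)}_\Lambda$ (along any sequence of finite sets exhausting $\mathbb{Z}^d$) is known to exist; it is a probability measure on $[0,2d+\gamma)^{\mathbb{Z}^d}$. *)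

(* Defs.v *)
From HB Require Import structures.
From mathcomp Require Import all_boot all_order all_algebra finmap.
From mathcomp Require Import all_classical all_reals all_analysis.

Set Implicit Arguments.
Unset Strict Implicit.
Unset Printing Implicit Defensive.

Import Order.TTheory GRing.Theory Num.Theory.
Import numFieldNormedType.Exports.

Local Open Scope classical_set_scope.
Local Open Scope ring_scope.

(* The space R^I, with the topology of pointwise convergence and the product
   of the Borel sigma-algebras of the factors.  For countable I the latter is
   the Borel sigma-algebra of the former. *)
Definition heights (I : Type) (R : realType) : Type := {ptws I -> R}.

HB.instance Definition _ (I : Type) (R : realType) :=
  Topological.copy (heights I R) {ptws I -> R}.
HB.instance Definition _ (I : Type) (R : realType) :=
  isPointed.Build (heights I R) (fun=> 0).

Definition heights_display : measure_display.
Proof. by constructor. Qed.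

Section heights_measurable.
Context (I : Type) (R : realType).

Definition heights_measurable : set_system (heights I R) :=
  <<s \bigcup_(i : I) preimage_set_system setT
        (fun h : heights I R => h i : measurableTypeR R) measurable >>.

Let heights_measurable0 : heights_measurable set0.
Proof. exact: sigma_algebra0. Qed.

Let heights_measurableC A : heights_measurable A -> heights_measurable (~` A).
Proof. exact: sigma_algebraC. Qed.

Let heights_measurable_bigcup (F : (set (heights I R))^nat) :
  (forall n, heights_measurable (F n)) ->
  heights_measurable (\bigcup_n F n).
Proof. exact: sigma_algebra_bigcup. Qed.

HB.instance Definition _ := @isMeasurable.Build heights_display
  (heights I R) heights_measurable
  heights_measurable0 heights_measurableC heights_measurable_bigcup.

End heights_measurable.

Lemma measurable_height (I : Type) (R : realType) (i : I) :
  measurable_fun [set: heights I R]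
    (fun h : heights I R => h i : measurableTypeR R).
Proof.
move=> _ B mB; apply: sub_sigma_algebra; exists i => //.
by exists B.
Qed.

Lemma measurable_fun_heights d (T : measurableType d) (I : Type)
    (R : realType) (f : T -> heights I R) :
  (forall i, measurable_fun [set: T] (fun t => f t i : measurableTypeR R)) ->
  measurable_fun [set: T] f.
Proof.
move=> mf.
suff : @measurable _ (heights I R) `<=` image_set_system setT f measurable.
  by move=> h _ A mA; exact: h.
apply: smallest_sub.
  exact/sigma_algebra_image/sigma_algebra_measurable.
move=> A [i _ [B mB <-]]; rewrite /image_set_system /=.
have := mf i measurableT B mB.
by rewrite !setTI.
Qed.

Section lebesgue_tuple.
Context (R : realType).
Local Notation RT := (measurableTypeR R).

Definition tuple_cons n (p : RT * n.-tuple RT) : n.+1.-tuple RT :=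
  [tuple of p.1 :: p.2].

Let measurable_tuple_cons n : measurable_fun setT (@tuple_cons n).
Proof. by apply: measurable_cons. Qed.

HB.instance Definition _ n :=
  isMeasurableFun.Build _ _ _ _ (@tuple_cons n) (@measurable_tuple_cons n).

Section cons.
Variables (n : nat) (mu : {sigma_finite_measure set (n.-tuple RT) -> \bar R}).

Definition lebesgue_cons : set (n.+1.-tuple RT) -> \bar R :=
  pushforward (lebesgue_measure \x mu)%E (@tuple_cons n).

Let lebesgue_cons0 : lebesgue_cons set0 = 0%E.
Proof. exact: measure0. Qed.

Let lebesgue_cons_ge0 A : (0 <= lebesgue_cons A)%E.
Proof. exact: measure_ge0. Qed.

Let lebesgue_cons_sigma_additive : semi_sigma_additive lebesgue_cons.
Proof. exact: measure_semi_sigma_additive. Qed.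

HB.instance Definition _ := isMeasure.Build _ _ _ lebesgue_cons
  lebesgue_cons0 lebesgue_cons_ge0 lebesgue_cons_sigma_additive.

Let lebesgue_cons_sigma_finite : sigma_finite setT lebesgue_cons.
Proof.
have /sigma_finiteP[F [FT ndF Foo]] := sigma_finiteT (@lebesgue_measure R).
have /sigma_finiteP[G [GT ndG Goo]] := sigma_finiteT mu.
pose uncons (t : n.+1.-tuple RT) : RT * n.-tuple RT :=
  (thead t, [tuple of behead t]).
have unconsK : uncons \o @tuple_cons n = id.
  by apply/funext => -[x t]; congr pair; exact/val_inj.
have muncons : measurable_fun setT uncons.
  apply/measurable_fun_pairP; split.
    exact: (measurable_tnth ord0).
  exact: measurable_behead.
exists (fun k => uncons @^-1` (F k `*` G k)).
  apply/esym; rewrite -subTset => t _.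
  have [i _ Fi] : (\bigcup_i F i) (thead t) by rewrite -FT.
  have [j _ Gj] : (\bigcup_i G i) [tuple of behead t] by rewrite -GT.
  exists (maxn i j) => //; split => /=.
    by move: Fi; exact/subsetPset/ndF/leq_maxl.
  by move: Gj; exact/subsetPset/ndG/leq_maxr.
move=> k; have [mFk Fkoo] := Foo k; have [mGk Gkoo] := Goo k; split.
  by rewrite -[X in measurable X]setTI; apply: muncons => //; exact: measurableX.
rewrite /lebesgue_cons /pushforward -comp_preimage unconsK preimage_id.
by rewrite product_measure1E// lte_mul_pinfty// ge0_fin_numE.
Qed.

HB.instance Definition _ := Measure_isSigmaFinite.Build _ _ _ lebesgue_cons
  lebesgue_cons_sigma_finite.
End cons.

Fixpoint lebesgue_tuple n : {sigma_finite_measure set (n.-tuple RT) -> \bar R} :=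
  if n is n'.+1 then lebesgue_cons (lebesgue_tuple n')
  else \d_([tuple] : 0.-tuple RT).

End lebesgue_tuple.

Section lebesgue_heights.
Context (I : finType) (R : realType).

Definition heights_of_tuple (t : #|I|.-tuple (measurableTypeR R)) :
  heights I R := fun i => tnth t (enum_rank i).

Let measurable_heights_of_tuple : measurable_fun setT heights_of_tuple.
Proof.
apply: measurable_fun_heights => i.
exact: (measurable_tnth (enum_rank i)).
Qed.

HB.instance Definition _ := isMeasurableFun.Build _ _ _ _
  heights_of_tuple measurable_heights_of_tuple.

(* Lebesgue measure on R^I for finite I; by Fubini the enumeration of I is
   immaterial. *)
Definition lebesgue_heights : set (heights I R) -> \bar R :=
  pushforward (lebesgue_tuple R #|I|) heights_of_tuple.

Let lebesgue_heights0 : lebesgue_heights set0 = 0%E.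
Proof. exact: measure0. Qed.

Let lebesgue_heights_ge0 A : (0 <= lebesgue_heights A)%E.
Proof. exact: measure_ge0. Qed.

Let lebesgue_heights_sigma_additive : semi_sigma_additive lebesgue_heights.
Proof. exact: measure_semi_sigma_additive. Qed.

HB.instance Definition _ := isMeasure.Build _ _ _ lebesgue_heights
  lebesgue_heights0 lebesgue_heights_ge0 lebesgue_heights_sigma_additive.

End lebesgue_heights.

Definition nearest_neighbours d (x y : 'rV[int]_d) : bool :=
  \sum_(i < d) `|x 0 i - y 0 i| == 1.

Definition stable (I : Type) (R : realType) (d : nat) (gamma : R) :
    set (heights I R) :=
  [set h | forall i, 0 <= h i < (2 * d)%:R + gamma].

Lemma measurable_stable (I : countType) (R : realType) d (gamma : R) :
  measurable (@stable I R d gamma).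
Proof.
rewrite (_ : stable d gamma = \bigcap_(i in [set: I])
    (fun h : heights I R => h i : measurableTypeR R) @^-1`
      `[0, (2 * d)%:R + gamma[); last first.
  apply/seteqP; split => [h sh i _|h sh i].
    by rewrite /= in_itv /=; exact: sh.
  by have := sh i Logic.I; rewrite /= in_itv.
rewrite -[X in measurable X]setCK setC_bigcap; apply: measurableC.
apply: countable_bigcupT_measurable; first exact: countableP.
move=> i; apply: measurableC; rewrite -[X in measurable X]setTI.
by apply: measurable_height => //; exact: measurable_itv.
Qed.

Section finite_volume.
Context (R : realType) (d : nat) (gamma : R) (L : {fset 'rV[int]_d}).

Definition forbidden (W : {set L}) (h : heights L R) : Prop :=
  forall y, y \in W ->
    h y < #|[pred z in W | nearest_neighbours (val z) (val y)]|%:R.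

Definition allowed : set (heights L R) :=
  [set h | stable d gamma h /\
           forall W : {set L}, W != finset.set0 -> ~ forbidden W h].

Lemma measurable_allowed : measurable allowed.
Proof.
rewrite (_ : allowed = stable d gamma `&`
    \bigcap_(W in [set W : {set L} | W != finset.set0])
      ~` (forbidden W : set (heights L R))).
  apply: measurableI; first exact: measurable_stable.
  apply: fin_bigcap_measurable => [|W _]; first exact: finite_finset.
  apply: measurableC.
  rewrite (_ : (forbidden W : set (heights L R)) =
      \bigcap_(y in [set y | y \in W])
      (fun h : heights L R => h y : measurableTypeR R) @^-1`
      `]-oo, #|[pred z in W | nearest_neighbours (val z) (val y)]|%:R[).
    apply: fin_bigcap_measurable => [|y _]; first exact: finite_finset.
    rewrite -[X in measurable X]setTI.
    by apply: measurable_height => //; exact: measurable_itv.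
  by apply/seteqP; split => h fh y /fh; rewrite /= in_itv.
by apply/seteqP; split => h [sh ah]; split.
Qed.

(* The default value [point] of [mnormalize] plays no role: for d >= 1 and
   gamma >= 0, [allowed] lies in the bounded box [stable] and contains
   [2d - 1, 2d)^L, so its volume is positive and finite. *)
Definition sandpile_measure : probability (heights L R) R :=
  mnormalize (mrestr (@lebesgue_heights L R) measurable_allowed) point.

Definition extend_by_zero (h : heights L R) : heights 'rV[int]_d R :=
  fun x => if insub x is Some u then h u else 0.

Let measurable_extend_by_zero : measurable_fun setT extend_by_zero.
Proof.
apply: measurable_fun_heights => x; rewrite /extend_by_zero.
case: (insub x) => [u|]; [exact: measurable_height|exact: measurable_cst].
Qed.

HB.instance Definition _ := isMeasurableFun.Build _ _ _ _
  extend_by_zero measurable_extend_by_zero.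

(* [sandpile_measure] seen on R^(Z^d), so that different volumes compare. *)
Definition extended_sandpile_measure : probability (heights 'rV[int]_d R) R :=
  distribution sandpile_measure extend_by_zero.

End finite_volume.

Definition weak_cvg (I : Type) (R : realType)
    (mu_ : nat -> probability (heights I R) R)
    (mu : probability (heights I R) R) : Prop :=
  forall f : heights I R -> R, continuous f ->
    (exists M, forall h, `|f h| <= M) ->
    (\int[mu_ n]_h (f h)%:E)%E @[n --> \oo] --> (\int[mu]_h (f h)%:E)%E.

Definition exhausting d (L_ : nat -> {fset 'rV[int]_d}) : Prop :=
  (forall n, fsubset (L_ n) (L_ n.+1)) /\ (forall x, exists n, x \in L_ n).

(* [m] is the weak limit, as L increases to Z^d, of the normalized Lebesgue
   measures on the allowed configurations in L.  Since [m] is carried by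
   [0, 2d + gamma)^(Z^d), weak convergence there and in R^(Z^d) agree. *)
Definition infinite_volume_limit (R : realType) (d : nat) (gamma : R)
    (m : probability (heights 'rV[int]_d R) R) : Prop :=
  m (stable d gamma) = 1%E /\
  forall L_ : nat -> {fset 'rV[int]_d}, exhausting L_ ->
    weak_cvg (fun n => extended_sandpile_measure gamma (L_ n)) m.

Definition box (d k : nat) : Type :=
  {x : 'rV[int]_d | [forall i, `|x 0 i| <= k%:Z]}.

Definition cylinder (R : realType) (d k : nat) (E0 : set (heights (box d k) R)) :
    set (heights 'rV[int]_d R) :=
  [set h | E0 (fun x : box d k => h (sval x))].

(* Main.v *)
(* Dhar's burning algorithm turns the volume of the recurrent configurations into
   a weighted count of spanning trees rooted at the sink.  Let W be the set of
   sites that stay unburnt while the box B is kept from burning.  On {W = w} the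
   configuration in w does not feel the dissipation, and the probability of
   {W = w} is at most that of {w is the set of descendants of B} in a random
   spanning tree.  Raising the dissipation by t multiplies the probability of
   {W = w} by at least (1 + t M)^-|w|, M being a bound on the diagonal Green
   function: Rayleigh monotonicity takes care of the sites outside w.  Hence E
   loses at most the mean of min(1, |W| t M), and the reverse bound is the same
   statement for the complement of E.

   In dimension two the dissipation is raised along the scales 80^-j.  A branch
   from a distant x reaches B with small probability, because the branch from B to
   the sink stands in the way of the walk; a discrete Beurling estimate, with a
   sum of logarithmic potentials over one point of that branch per sphere, gives
   the decay 5/6 per factor 8 of scale.  In dimension three the branches of a net
   of points, which with high probability avoid B, play the role of the obstacle,
   the potentials being 1/|x|.  The indicator of a cylinder is finally replaced by
   continuous cylinder functions in order to pass to the weak limit. *)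
Require Import Defs.
From HB Require Import structures.
From mathcomp Require Import all_boot all_order all_algebra finmap.
From mathcomp Require Import all_classical all_reals all_analysis.
From mathcomp Require Import measurable_realfun.
From mathcomp Require Import ring lra zify.
Set Implicit Arguments.
Unset Strict Implicit.
Unset Printing Implicit Defensive.
Import Order.TTheory GRing.Theory Num.Theory.
Import numFieldNormedType.Exports.
Local Open Scope classical_set_scope.
Local Open Scope ring_scope.

(** * Spanning forests *)

(** No random walk or Markov chain is constructed. A forest is a function [f] sending each site to
    its parent, and deleting one site from the domain ([acyclic_peel], [tree_sum_peel]) does the
    work of one step of Wilson's algorithm. Hitting probabilities become ratios of weighted sums,
    estimated by comparison with explicit super- and subharmonic functions. The scales in dimension
    two are forced by recurrence: the bound M grows like ln (1/s) as the dissipation s vanishes, so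
    no single step can start from zero. At s = 80^-(J+1) the obstacle acts up to distance 8^J. Sites
    nearer than that number about 64^J per site of the box, the farther ones contribute order
    (5/6)^J / s. As 80 * 5/6 > 64, the second term governs, and a step of size 80^-J loses order J
    (5/6)^J, which is summable. In dimension three M = 6 in every volume and one step from zero
    suffices. But a branch there is only guaranteed to stop the walk at scale r with a probability
    of order 1 / ln r, so that many obstacles have to be met in succession. *)

Section exits.
Variable T : finType.
Implicit Types (A : {set T}) (f g : {ffun T -> option T}) (v w : option T).

(* Vertices are [Some x]; [None] is the sink.  If [f] is acyclic on [A] it is a
   forest rooted outside [A], and [exit A f v] is the root below [v]. *)
Definition inside A v := if v is Some x then x \in A else false.

Definition next A f v := if v is Some x then if x \in A then f x else v else v.

Definition exit A f v := iter #|T| (next A f) v.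

Definition acyclic A f := [forall x in A, ~~ inside A (exit A f (Some x))].

Definition upd f x v : {ffun T -> option T} :=
  [ffun y => if y == x then v else f y].

Definition supported A f := [forall y, (y \notin A) ==> (f y == None)].

Lemma next_outside A f v : ~~ inside A v -> next A f v = v.
Proof. by case: v => //= x /negbTE ->. Qed.

Lemma iter_next_outside A f v k : ~~ inside A v -> iter k (next A f) v = v.
Proof. by move=> h; elim: k => //= k ->; exact: next_outside. Qed.

(** The orbit of [v] has at most [#|T| + 1] points in [option T], so each of them is reached within
    [#|T|] steps; a point outside [A] is fixed by [next], hence is the exit. *)
Lemma exit_iter A f v k : ~~ inside A (iter k (next A f) v) ->
  exit A f v = iter k (next A f) v.
Proof.
set w := iter k _ v => ow.
have c : fconnect (next A f) v w by exact: fconnect_iter.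
have lt := findex_max c.
have le : (findex (next A f) v w <= #|T|)%N.
  rewrite -ltnS; apply: leq_trans lt _.
  by rewrite /order -(card_option T); exact: max_card.
rewrite /exit -(subnK le) iterD iter_findex //.
exact: iter_next_outside.
Qed.

Lemma exit_outside A f v : ~~ inside A v -> exit A f v = v.
Proof. exact: iter_next_outside. Qed.

Lemma exit_next A f v : ~~ inside A (exit A f v) ->
  exit A f (next A f v) = exit A f v.
Proof.
move=> h; rewrite [RHS](@exit_iter _ _ _ #|T|.+1) /=; first by rewrite /exit -iterSr.
by rewrite next_outside.
Qed.

Lemma acyclicP A f : reflect (forall v, ~~ inside A (exit A f v)) (acyclic A f).
Proof.
apply: (iffP forall_inP) => h; last by move=> x _; exact: h.
case=> [x|]; last by rewrite exit_outside.
by have [xA|xA] := boolP (x \in A); [exact: h|rewrite exit_outside].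
Qed.

Lemma acyclic_iter A f : (forall v, exists k, ~~ inside A (iter k (next A f) v)) ->
  acyclic A f.
Proof. by move=> h; apply/acyclicP => v; have [k hk] := h v; rewrite (exit_iter hk). Qed.

Lemma eq_next A f g : {in A, f =1 g} -> next A f =1 next A g.
Proof. by move=> e [x|] //=; case: ifP => // /e. Qed.

Lemma eq_exit A f g v : {in A, f =1 g} -> exit A f v = exit A g v.
Proof. by move=> /eq_next e; exact: eq_iter. Qed.

Lemma eq_acyclic A f g : {in A, f =1 g} -> acyclic A f = acyclic A g.
Proof. by move=> e; apply: eq_forallb => x; rewrite (eq_exit _ e). Qed.

Section peel.
Variables (A : {set T}) (x : T) (f : {ffun T -> option T}).
Hypothesis xA : x \in A.
Let A' := A :\ x.

Lemma next_peel v : v != Some x -> next A' f v = next A f v.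
Proof.
case: v => [y|] //= yx; rewrite !inE.
by have -> : y != x by apply: contra yx => /eqP ->.
Qed.

Lemma inside_peel v : inside A' v = inside A v && (v != Some x).
Proof. by case: v => [y|] //=; rewrite !inE andbC. Qed.

Lemma iter_peel_neq k v : iter k (next A' f) v != Some x ->
  iter k (next A f) v = iter k (next A' f) v.
Proof.
elim: k v => [|k IH] v //; rewrite !iterSr => h.
have [e|ne] := eqVneq v (Some x).
  have ox : ~~ inside A' (Some x) by rewrite inside_peel eqxx andbF.
  by move: h; rewrite e next_outside // iter_next_outside // eqxx.
by rewrite -next_peel // IH.
Qed.

Lemma iter_peel_eq k v : iter k (next A' f) v = Some x ->
  exists j, iter j (next A f) v = Some x.
Proof.
elim: k v => [|k IH] v; first by exists 0%N.
rewrite iterSr; have [e _|ne /IH[j jx]] := eqVneq v (Some x); first by exists 0%N.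
by exists j.+1; rewrite iterSr -next_peel.
Qed.

Lemma iter_peel_outside k v : ~~ inside A (iter k (next A f) v) ->
  exists j, ~~ inside A' (iter j (next A' f) v).
Proof.
elim: k v => [|k IH] v.
  by move=> h; exists 0%N; rewrite inside_peel negb_and h.
rewrite iterSr; have [e _|ne /IH[j jx]] := eqVneq v (Some x).
  by exists 0%N; rewrite inside_peel e eqxx andbF.
by exists j.+1; rewrite iterSr next_peel.
Qed.

(** Deleting [x] from [A] makes it a root; restoring its arrow closes a cycle exactly when the
    branch of [f x] ends at [x]. Sums over forests can thus be computed one site at a time. *)
Lemma acyclic_peel :
  acyclic A f = acyclic A' f && (exit A' f (f x) != Some x).
Proof.
apply/idP/andP => [/acyclicP h|[/acyclicP h ne]].
  split.
    by apply: acyclic_iter => v; apply: iter_peel_outside (h v).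
  apply/eqP => /iter_peel_eq[j jx].
  (* A branch from [f x] back to [x] makes the orbit of [x] periodic: it is in [A] at arbitrarily
     late times and never exits. *)
  have per m : iter (m * j.+1) (next A f) (Some x) = Some x.
    by elim: m => // m IH; rewrite mulSn iterD IH iterSr /= xA jx.
  have := h (Some x).
  rewrite -(iter_next_outside f (#|T| * j) (h (Some x))) -iterD addnC -mulnS per.
  by rewrite /= xA.
apply: acyclic_iter => v.
have [e|nv] := eqVneq (exit A' f v) (Some x); last first.
  exists #|T|; rewrite iter_peel_neq //.
  by have := h v; rewrite inside_peel negb_and nv orbF.
have [j jx] := iter_peel_eq e.
exists (#|T| + j.+1)%N; rewrite iterD iterS jx /= xA iter_peel_neq //.
by have := h (f x); rewrite inside_peel negb_and ne orbF.
Qed.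

Lemma exit_peel_neq v : acyclic A f -> exit A' f v != Some x ->
  exit A f v = exit A' f v.
Proof. by move=> _ ne; rewrite /exit iter_peel_neq. Qed.

Lemma exit_peel_self : acyclic A f -> exit A f (Some x) = exit A' f (f x).
Proof.
move=> ac; have /acyclicP h := ac.
rewrite -exit_next // /= xA exit_peel_neq //.
by move: ac; rewrite acyclic_peel => /andP[].
Qed.

Lemma exit_peel_eq v : acyclic A f -> exit A' f v = Some x ->
  exit A f v = exit A' f (f x).
Proof.
move=> ac e; rewrite -exit_peel_self //.
have [j jx] := iter_peel_eq e.
have /acyclicP h := ac.
rewrite (@exit_iter _ _ v (#|T| + j)%N) iterD jx //.
exact: h.
Qed.

End peel.

Lemma acyclic_sub A A' f : A' \subset A -> acyclic A f -> acyclic A' f.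
Proof.
move: {2}#|A :\: A'| (erefl #|A :\: A'|) => n; elim: n A => [|n IH] A.
  move=> /eqP; rewrite cards_eq0 finset.setD_eq0 => s1 s2.
  by have /eqP -> : A == A' by rewrite finset.eqEsubset s1 s2.
move=> e s; have : (0 < #|A :\: A'|)%N by rewrite e.
rewrite card_gt0 => /set0Pn[x]; rewrite inE => /andP[xA' xA].
rewrite (acyclic_peel f xA) => /andP[ac _]; apply: (IH (A :\ x)) => //.
  rewrite finset.setDDl finset.setUC -finset.setDDl -[RHS]/(n.+1.-1) -e.
  by rewrite (cardsD1 x (A :\: A')) !inE xA' xA.
by apply/fintype.subsetP => y yA'; rewrite !inE (fintype.subsetP s) // andbT; apply: contraNneq xA' => <-.
Qed.

Lemma supportedP A f : reflect (forall y, y \notin A -> f y = None) (supported A f).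
Proof.
apply: (iffP forallP) => h y; first by have := h y; case: (y \in A) => //= /eqP.
by apply/implyP => /h ->.
Qed.

End exits.

(** * Weighted sums over forests and harmonic measure *)

Section tree_sums.
Variables (T : finType) (R : realFieldType) (omega : T -> option T -> R).
Implicit Types (A : {set T}) (f g : {ffun T -> option T}) (v w : option T)
  (C : pred (option T)).

Definition weight A f := \prod_(y in A) omega y (f y).

Definition tree_sum A (F : {ffun T -> option T} -> R) :=
  \sum_(f | supported A f && acyclic A f) weight A f * F f.

(* By the matrix-tree theorem this is the determinant of the Laplacian on [A]. *)
Definition treeZ A := tree_sum A (fun=> 1).

(** The unnormalised probability that the branch of [v] in a random forest on [A] exits in [C];
    statements are kept free of division by [treeZ A]. *)
Definition treeY A v C := tree_sum A (fun f => (C (exit A f v))%:R).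

Lemma eq_tree_sum A F G :
  (forall f, supported A f -> acyclic A f -> F f = G f) -> tree_sum A F = tree_sum A G.
Proof. by move=> e; apply: eq_bigr => f /andP[? ?]; rewrite e. Qed.

Lemma tree_sumD A F G :
  tree_sum A (fun f => F f + G f) = tree_sum A F + tree_sum A G.
Proof. by rewrite /tree_sum -big_split; apply: eq_bigr => f _; rewrite mulrDr. Qed.

Lemma tree_sumZ A k F : tree_sum A (fun f => k * F f) = k * tree_sum A F.
Proof. by rewrite /tree_sum mulr_sumr; apply: eq_bigr => f _; rewrite mulrCA. Qed.

Lemma tree_sumB A F G :
  tree_sum A (fun f => F f - G f) = tree_sum A F - tree_sum A G.
Proof.
rewrite -[X in _ = _ + X]mulN1r -tree_sumZ -tree_sumD.
by apply: eq_tree_sum => f _ _; rewrite mulN1r.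
Qed.

Lemma tree_sum_sum (I : finType) (P : pred I) A F :
  tree_sum A (fun f => \sum_(i | P i) F i f) = \sum_(i | P i) tree_sum A (F i).
Proof.
rewrite /tree_sum exchange_big; apply: eq_bigr => f _.
by rewrite mulr_sumr.
Qed.

Lemma sum_supported A x (F : {ffun T -> option T} -> R) : x \in A ->
  \sum_(f | supported A f) F f =
  \sum_v \sum_(g | supported (A :\ x) g) F (upd g x v).
Proof.
move=> xA; rewrite (partition_big (fun f : {ffun T -> option T} => f x) predT) //=.
apply: eq_bigr => v _.
rewrite (reindex_onto (fun g => upd g x v) (fun f => upd f x None)) /=; last first.
  move=> f /andP[_ /eqP fx]; apply/ffunP => y; rewrite !ffunE.
  by case: eqP => // ->.
apply: eq_bigl => g; apply/idP/idP.
  move=> /andP[/andP[/supportedP sg _] /eqP e].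
  apply/supportedP => y; rewrite !inE negb_and negbK => /orP[/eqP ->|yA].
    by rewrite -e !ffunE eqxx.
  rewrite -e !ffunE; case: eqP => // /eqP ne.
  by have := sg _ yA; rewrite ffunE (negbTE ne).
move=> /supportedP sg; rewrite !ffunE eqxx eqxx andbT; apply/andP; split.
  apply/supportedP => y yA; rewrite !ffunE.
  case: eqP => [e|_]; first by rewrite e xA in yA.
  by apply: sg; rewrite !inE negb_and yA orbT.
apply/eqP/ffunP => y; rewrite !ffunE; case: eqP => // ->.
by rewrite sg // !inE eqxx.
Qed.

Lemma upd_in A x g v : {in A :\ x, upd g x v =1 g}.
Proof. by move=> y; rewrite !inE ffunE => /andP[/negbTE ->]. Qed.

(** Weights factorise over sites, so the arrow [v] out of [x] separates from the rest; the indicator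
    is the condition of [acyclic_peel]. *)
Lemma tree_sum_peel A x F : x \in A ->
  tree_sum A F = \sum_v omega x v * tree_sum (A :\ x)
    (fun g => (exit (A :\ x) g v != Some x)%:R * F (upd g x v)).
Proof.
move=> xA; rewrite /tree_sum big_mkcondr (sum_supported _ xA).
apply: eq_bigr => v _; rewrite mulr_sumr [RHS]big_mkcondr; apply: eq_bigr => g sg.
rewrite (acyclic_peel _ xA) ffunE eqxx (eq_acyclic (@upd_in A x g v)).
rewrite (eq_exit _ (@upd_in A x g v)).
case: (acyclic _ _) => //=; case: (_ != _); rewrite ?(mul0r, mulr0) //.
rewrite /weight (bigD1 x) //= ffunE eqxx mul1r -mulrA; congr (_ * (_ * _)).
apply: eq_big => [y|y /andP[_ /negbTE ne]]; first by rewrite !inE andbC.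
by rewrite ffunE ne.
Qed.

Lemma exit_upd_self A x g v : x \in A -> acyclic (A :\ x) g ->
  exit (A :\ x) g v != Some x -> exit A (upd g x v) (Some x) = exit (A :\ x) g v.
Proof.
move=> xA ac ne.
have ac' : acyclic A (upd g x v).
  by rewrite (acyclic_peel _ xA) ffunE eqxx (eq_acyclic (@upd_in A x g v)) ac
             (eq_exit _ (@upd_in A x g v)).
by rewrite (exit_peel_self xA ac') ffunE eqxx (eq_exit _ (@upd_in A x g v)).
Qed.

(** All arrows out of [x], less those that close a cycle: the forest form of expanding the Laplacian
    determinant at [x]. *)
Lemma treeZ_peel A x : x \in A ->
  treeZ A = (\sum_v omega x v) * treeZ (A :\ x) -
            \sum_v omega x v * treeY (A :\ x) v (pred1 (Some x)).
Proof.
move=> xA; rewrite /treeZ (tree_sum_peel _ xA) mulr_suml -sumrB.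
apply: eq_bigr => v _; rewrite -mulrBr -tree_sumB; congr (_ * _).
apply: eq_tree_sum => g _ _ /=; case: eqP => _; rewrite ?subrr ?subr0 ?mul1r ?mul0r //.
Qed.

(** Markov property of a branch: after its first step [v] it is a branch in [A :\ x]. One that
    returns to [x] contributes nothing, as [C] excludes [x]. *)
Lemma treeY_peel A x C : x \in A -> ~~ C (Some x) ->
  treeY A (Some x) C = \sum_v omega x v * treeY (A :\ x) v C.
Proof.
move=> xA nC; rewrite /treeY (tree_sum_peel _ xA).
apply: eq_bigr => v _; congr (_ * _); apply: eq_tree_sum => g _ ac /=.
have [->|ne] := eqVneq (exit (A :\ x) g v) (Some x); first by rewrite (negbTE nC) mul0r.
by rewrite mul1r exit_upd_self.
Qed.

Lemma treeY_outside A v C : ~~ inside A v -> treeY A v C = (C v)%:R * treeZ A.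
Proof.
by move=> o; rewrite /treeY /treeZ -tree_sumZ; apply: eq_tree_sum => f _ _; rewrite exit_outside // mulr1.
Qed.

Lemma treeZ0 : treeZ finset.set0 = 1.
Proof.
rewrite /treeZ /tree_sum (big_pred1 [ffun=> None]).
  by rewrite /weight big1 ?mul1r // => y; rewrite inE.
move=> f; apply/andP/eqP => [[/supportedP s _]|->].
  by apply/ffunP => y; rewrite ffunE s // inE.
by split; [apply/supportedP => y; rewrite ffunE|apply/forall_inP => y; rewrite inE].
Qed.

(* A discrete optional stopping theorem: under the tree measure on [A], the law
   of the exit point from [v] is the harmonic measure seen from [v]. *)
Lemma tree_sum_harmonic A (U : option T -> R) v :
  (forall x, x \in A -> \sum_w omega x w * U w = (\sum_w omega x w) * U (Some x)) ->
  tree_sum A (fun f => U (exit A f v)) = treeZ A * U v.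
Proof.
move: {2}#|A| (erefl #|A|) => n; elim: n A v => [|n IH] A v eA hU.
  rewrite /treeZ mulrC -tree_sumZ; apply: eq_tree_sum => f _ _.
  rewrite mulr1 exit_outside //; case: v => //= x.
  by move: eA => /eqP; rewrite cards_eq0 => /eqP ->; rewrite inE.
have [|o] := boolP (inside A v); last first.
  rewrite /treeZ mulrC -tree_sumZ; apply: eq_tree_sum => f _ _.
  by rewrite mulr1 exit_outside.
case: v => //= x xA.
have eA' : #|A :\ x| = n by apply/eqP; rewrite -eqSS -eA (cardsD1 x A) xA.
have hU' y : y \in A :\ x -> \sum_w omega y w * U w = (\sum_w omega y w) * U (Some y).
  by rewrite inE => /andP[_]; exact: hU.
rewrite (tree_sum_peel _ xA) (treeZ_peel xA) mulrBl mulrAC.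
rewrite -hU // !mulr_suml -sumrB; apply: eq_bigr => w _.
(* Arrow by arrow: the forests in which [w] exits at [x] carry the value [U (Some x)] in the
   induction hypothesis, and the cycle term of [treeZ_peel] removes them. *)
rewrite -!mulrA [U w * _]mulrC -IH // [treeY _ _ _ * _]mulrC -mulrBr.
congr (_ * _); rewrite /treeY -tree_sumZ -tree_sumB; apply: eq_tree_sum => g _ ac /=.
have [->|ne] := eqVneq (exit (A :\ x) g w) (Some x); first by rewrite mulr1 mul0r subrr.
by rewrite mulr0 subr0 mul1r exit_upd_self.
Qed.

Hypothesis omega_ge0 : forall y v, 0 <= omega y v.

Lemma weight_ge0 A f : 0 <= weight A f.
Proof. by apply: prodr_ge0. Qed.

Lemma ler_tree_sum A F G :
  (forall f, supported A f -> acyclic A f -> F f <= G f) -> tree_sum A F <= tree_sum A G.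
Proof. by move=> e; apply: ler_sum => f /andP[? ?]; rewrite ler_wpM2l ?weight_ge0 ?e. Qed.

Lemma tree_sum_ge0 A F :
  (forall f, supported A f -> acyclic A f -> 0 <= F f) -> 0 <= tree_sum A F.
Proof. by move=> e; apply: sumr_ge0 => f /andP[? ?]; rewrite mulr_ge0 ?weight_ge0 ?e. Qed.

Lemma treeZ_ge0 A : 0 <= treeZ A.
Proof. exact: tree_sum_ge0. Qed.

Lemma treeY_ge0 A v C : 0 <= treeY A v C.
Proof. by apply: tree_sum_ge0 => *; exact: ler0n. Qed.

Lemma treeY_leZ A v C : treeY A v C <= treeZ A.
Proof. by apply: ler_tree_sum => *; case: (C _). Qed.

(** The induction of [tree_sum_harmonic], with the inequality entering at the peeled site; it stands
    for the supermartingale inequality of a walk stopped on leaving [A]. *)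
Lemma tree_sum_superharmonic A (U : option T -> R) v :
  (forall x, x \in A -> \sum_w omega x w * U w <= (\sum_w omega x w) * U (Some x)) ->
  tree_sum A (fun f => U (exit A f v)) <= treeZ A * U v.
Proof.
move: {2}#|A| (erefl #|A|) => n; elim: n A v => [|n IH] A v eA hU.
  rewrite /treeZ mulrC -tree_sumZ; apply: ler_tree_sum => f _ _.
  rewrite mulr1 exit_outside //; case: v => //= x.
  by move: eA => /eqP; rewrite cards_eq0 => /eqP ->; rewrite inE.
have [|o] := boolP (inside A v); last first.
  rewrite /treeZ mulrC -tree_sumZ; apply: ler_tree_sum => f _ _.
  by rewrite mulr1 exit_outside.
case: v => //= x xA.
have eA' : #|A :\ x| = n by apply/eqP; rewrite -eqSS -eA (cardsD1 x A) xA.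
have hU' y : y \in A :\ x -> \sum_w omega y w * U w <= (\sum_w omega y w) * U (Some y).
  by rewrite inE => /andP[_]; exact: hU.
rewrite (tree_sum_peel _ xA) (treeZ_peel xA) mulrBl mulrAC.
rewrite lerBrDr; apply: le_trans (_ : (\sum_w omega x w * U w) * treeZ (A :\ x) <= _).
  rewrite !mulr_suml -big_split /=; apply: ler_sum => w _.
  rewrite -!mulrA -mulrDr; apply: ler_wpM2l => //.
  rewrite [U w * _]mulrC; apply: le_trans (IH _ w eA' hU').
  rewrite [treeY _ _ _ * _]mulrC /treeY -tree_sumZ -tree_sumD.
  apply: ler_tree_sum => g _ ac /=.
  have [->|ne] := eqVneq (exit (A :\ x) g w) (Some x); first by rewrite mulr1 mul0r add0r.
  by rewrite mulr0 addr0 mul1r exit_upd_self.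
by rewrite ler_wpM2r ?treeZ_ge0 // hU.
Qed.

End tree_sums.

(** * Harmonic functions and forests *)

Lemma big_option (T : finType) (R : nmodType) (F : option T -> R) :
  \sum_v F v = F None + \sum_x F (Some x).
Proof.
rewrite (bigD1 None) //=; congr (_ + _).
rewrite (reindex_omap Some id); last by case.
by apply: eq_bigl => x /=; rewrite eqxx.
Qed.

Section dirichlet.
Variables (T : finType) (R : realFieldType) (omega : T -> option T -> R).
Hypothesis omega_ge0 : forall y v, 0 <= omega y v.
Implicit Types (A : {set T}) (U : option T -> R).

Definition superharmonic A U := forall x, x \in A ->
  \sum_v omega x v * U v <= (\sum_v omega x v) * U (Some x).

Definition harmonic A U := forall x, x \in A ->
  \sum_v omega x v * U v = (\sum_v omega x v) * U (Some x).

(** A strictly superharmonic function certifies that the walk leaves [A]; this covers volumes whose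
    interior sites are not killed. *)
Definition transient A := exists phi : option T -> R,
  (forall v, 0 <= phi v) /\
  forall x, x \in A -> \sum_v omega x v * phi v < (\sum_v omega x v) * phi (Some x).

Lemma transient_sub A A' : A' \subset A -> transient A -> transient A'.
Proof. by move=> /fintype.subsetP s [phi [h1 h2]]; exists phi; split => // x /s; exact: h2. Qed.

Lemma transient_gt0 phi x : (forall v, 0 <= phi v) ->
  \sum_v omega x v * phi v < (\sum_v omega x v) * phi (Some x) ->
  0 < phi (Some x :> option T).
Proof.
move=> p0 h; rewrite lt_def p0 andbT; apply: contraTneq h => ->.
by rewrite mulr0 -leNgt; apply: sumr_ge0 => v _; rewrite mulr_ge0.
Qed.

(** Minimum principle, at a site minimising [U / phi] instead of [U]: the strict inequality for
    [phi] then yields the contradiction without any connectivity of [A]. *)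
Lemma superharmonic_ge0 A U : transient A -> superharmonic A U ->
  (forall v, ~~ inside A v -> 0 <= U v) -> forall v, 0 <= U v.
Proof.
move=> [phi [p0 pA]] sU U0 v; rewrite leNgt; apply/negP => Uv.
have : inside A v by apply: contraTT Uv => /U0; rewrite leNgt.
case: v Uv => //= x0 Ux0 x0A.
case: (@Order.TotalTheory.arg_minP _ _ _ x0 (mem A) (fun x => U (Some x) / phi (Some x)) x0A).
move=> x xA xmin.
have pgt y : y \in A -> 0 < phi (Some y) by move=> yA; exact: transient_gt0 p0 (pA _ yA).
set mu := U (Some x) / phi (Some x).
have mu0 : mu < 0.
  by apply: le_lt_trans (xmin _ x0A) _; rewrite pmulr_llt0 ?invr_gt0 ?pgt.
have low w : mu * phi w <= U w.
  have [|o] := boolP (inside A w); last first.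
    by apply: le_trans (U0 _ o); rewrite nmulr_rle0.
  by case: w => //= y yA; rewrite -ler_pdivlMr ?pgt // xmin.
have := sU x xA; apply/negP; rewrite -ltNge.
have -> : U (Some x) = mu * phi (Some x) by rewrite divfK // gt_eqF ?pgt.
apply: lt_le_trans (_ : mu * \sum_w omega x w * phi w <= _).
  by rewrite mulrCA ltr_nM2l // pA.
rewrite mulr_sumr; apply: ler_sum => w _.
by rewrite mulrCA ler_wpM2l.
Qed.

Lemma comparison A U V : transient A -> superharmonic A V -> harmonic A U ->
  (forall v, ~~ inside A v -> U v <= V v) -> forall v, U v <= V v.
Proof.
move=> tA sV hU le v; rewrite -subr_ge0.
apply: (@superharmonic_ge0 A (fun v => V v - U v)) => // [x xA|w /le]; last by rewrite subr_ge0.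
rewrite mulrBr -hU //; under eq_bigr do rewrite mulrBr.
by rewrite sumrB lerD2r sV.
Qed.

(** By the minimum principle for a solution and its negative, the homogeneous system has only the
    zero solution; the matrix is square, hence invertible. *)
Lemma dirichlet A (q : option T -> R) : transient A ->
  exists U, (forall v, ~~ inside A v -> U v = q v) /\ harmonic A U.
Proof.
move=> tA.
pose e (i : 'I_#|T|) : T := enum_val i.
pose c x := \sum_v omega x v.
(* Column [j] is the equation at the site [e j]: the Laplacian on [A], the boundary value elsewhere.
   The sink is no unknown; its value enters through [rhs]. *)
pose M : 'M[R]_#|T| := \matrix_(i, j)
  if e j \in A then c (e j) *+ (i == j) - omega (e j) (Some (e i)) else (i == j)%:R.
pose rhs : 'rV[R]_#|T| := \row_j
  if e j \in A then omega (e j) None * q None else q (Some (e j)).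
pose F (b : 'rV[R]_#|T|) (qn : R) (v : option T) :=
  if v is Some x then b 0 (enum_rank x) else qn.
have FM b x : (b *m M) 0 (enum_rank x) =
    if x \in A then c x * F b 0 (Some x) - \sum_y omega x (Some y) * F b 0 (Some y)
    else F b 0 (Some x).
  rewrite mxE; under eq_bigr do rewrite mxE /e enum_rankK.
  case: ifP => xA.
    under eq_bigr do rewrite mulrBr.
    rewrite sumrB; congr (_ - _).
      rewrite /F; move: (enum_rank x) => j; rewrite (bigD1 j) //= [X in _ + X]big1 => [|i /negbTE ->].
        by rewrite eqxx mulr1n addr0 mulrC.
      by rewrite mulr0n mulr0.
    rewrite (reindex (@enum_rank T)); last first.
      by exists enum_val => y _; rewrite ?enum_rankK ?enum_valK.
    by apply: eq_bigr => y _; rewrite enum_rankK mulrC.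
  rewrite /F; move: (enum_rank x) => j; rewrite (bigD1 j) //= [X in _ + X]big1 => [|i /negbTE ->].
    by rewrite eqxx mulr1 addr0.
  by rewrite mulr0.
have uM : M \in unitmx.
  rewrite unitmxE unitfE; apply/det0P => -[b b0 bM].
  case/negP: b0; apply/eqP/rowP => j; rewrite mxE.
  have hF : harmonic A (F b 0).
    move=> x xA; have := FM b x; rewrite bM xA mxE => /eqP.
    rewrite eq_sym subr_eq0 => /eqP; rewrite /c => ->.
    by rewrite big_option mulr0 add0r.
  have F0 v : ~~ inside A v -> F b 0 v = 0.
    case: v => //= x /negbTE xA; have := FM b x; rewrite bM xA mxE //.
  have hN : harmonic A (fun v => - F b 0 v).
    move=> x xA; rewrite mulrN -hF // -sumrN.
    by apply: eq_bigr => v _; rewrite mulrN.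
  have -> : b 0 j = F b 0 (Some (e j)) by rewrite /= enum_valK.
  apply/eqP; rewrite eq_le -[X in X && _]oppr_ge0; apply/andP; split.
    apply: (@superharmonic_ge0 A (fun v => - F b 0 v)) => // [x xA|v /F0 ->].
      by rewrite hN.
    by rewrite oppr0.
  by apply: (@superharmonic_ge0 A (F b 0)) => // [x xA|v /F0 ->//]; rewrite hF.
exists (F (rhs *m invmx M) (q None)).
have K x := FM (rhs *m invmx M) x.
rewrite mulmxKV // in K.
split=> [[x|] //= xA|x xA].
  by have := K x; rewrite mxE /e enum_rankK (negbTE xA) => ->.
have := K x; rewrite mxE /e enum_rankK xA => K'.
by rewrite big_option [F _ _ None]/= K' /c subrK.
Qed.

Lemma treeY_harmonic A (C : pred (option T)) U v : harmonic A U ->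
  (forall w, ~~ inside A w -> U w = (C w)%:R) -> treeY omega A v C = treeZ omega A * U v.
Proof.
move=> hU UC; rewrite -(tree_sum_harmonic _ hU); apply: eq_tree_sum => f _ /acyclicP ac.
by rewrite UC.
Qed.

(** [treeZ (A :\ b) / treeZ A] is the Green function at [(b, b)]. The function [V] dominates
    [V (Some b)] times the probability of reaching [b]; inserted in [treeZ_peel], this turns the
    unit charge of [V] at [b] into the bound. *)
Lemma green_diag_le A V b : b \in A -> (forall v, 0 <= V v) -> superharmonic A V ->
  1 <= (\sum_v omega b v) * V (Some b) - \sum_v omega b v * V v ->
  treeZ omega (A :\ b) <= treeZ omega A * V (Some b).
Proof.
move=> bA V0 sV b1.
have sV' : superharmonic (A :\ b) V by move=> x; rewrite inE => /andP[_]; exact: sV.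
have Y w : treeY omega (A :\ b) w (pred1 (Some b)) * V (Some b) <= treeZ omega (A :\ b) * V w.
  rewrite mulrC /treeY -tree_sumZ; apply: le_trans (tree_sum_superharmonic omega_ge0 _ sV').
  apply: ler_tree_sum => // f _ _ /=.
  by case: eqP => [->|_]; rewrite ?mulr1 ?mulr0.
rewrite (treeZ_peel _ bA) mulrBl.
apply: le_trans (_ : treeZ omega (A :\ b) *
    ((\sum_v omega b v) * V (Some b) - \sum_v omega b v * V v) <= _).
  by rewrite ler_peMr // treeZ_ge0.
rewrite mulrBr mulrA [treeZ _ _ * (\sum__ _)]mulrC lerD2l lerN2.
rewrite mulr_suml mulr_sumr; apply: ler_sum => v _.
by rewrite -mulrA [X in _ <= X]mulrCA ler_wpM2l.
Qed.

(** The probability of reaching [b] is at most [V v / V (Some b)]; times the diagonal bound, this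
    gives the Green function at [(v, b)]. *)
Lemma green_le A V b v : b \in A -> (forall v, 0 <= V v) -> superharmonic A V ->
  1 <= (\sum_v omega b v) * V (Some b) - \sum_v omega b v * V v ->
  treeY omega (A :\ b) v (pred1 (Some b)) <= treeZ omega A * V v.
Proof.
move=> bA V0 sV b1.
have Vb : 0 < V (Some b).
  rewrite lt_def V0 andbT; apply: contraTneq b1 => ->.
  rewrite mulr0 sub0r -ltNge; apply: le_lt_trans ltr01.
  by rewrite oppr_le0 sumr_ge0 // => w _; rewrite mulr_ge0.
have sV' : superharmonic (A :\ b) V by move=> x; rewrite inE => /andP[_]; exact: sV.
have := green_diag_le bA V0 sV b1 => Zb.
rewrite -(ler_pM2r Vb); apply: le_trans (_ : treeZ omega (A :\ b) * V v <= _).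
  rewrite mulrC /treeY -tree_sumZ; apply: le_trans (tree_sum_superharmonic omega_ge0 _ sV').
  apply: ler_tree_sum => // f _ _ /=.
  by case: eqP => [->|_]; rewrite ?mulr1 ?mulr0.
by rewrite mulrAC ler_wpM2r.
Qed.

Section green_function.
Variable A : {set T}.
Hypotheses (tA : transient A)
  (omegaC : {in A &, forall x y, omega x (Some y) = omega y (Some x)}).

(** As a function of [v], [treeY omega (A :\ b) v (pred1 (Some b))] is [treeZ omega A] times the
    Green function with pole [b]. *)
Lemma green_equation b : b \in A -> exists g : option T -> R,
  [/\ forall v, g v = treeY omega (A :\ b) v (pred1 (Some b)),
      g (Some b) = treeZ omega (A :\ b),
      forall v, ~~ inside A v -> g v = 0 &
      forall x, x \in A -> (\sum_v omega x v) * g (Some x) - \sum_v omega x v * g v =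
        treeZ omega A *+ (x == b)].
Proof.
move=> bA; have tA' : transient (A :\ b) by apply: transient_sub tA; rewrite subD1set.
have [U [Uq Uh]] := dirichlet (fun v => (v == Some b)%:R) tA'.
exists (fun v => treeY omega (A :\ b) v (pred1 (Some b))).
have gb : treeY omega (A :\ b) (Some b) (pred1 (Some b)) = treeZ omega (A :\ b).
  by rewrite treeY_outside /= ?eqxx ?mul1r // !inE eqxx.
split => //.
  move=> v ov; rewrite treeY_outside; last by case: v ov => //= x; rewrite !inE negb_and => ->; rewrite orbT.
  rewrite /=; case: eqP => [e|]; last by rewrite mul0r.
  by move: ov; rewrite e /= bA.
move=> x xA; have [->|xb] := eqVneq x b.
  by rewrite gb (treeZ_peel _ bA) mulr1n.
have YU v := @treeY_harmonic (A :\ b) (pred1 (Some b)) U v Uh Uq; cbv beta.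
rewrite (YU (Some x)).
have xA' : x \in A :\ b by rewrite !inE xb.
under [X in _ - X]eq_bigr => w _ do rewrite (YU w) mulrCA.
by rewrite -mulr_sumr Uh // mulrCA subrr.
Qed.

(** Summing the Green equation over [A], the interior terms cancel by symmetry of the weights; the
    flow out of [A], at least [s] per unit of mass, balances the charge at [b]. *)
Lemma green_sum_le b (s : R) : b \in A ->
  (forall x, x \in A -> s <= \sum_(v | ~~ inside A v) omega x v) ->
  s * \sum_(x in A) treeY omega (A :\ b) (Some x) (pred1 (Some b)) <= treeZ omega A.
Proof.
move=> bA sA; have [g [gE gb g0 gA]] := green_equation bA.
have eZ : \sum_(x in A) ((\sum_v omega x v) * g (Some x) - \sum_v omega x v * g v) = treeZ omega A.
  rewrite (bigD1 b) //= gA // eqxx mulr1n big1 ?addr0 // => x /andP[xA /negbTE xb].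
  by rewrite gA // xb.
rewrite -[X in _ <= X]eZ sumrB.
have inner x : \sum_v omega x v * g v = \sum_(y in A) omega x (Some y) * g (Some y).
  rewrite big_option g0 // mulr0 add0r [LHS](bigID (mem A)) /= [X in _ + X]big1 ?addr0 // => y yA.
  by rewrite g0 ?mulr0.
under [X in _ <= _ - X]eq_bigr do rewrite inner.
rewrite [X in _ <= _ - X]exchange_big /= mulr_sumr -sumrB.
apply: ler_sum => x xA; rewrite -gE -mulr_suml -mulrBl.
apply: ler_wpM2r; first by rewrite gE treeY_ge0.
apply: le_trans (sA x xA) _.
rewrite lerBrDr addrC (bigID (inside A) predT) /=; apply: lerD => //.
rewrite [X in _ <= X]big_mkcond big_option /= add0r -big_mkcond /=.
by apply: ler_sum => y yA; rewrite omegaC.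
Qed.

End green_function.
End dirichlet.

(** * Rayleigh monotonicity *)

Section restricted_weights.
Variables (T : finType) (R : realFieldType) (J : T -> T -> R).
Hypotheses (J_ge0 : forall x y, 0 <= J x y) (J_sym : forall x y, J x y = J y x).
Implicit Types (A D w : {set T}) (kap : T -> R).

(** Free boundary conditions on [D]: edges leaving [D] are deleted and not turned into killing. *)
Definition free_weight D kap (y : T) (v : option T) : R :=
  if v is Some z then if z \in D then J y z else 0 else kap y.

Lemma free_weight_ge0 D kap y v : (forall x, 0 <= kap x) -> 0 <= free_weight D kap y v.
Proof. by case: v => //= z; case: ifP. Qed.

Lemma eq_treeZ (om om' : T -> option T -> R) A :
  (forall y v, y \in A -> om y v = om' y v) -> treeZ om A = treeZ om' A.
Proof.
move=> e; apply: eq_bigr => f _; congr (_ * _); apply: eq_bigr => y yA; exact: e.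
Qed.

Lemma ler_treeZ (om om' : T -> option T -> R) A : (forall y v, 0 <= om y v) ->
  (forall y v, y \in A -> om y v <= om' y v) -> treeZ om A <= treeZ om' A.
Proof.
move=> o0 e; apply: ler_sum => f _; rewrite !mulr1; apply: ler_prod => y yA.
by rewrite o0 e.
Qed.

Definition incr kap x (t : R) y := if y == x then kap y + t else kap y.

Lemma treeZ_incr D kap x t A : x \in A ->
  treeZ (free_weight D (incr kap x t)) A =
  treeZ (free_weight D kap) A + t * treeZ (free_weight D kap) (A :\ x).
Proof.
move=> xA.
have E G : tree_sum (free_weight D (incr kap x t)) (A :\ x) G = tree_sum (free_weight D kap) (A :\ x) G.
  apply: eq_bigr => f _; congr (_ * _); apply: eq_bigr => y.
  by rewrite !inE => /andP[/negbTE yx _]; case: (f y) => //=; rewrite /incr yx.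
rewrite /treeZ !(tree_sum_peel _ _ xA) !big_option /= /incr eqxx E mulrDl.
rewrite -!addrA; congr (_ + _); rewrite addrC; congr (_ + _).
  by apply: eq_bigr => z _; rewrite E.
congr (_ * _); apply: eq_tree_sum => f _ _.
by rewrite exit_outside //= mul1r.
Qed.

Lemma treeZ_gt0 D kap A : (forall x, 0 < kap x) -> 0 < treeZ (free_weight D kap) A.
Proof.
move=> k0; rewrite /treeZ /tree_sum (bigD1 [ffun=> None]) /=; last first.
  apply/andP; split; first by apply/supportedP => y; rewrite ffunE.
  apply: acyclic_iter => v.
  case: v => [y|]; last by exists 0%N.
  exists 1%N; rewrite /=; case: ifP => /= [|->//]; by rewrite ffunE.
apply: ltr_wpDr; first by apply: sumr_ge0 => f _; rewrite mulr1; apply: prodr_ge0 => y _; apply: free_weight_ge0 => z; exact: ltW.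
by rewrite mulr1; apply: prodr_gt0 => y _; rewrite ffunE /=.
Qed.

Lemma free_transient D kap A : (forall x, 0 < kap x) -> transient (free_weight D kap) A.
Proof.
move=> k0; exists (fun v => (v : bool)%:R); split=> [v|x _]; first exact: ler0n.
rewrite !big_option /= mulr0 mulr1 add0r; under eq_bigr do rewrite mulr1.
by rewrite ltrDr.
Qed.

Lemma sum_free D kap x (U : option T -> R) :
  \sum_v free_weight D kap x v * U v = kap x * U None + \sum_(y in D) J x y * U (Some y).
Proof.
rewrite big_option /=; congr (_ + _); rewrite [RHS]big_mkcond.
by apply: eq_bigr => y _; case: ifP => //; rewrite mul0r.
Qed.

Lemma sum_free1 D kap x :
  \sum_v free_weight D kap x v = kap x + \sum_(y in D) J x y.
Proof.
have := sum_free D kap x (fun=> 1); under eq_bigr do rewrite mulr1; move=> ->.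
by rewrite mulr1; congr (_ + _); apply: eq_bigr => y _; rewrite mulr1.
Qed.

(** The Dirichlet form of [free_weight D kap]; with free boundary conditions it is monotone in
    [D]. *)
Definition energy D kap (h : T -> R) : R :=
  \sum_(y in D) kap y * h y ^+ 2 + 2^-1 * \sum_(y in D) \sum_(z in D) J y z * (h y - h z) ^+ 2.

Lemma energy_ge0 D kap h : (forall x, 0 <= kap x) -> 0 <= energy D kap h.
Proof.
move=> k0; apply: addr_ge0; first by apply: sumr_ge0 => y _; rewrite mulr_ge0 ?sqr_ge0.
rewrite mulr_ge0 ?invr_ge0 //; apply: sumr_ge0 => y _; apply: sumr_ge0 => z _.
by rewrite mulr_ge0 ?sqr_ge0.
Qed.

Lemma energy_le D D' kap h : D' \subset D -> (forall x, 0 <= kap x) ->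
  energy D' kap h <= energy D kap h.
Proof.
move=> /fintype.subsetP s k0.
have L (F G : T -> R) : (forall y, 0 <= G y) -> (forall y, F y <= G y) ->
    \sum_(y in D') F y <= \sum_(y in D) G y.
  move=> G0 FG; rewrite [X in X <= _]big_mkcond [X in _ <= X]big_mkcond /=.
  apply: ler_sum => y _; case: ifP => [/s ->//|_]; by case: ifP.
apply: lerD; first by apply: L => // y; rewrite mulr_ge0 ?sqr_ge0.
rewrite ler_pM2l ?invr_gt0 //; apply: (L) => y.
  by apply: sumr_ge0 => z _; rewrite mulr_ge0 ?sqr_ge0.
by apply: L => // z; rewrite mulr_ge0 ?sqr_ge0.
Qed.

Lemma energyE D kap h : energy D kap h =
  \sum_(y in D) h y * ((kap y + \sum_(z in D) J y z) * h y - \sum_(z in D) J y z * h z).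
Proof.
rewrite /energy.
have -> : \sum_(y in D) \sum_(z in D) J y z * (h y - h z) ^+ 2 =
   2 * \sum_(y in D) \sum_(z in D) J y z * (h y ^+ 2 - h y * h z).
  rewrite mulr2n mulrDl mul1r [X in _ = X + _]exchange_big /= -big_split; apply: eq_bigr => y _ /=.
  by rewrite -big_split; apply: eq_bigr => z _ /=; rewrite (J_sym z y); ring.
rewrite mulrA mulVf ?mul1r ?pnatr_eq0 // -big_split; apply: eq_bigr => y _ /=.
rewrite mulrBr mulrDl mulrDr -addrA; congr (_ + _); first by ring.
rewrite mulr_suml !mulr_sumr -sumrB; apply: eq_bigr => z _; ring.
Qed.

(* Rayleigh monotonicity: [treeZ (D :\ x) / treeZ D] is the diagonal Green function. *)
Lemma rayleigh D D' kap x : (forall y, 0 < kap y) -> D' \subset D -> x \in D' ->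
  treeZ (free_weight D kap) (D :\ x) * treeZ (free_weight D' kap) D' <=
  treeZ (free_weight D' kap) (D' :\ x) * treeZ (free_weight D kap) D.
Proof.
move=> k0 sD xD'; have xD : x \in D by exact: (fintype.subsetP sD).
have k0' y : 0 <= kap y by exact: ltW.
have w0 (E : {set T}) y v : 0 <= free_weight E kap y v by exact: free_weight_ge0.
have [g [_ gx gN gE]] := green_equation (w0 D) (free_transient D D k0) xD.
have [g' [_ gx' gN' gE']] := green_equation (w0 D') (free_transient D' D' k0) xD'.
have Z0 := treeZ_gt0 D D k0; have Z0' := treeZ_gt0 D' D' k0.
rewrite -gx -gx'; set Z := treeZ _ D in gE Z0 *; set Z' := treeZ _ D' in gE' Z0' *.
have G y : y \in D -> (kap y + \sum_(z in D) J y z) * g (Some y) - \sum_(z in D) J y z * g (Some z) = Z *+ (y == x).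
  by move=> yD; have := gE y yD; rewrite sum_free sum_free1 (gN None) // mulr0 add0r.
have G' y : y \in D' -> (kap y + \sum_(z in D') J y z) * g' (Some y) - \sum_(z in D') J y z * g' (Some z) = Z' *+ (y == x).
  by move=> yD; have := gE' y yD; rewrite sum_free sum_free1 (gN' None) // mulr0 add0r.
(* Both Green functions are scaled to the same charge [Z * Z'] at [x]. *)
pose f y := Z' * g (Some y); pose f' y := Z * g' (Some y).
have pick (E : {set T}) (h : T -> R) c : x \in E -> \sum_(y in E) h y * (c *+ (y == x)) = h x * c.
  move=> xE; rewrite (bigD1 x) //= eqxx mulr1n big1 ?addr0 // => y /andP[_ /negbTE ->].
  by rewrite mulr0n mulr0.
have LF y : y \in D -> (kap y + \sum_(z in D) J y z) * f y - \sum_(z in D) J y z * f z = (Z' * Z) *+ (y == x).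
  move=> yD; rewrite -mulrnAr -G // mulrBr mulrCA; congr (_ - _).
  by rewrite mulr_sumr; apply: eq_bigr => z _; rewrite mulrCA.
have LF' y : y \in D' -> (kap y + \sum_(z in D') J y z) * f' y - \sum_(z in D') J y z * f' z = (Z * Z') *+ (y == x).
  move=> yD; rewrite -mulrnAr -G' // mulrBr mulrCA; congr (_ - _).
  by rewrite mulr_sumr; apply: eq_bigr => z _; rewrite mulrCA.
have Ef : energy D kap f = f x * (Z * Z').
  by rewrite energyE -(pick D f _ xD); apply: eq_bigr => y yD; rewrite LF // [Z' * Z]mulrC.
pose L h y := (kap y + \sum_(z in D') J y z) * h y - \sum_(z in D') J y z * h z.
have LB h y : L (fun z => h z - f' z) y = L h y - L f' y.
  rewrite /L mulrBr [X in _ - X](eq_bigr _ (fun z _ => mulrBr (J y z) (h z) (f' z))).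
  by rewrite sumrB; ring.
have Lsym h : \sum_(y in D') h y * L f' y = \sum_(y in D') f' y * L h y.
  rewrite /L; under eq_bigr do rewrite mulrBr mulr_sumr.
  under [RHS]eq_bigr do rewrite mulrBr mulr_sumr.
  rewrite !sumrB; congr (_ - _); first by apply: eq_bigr => y _; ring.
  rewrite exchange_big; apply: eq_bigr => y _; apply: eq_bigr => z _ /=.
  by rewrite (J_sym z y); ring.
have Lf' h : \sum_(y in D') h y * L f' y = h x * (Z * Z').
  by rewrite -(pick _ h _ xD'); apply: eq_bigr => y yD; rewrite /L LF'.
(* For the form on [D'], pairing with [f'] is evaluation at [x] times [Z * Z']. Expanding the
   nonnegative energy of [f - f'] and bounding that of [f] by its energy on [D] leaves
   [f x <= f' x]. *)
have Ed : energy D' kap (fun y => f y - f' y) =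
    energy D' kap f - 2 * (f x * (Z * Z')) + f' x * (Z * Z').
  rewrite -(Lf' f') mulr2n mulrDl mul1r -{1}(Lf' f) Lsym -(Lf' f) !energyE.
  rewrite opprD addrA -!sumrB -big_split /=; apply: eq_bigr => y _.
  by rewrite -!/(L _ _) LB; ring.
have := @energy_ge0 D' kap (fun y => f y - f' y) k0'; rewrite Ed.
have := energy_le f sD k0'; rewrite Ef => le1 le2.
have : 0 <= (f' x - f x) * (Z * Z') by lra.
by rewrite pmulr_lge0 ?mulr_gt0 // subr_ge0 /f /f' mulrC [X in _ <= X]mulrC.
Qed.

Variables (w : {set T}) (M : R).
Hypothesis M_ge0 : 0 <= M.
Let Zfull kap := treeZ (free_weight [set: T]%SET kap) [set: T]%SET.
Let Zout kap := treeZ (free_weight (~: w) kap) (~: w).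

Definition mixed (k1 k2 : T -> R) (D : {set T}) y := if y \in D then k2 y else k1 y.

Lemma mixed_incr k1 k2 D x : x \in D ->
  mixed k1 k2 D =1 incr (mixed k1 k2 (D :\ x)) x (k2 x - k1 x).
Proof.
move=> xD y; rewrite /incr /mixed !inE; case: eqP => [->|_] //=.
by rewrite xD addrC subrK.
Qed.

Lemma eq_treeZ_kap D A k1 k2 : k1 =1 k2 ->
  treeZ (free_weight D k1) A = treeZ (free_weight D k2) A.
Proof. by move=> e; apply: eq_treeZ => y [z|] _ //=. Qed.

(* Extra killing outside [w] only favours [Zout / Zfull] by [rayleigh]; inside
   [w] it multiplies [Zfull] by at most [1 + t M] per site. *)
Lemma killing_ratio k1 k2 t : (forall y, 0 < k1 y) -> (forall y, k1 y <= k2 y) ->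
  (forall y, k2 y <= k1 y + t) ->
  (forall k x, (forall y, k1 y <= k y) ->
     treeZ (free_weight [set: T]%SET k) ([set: T]%SET :\ x) <= M * Zfull k) ->
  Zout k1 * Zfull k2 <= (1 + t * M) ^+ #|w| * (Zout k2 * Zfull k1).
Proof.
move=> k0 k12 k2t bM.
suff H D : Zout k1 * Zfull (mixed k1 k2 D) <=
    (1 + t * M) ^+ #|w :&: D| * (Zout (mixed k1 k2 D) * Zfull k1).
  have := H [set: T]%SET; rewrite finset.setIT.
  by rewrite /Zfull /Zout !(@eq_treeZ_kap _ _ (mixed k1 k2 _) k2) // => y; rewrite /mixed inE.
move: {2}#|D| (erefl #|D|) => n; elim: n D => [|n IH] D eD.
  move/eqP: eD; rewrite cards_eq0 => /eqP ->; rewrite finset.setI0 cards0 expr0 mul1r.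
  by rewrite /Zfull /Zout !(@eq_treeZ_kap _ _ (mixed k1 k2 _) k1) // => y; rewrite /mixed inE.
have : (0 < #|D|)%N by rewrite eD.
rewrite card_gt0 => /set0Pn[x xD].
have eD' : #|D :\ x| = n by apply/eqP; rewrite -eqSS -eD (cardsD1 x D) xD.
have := IH _ eD'; set k := mixed k1 k2 (D :\ x) => IHD.
set u := k2 x - k1 x; have u0 : 0 <= u by rewrite subr_ge0.
have ut : u <= t by rewrite lerBlDl.
have t0 : 0 <= t by exact: le_trans ut.
have kk y : k1 y <= k y by rewrite /k /mixed; case: ifP.
have kp y : 0 < k y by apply: lt_le_trans (kk y).
have Zf : Zfull (mixed k1 k2 D) = Zfull k + u * treeZ (free_weight [set: T]%SET k) ([set: T]%SET :\ x).
  by rewrite /Zfull (eq_treeZ_kap _ _ (mixed_incr k1 k2 xD)) treeZ_incr // inE.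
have Z0 : 0 < Zfull k by exact: treeZ_gt0.
have Z1 : 0 < Zfull k1 by exact: treeZ_gt0.
have O1 : 0 < Zout k1 by exact: treeZ_gt0.
have O0 : 0 < Zout k by exact: treeZ_gt0.
have tM : 0 <= t * M by rewrite mulr_ge0.
have [xw|xw] := boolP (x \in w).
  have -> : Zout (mixed k1 k2 D) = Zout k.
    apply: eq_treeZ => y [z|] //=; rewrite inE => yw; rewrite /k /mixed !inE.
    by have -> : y != x by apply: contraNneq yw => ->.
  rewrite (cardsD1 x) !inE xw xD /= exprS -mulrA.
  have -> : (w :&: D) :\ x = w :&: (D :\ x) by apply/finset.setP => y; rewrite !inE andbCA.
  apply: le_trans (_ : (1 + t * M) * (Zout k1 * Zfull k) <= _); last first.
    by rewrite ler_wpM2l // addr_ge0.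
  rewrite [X in _ <= X]mulrCA; apply: ler_wpM2l; first exact: ltW.
  rewrite Zf [X in _ <= X]mulrDl mul1r lerD2l.
  rewrite -mulrA ler_pM //; first by rewrite treeZ_ge0 // => y v; apply: free_weight_ge0 => z; exact: ltW.
  exact: bM.
have -> : w :&: D = w :&: (D :\ x).
  apply/finset.setP => y; rewrite !inE; case: (eqVneq y x) => [->|] //=.
  by rewrite (negbTE xw).
have Zo : Zout (mixed k1 k2 D) = Zout k + u * treeZ (free_weight (~: w) k) (~: w :\ x).
  by rewrite /Zout (eq_treeZ_kap _ _ (mixed_incr k1 k2 xD)) treeZ_incr // inE.
have ray := @rayleigh [set: T]%SET (~: w) k x kp (finset.subsetT _).
rewrite inE xw in ray; have {}ray := ray isT.
rewrite -(ler_pM2r Z0).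
set c := (1 + t * M) ^+ _ in IHD *.
have c0 : 0 <= c by rewrite exprn_ge0 // addr_ge0.
have key : Zout k * Zfull (mixed k1 k2 D) <= Zout (mixed k1 k2 D) * Zfull k.
  rewrite Zf Zo mulrDr [X in _ <= X]mulrDl lerD2l mulrCA -mulrA ler_wpM2l //.
  by rewrite mulrC.
apply: le_trans (_ : (Zout k1 * Zfull k) * Zfull (mixed k1 k2 D) <= _).
  by rewrite mulrAC.
apply: le_trans (_ : c * (Zout k * Zfull k1) * Zfull (mixed k1 k2 D) <= _).
  rewrite ler_wpM2r // Zf addr_ge0 ?mulr_ge0 ?(ltW Z0) ?treeZ_ge0 // => y v.
  by apply: free_weight_ge0 => z; exact: ltW.
rewrite -!mulrA; apply: ler_wpM2l => //.
rewrite mulrCA [X in _ <= X]mulrCA; apply: ler_wpM2l; first exact: ltW.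
exact: key.
Qed.

(** Each site at which the killing is raised costs a factor [1 + t M]. Here [k1] may vanish, which
    [killing_ratio0] relies on. *)
Lemma killing_growth k1 k2 t : (forall y, 0 <= k1 y) -> (forall y, k1 y <= k2 y) ->
  (forall y, k2 y <= k1 y + t) ->
  (forall k x, (forall y, k1 y <= k y) ->
     treeZ (free_weight [set: T]%SET k) ([set: T]%SET :\ x) <= M * Zfull k) ->
  Zfull k2 <= (1 + t * M) ^+ #|T| * Zfull k1.
Proof.
move=> k0 k12 k2t bM.
suff H D : Zfull (mixed k1 k2 D) <= (1 + t * M) ^+ #|D| * Zfull k1.
  have := H [set: T]%SET; rewrite cardsT.
  by rewrite /Zfull !(@eq_treeZ_kap _ _ (mixed k1 k2 _) k2) // => y; rewrite /mixed inE.
move: {2}#|D| (erefl #|D|) => n; elim: n D => [|n IH] D eD.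
  move/eqP: eD; rewrite cards_eq0 => /eqP ->; rewrite cards0 expr0 mul1r.
  by rewrite /Zfull !(@eq_treeZ_kap _ _ (mixed k1 k2 _) k1) // => y; rewrite /mixed inE.
have : (0 < #|D|)%N by rewrite eD.
rewrite card_gt0 => /set0Pn[x xD].
have eD' : #|D :\ x| = n by apply/eqP; rewrite -eqSS -eD (cardsD1 x D) xD.
have := IH _ eD'; set k := mixed k1 k2 (D :\ x) => IHD.
have u0 : 0 <= k2 x - k1 x by rewrite subr_ge0.
have ut : k2 x - k1 x <= t by rewrite lerBlDl.
have t0 : 0 <= t by exact: le_trans ut.
have kk y : k1 y <= k y by rewrite /k /mixed; case: ifP.
have kp y : 0 <= k y by apply: le_trans (kk y).
rewrite /Zfull (eq_treeZ_kap _ _ (mixed_incr k1 k2 xD)) treeZ_incr ?inE // -/k -/(Zfull k).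
rewrite eD exprS -mulrA.
apply: le_trans (_ : (1 + t * M) * Zfull k <= _); last first.
  by rewrite ler_wpM2l ?addr_ge0 ?mulr_ge0 // -eD'.
rewrite [X in _ <= X]mulrDl mul1r lerD2l -mulrA ler_pM ?bM //.
by rewrite treeZ_ge0 // => y v; exact: free_weight_ge0.
Qed.

End restricted_weights.

(** * Descendants of a set *)

Section descendants.
Variables (T : finType) (R : realFieldType) (omega : T -> option T -> R).
Hypothesis omega_ge0 : forall y v, 0 <= omega y v.
Implicit Types (A B Q w : {set T}) (f g : {ffun T -> option T}) (v : option T).

Lemma iter_next_sub A A' f k v : A' \subset A ->
  exists j, iter j (next A f) v = iter k (next A' f) v.
Proof.
move=> /fintype.subsetP s; elim: k => [|k [j IH]]; first by exists 0%N.
rewrite iterS -IH; set u := iter j _ v.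
have [|o] := boolP (inside A' u); last by exists j; rewrite next_outside.
by case E : u => [y|] //= yA'; exists j.+1; rewrite iterS -/u E /= yA' (s _ yA').
Qed.

Lemma next_ind (K : option T -> bool) A f : (forall v, K v -> K (next A f v)) ->
  forall v, K v -> K (exit A f v).
Proof. by move=> h v Kv; rewrite /exit; elim: #|T| => //= k /h. Qed.

Definition descendant B f x := inside B (exit (~: B) f (Some x)).

Definition descendants B f := [set x | descendant B f x]%SET.

(* A forest in which [w] is the set of descendants of [B] splits into a forest on
   [w] with the first weights and a forest on the complement with the second. *)
Definition inner_weight B w (y : T) v : R :=
  if (y \in B) || inside w v then omega y v else 0.

Definition outer_weight w (y : T) v : R := if inside w v then 0 else omega y v.

Lemma inner_weight_ge0 B w y v : 0 <= inner_weight B w y v.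
Proof. by rewrite /inner_weight; case: ifP. Qed.

Definition restr A f : {ffun T -> option T} := [ffun y => if y \in A then f y else None].

Lemma glue_sum w (a b : {ffun T -> option T} -> R) :
  (forall f, a (restr w f) = a f) -> (forall f, b (restr (~: w) f) = b f) ->
  (\sum_(g | supported w g) a g) * (\sum_(h | supported (~: w) h) b h) = \sum_f a f * b f.
Proof.
move=> la lb; rewrite big_distrlr /= pair_big /=.
pose glue (p : {ffun T -> option T} * {ffun T -> option T}) : {ffun T -> option T} :=
  [ffun y => if y \in w then p.1 y else p.2 y].
rewrite (reindex_onto (fun f => (restr w f, restr (~: w) f)) glue) /=; last first.
  move=> [g h] /= /andP[/supportedP sg /supportedP sh]; congr pair; apply/ffunP => y; rewrite !ffunE ?inE /=.
    by case: (boolP (y \in w)) => yw //=; rewrite sg.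
  by case: (boolP (y \in w)) => yw //=; rewrite sh // inE negbK.
apply: eq_big => [f|f _]; last by rewrite la lb.
have -> : glue (restr w f, restr (~: w) f) = f.
  by apply/ffunP => y; rewrite !ffunE /= !inE; case: (y \in w).
rewrite eqxx andbT; apply/andP; split; apply/supportedP => y yw; rewrite ffunE ?(negbTE yw) //.
Qed.

Lemma treeZ_glue om om' w :
  treeZ om w * treeZ om' (~: w) = \sum_f
    (if acyclic w f && acyclic (~: w) f then weight om w f * weight om' (~: w) f else 0) :> R.
Proof.
have rE A f : {in A, restr A f =1 f} by move=> y yA; rewrite ffunE yA.
have W (o : T -> option T -> R) A f : weight o A (restr A f) = weight o A f.
  by apply: eq_bigr => y /rE ->.
have AC A f : acyclic A (restr A f) = acyclic A f by exact/eq_acyclic/rE.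
rewrite /treeZ /tree_sum !big_mkcondr glue_sum => [|f|f]; rewrite ?AC ?W //.
apply: eq_bigr => f _; case: (acyclic w f) => /=; last by rewrite mul0r.
by case: (acyclic _ f); rewrite ?mulr0 // !mulr1.
Qed.

(** Nothing outside [w] points into [w], so the two forests cannot combine into a cycle; and a
    branch leaves [w] only through [B], so [w] consists exactly of the descendants. *)
Lemma glue_acyclic B w f : B \subset w -> acyclic w f -> acyclic (~: w) f ->
  (forall y, y \in w -> y \notin B -> inside w (f y)) ->
  (forall y, y \notin w -> ~~ inside w (f y)) ->
  acyclic [set: T]%SET f /\ descendants B f = w.
Proof.
move=> Bw /acyclicP aw /acyclicP ac h1 h2.
have out v : ~~ inside w v -> exit (~: w) f v = None.
  move=> nv; have : ~~ inside w (exit (~: w) f v).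
    apply: (@next_ind (fun v => ~~ inside w v) _ f) nv => -[y|] //= yw.
    by rewrite inE yw h2.
  by move: (ac v); case: (exit _ _ _) => //= y; rewrite inE negbK => ->.
have aT : acyclic [set: T]%SET f.
  apply: acyclic_iter => v.
  have [j e] := iter_next_sub f #|T| v (finset.subsetT w).
  have [j' e'] := iter_next_sub f #|T| (exit w f v) (finset.subsetT (~: w)).
  exists (j' + j)%N; rewrite iterD e -[iter _ (next w f) v]/(exit w f v) e'.
  by rewrite -[iter _ _ _]/(exit (~: w) f (exit w f v)) out // aw.
split => //; apply/finset.setP => x; rewrite inE /descendant.
have /acyclicP aB := acyclic_sub (finset.subsetT (~: B)) aT.
have [xw|xw] := boolP (x \in w).
  have : inside w (exit (~: B) f (Some x)).
    apply: (@next_ind (inside w)) => // -[y|] //= yw; rewrite inE.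
    by case: ifP => //= yB; apply: h1.
  by move: (aB (Some x)); case: (exit _ _ _) => //= y; rewrite inE negbK => ->.
have : ~~ inside w (exit (~: B) f (Some x)).
  apply: (@next_ind (fun v => ~~ inside w v)) => // -[y|] //= yw; rewrite inE.
  by case: ifP => //= yB; apply: h2.
by case: (exit _ _ _) => //= y; apply: contraNF; apply: (fintype.subsetP Bw).
Qed.

(** A forest [f] occurs in the double sum for at most one [w], namely [descendants B f]: otherwise
    one of the weights vanishes or [f] violates acyclicity on a piece. *)
Lemma descendants_law B (F : {set T} -> R) : (forall w, 0 <= F w) ->
  \sum_(w : {set T} | B \subset w)
     F w * (treeZ (inner_weight B w) w * treeZ (outer_weight w) (~: w)) <=
  tree_sum omega [set: T]%SET (fun f => F (descendants B f)).
Proof.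
move=> F0; under eq_bigr => w _ do rewrite treeZ_glue mulr_sumr.
rewrite exchange_big /= /tree_sum [X in _ <= X]big_mkcond /=; apply: ler_sum => f _.
have sT : supported [set: T]%SET f by apply/supportedP => y; rewrite inE.
rewrite sT /=.
pose ok w := [&& acyclic w f, acyclic (~: w) f, [forall (y | (y \in w) && (y \notin B)), inside w (f y)]
  & [forall (y | y \notin w), ~~ inside w (f y)]].
have okP w : B \subset w -> ok w -> acyclic [set: T]%SET f /\ descendants B f = w.
  move=> Bw /and4P[a1 a2 /forall_inP h1 /forall_inP h2]; apply: glue_acyclic => //.
  by move=> y yw yB; apply: h1; rewrite yw.
have term w : B \subset w -> F w * (if acyclic w f && acyclic (~: w) f then
   weight (inner_weight B w) w f * weight (outer_weight w) (~: w) f else 0) =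
   if ok w then F w * weight omega [set: T]%SET f else 0.
  move=> Bw; rewrite /ok; case: (acyclic w f) => /=; last by rewrite mulr0.
  case: (acyclic _ f) => /=; last by rewrite mulr0.
  have [/forall_inP h1|] := boolP [forall (y | (y \in w) && (y \notin B)), inside w (f y)] => /=; last first.
    rewrite negb_forall_in => /exists_inP[y /andP[yw yB] ny].
    by rewrite /weight (bigD1 y) //= /inner_weight (negbTE yB) (negbTE ny) !mul0r mulr0.
  have [/forall_inP h2|] := boolP [forall (y | y \notin w), ~~ inside w (f y)] => /=; last first.
    rewrite negb_forall_in => /exists_inP[y yw]; rewrite negbK => ny.
    rewrite /weight [X in _ * (_ * X)](bigD1 y) /= ?inE // /outer_weight ny.
    by rewrite mul0r !mulr0.
  congr (_ * _); rewrite /weight [RHS](bigID (mem w)) /=; congr (_ * _); apply: eq_big => y.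
  - by rewrite inE.
  - move=> yw; rewrite /inner_weight; case: ifP => // /negbT; rewrite negb_or => /andP[yB].
    by rewrite h1 // yw.
  - by rewrite !inE.
  - by rewrite inE => yw; rewrite /outer_weight (negbTE (h2 _ yw)).
rewrite (eq_bigr _ term).
have W0 : 0 <= weight omega [set: T]%SET f by exact: weight_ge0.
have [ac|nac] := boolP (acyclic _ f); last first.
  rewrite big1 // => w Bw; case: ifP => // /(okP _ Bw)[ac]; by rewrite ac in nac.
rewrite big_mkcond /= (bigD1 (descendants B f)) //= big1 => [|w ne].
  rewrite addr0 mulrC; case: ifP => _; last by rewrite mulr_ge0.
  by case: ifP => // _; rewrite mulr_ge0.
case: ifP => // Bw; case: ifP => // /(okP _ Bw)[_ e].
by rewrite e eqxx in ne.
Qed.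

Lemma setD_peel A B y : (A :\ y) :\: B = (A :\: B) :\ y.
Proof. by apply/finset.setP => z; rewrite !inE andbCA. Qed.

(** Union bound over the first site [b] of [B] that is met. Dropping the acyclicity condition on the
    arrow of [b] leaves the factor [\sum_u omega b u]. *)
Lemma hit_le A B v : B \subset A ->
  tree_sum omega A (fun f => (inside B (exit (A :\: B) f v))%:R) <=
  \sum_(b in B) (\sum_u omega b u) * treeY omega (A :\ b) v (pred1 (Some b)).
Proof.
move=> /fintype.subsetP BA.
apply: le_trans (_ : \sum_(b in B) tree_sum omega A (fun f => (exit (A :\ b) f v == Some b)%:R) <= _).
  rewrite -tree_sum_sum; apply: ler_tree_sum => // f _ _.
  case E : (exit (A :\: B) f v) => [b|] /=; last by apply: sumr_ge0.
  case: (boolP (b \in B)) => bB /=; last by apply: sumr_ge0.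
  rewrite (bigD1 b) //=.
  have s : A :\: B \subset A :\ b.
    by apply/fintype.subsetP => y; rewrite !inE => /andP[yB ->]; rewrite andbT; apply: contraNneq yB => ->.
  have [j e] := iter_next_sub f #|T| v s.
  have e' : iter j (next (A :\ b) f) v = Some b by rewrite e -E.
  have o : ~~ inside (A :\ b) (iter j (next (A :\ b) f) v) by rewrite e' /= !inE eqxx.
  by rewrite (exit_iter o) e' eqxx lerDl sumr_ge0.
apply: ler_sum => b bB; rewrite (tree_sum_peel _ _ (BA _ bB)) mulr_suml.
apply: ler_sum => u _; apply: ler_wpM2l => //; apply: ler_tree_sum => // g _ _.
rewrite (eq_exit _ (@upd_in _ A b g u)).
by case: (_ != _); rewrite ?mul1r ?mul0r.
Qed.

Definition chain Q a b := (a \in Q) && (0 < omega a (Some b)).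

(** * Branches passing through a set on their way to the sink *)

Section path_to.
Variables (B : {set T}) (x : T) (beta : R).
Hypothesis beta_ge0 : 0 <= beta.
Hypothesis escape : forall A b z, b \in B -> b \notin A -> x \notin A ->
  connect (chain (~: A)) x b -> 0 < omega b (Some z) -> z \in A ->
  treeY omega A (Some z) (pred1 None) <= beta * treeZ omega A.

(** The peeling follows the branch of [x]: [~: A] holds the part drawn so far and [y] is its tip.
    From the site [b] of [B] where the tip arrives, the branch has to reach the sink without
    touching the drawn part, which joins [x] to [b]. This costs [beta] by [escape]; what remains is
    the Green function from [y] to [b]. *)
Lemma path_to_le A y : x \in y |: ~: A -> y \in A -> connect (chain (~: A)) x y ->
  tree_sum omega A (fun f => (inside B (exit (A :\: B) f (Some y)))%:R * (exit A f (Some y) == None)%:R)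
  <= \sum_(b in B :&: A) (omega b None + beta * \sum_z omega b (Some z)) *
       treeY omega (A :\ b) (Some y) (pred1 (Some b)).
Proof.
move: {2}#|A| (erefl #|A|) => n; elim: n A y => [|n IH] A y eA xQ yA cA.
  by move: eA => /eqP; rewrite cards_eq0 => /eqP e; rewrite e inE in yA.
have eA' : #|A :\ y| = n by apply/eqP; rewrite -eqSS -eA (cardsD1 y A) yA.
have c0 b : 0 <= omega b None + beta * \sum_z omega b (Some z).
  by rewrite addr_ge0 ?mulr_ge0 ?sumr_ge0.
have sA' : subrel (chain (~: A)) (connect (chain (~: (A :\ y)))).
  move=> a b /andP[aA ab]; apply: connect1; rewrite /chain ab andbT !inE.
  by move: aA; rewrite inE => /negbTE ->; rewrite andbF.
have cA' : connect (chain (~: (A :\ y))) x y by exact: connect_sub sA' _ _ cA.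
have xA' : x \notin A :\ y.
  by move: xQ; rewrite !inE => /orP[/eqP ->|/negbTE ->]; rewrite ?eqxx ?andbF.
(* The tip is in [B]: it points either to the sink or to a neighbour, which then has to escape. *)
have [yB|yB] := boolP (y \in B).
  rewrite (bigD1 y) /= ?inE ?yB //.
  apply: ler_wpDr; first by apply: sumr_ge0 => b _; rewrite mulr_ge0 ?treeY_ge0.
  apply: le_trans (_ : treeY omega A (Some y) (pred1 None) <= _).
    by apply: ler_tree_sum => // f _ _; case: (inside _ _); rewrite ?mul1r ?mul0r.
  rewrite treeY_peel // [X in _ <= _ * X]treeY_outside /= ?eqxx ?mul1r ?inE ?eqxx //.
  rewrite big_option mulrDl; apply: lerD.
    by rewrite treeY_outside //= mul1r.
  rewrite -mulrA mulrCA mulr_suml; apply: ler_sum => z _.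
  have [zA|zA] := boolP (z \in A :\ y); last first.
    by rewrite treeY_outside //= mul0r mulr0 mulr_ge0 // mulr_ge0 // treeZ_ge0.
  have := omega_ge0 y (Some z); rewrite le_eqVlt => /orP[/eqP <-|oz]; first by rewrite !mul0r.
  rewrite ler_wpM2l //; apply: (escape yB) => //.
  by rewrite !inE eqxx.
(* Off [B] only steps within [A] count: a step to the sink misses [B], and a step onto a drawn site
   makes the branch exit there instead of at the sink. *)
rewrite (tree_sum_peel _ _ yA).
apply: le_trans (_ : \sum_(z in A :\ y) omega y (Some z) *
   tree_sum omega (A :\ y) (fun f => (inside B (exit ((A :\ y) :\: B) f (Some z)))%:R * (exit (A :\ y) f (Some z) == None)%:R) <= _).
  rewrite big_option [X in _ <= X]big_mkcond /= -[X in _ <= X]add0r; apply: lerD.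
    rewrite -[X in _ <= X](mulr0 (omega y None)); apply: ler_wpM2l => //.
    rewrite -(mul0r (treeZ omega (A :\ y))) /treeZ -tree_sumZ; apply: ler_tree_sum => // g _ ac.
    rewrite mulr1 exit_outside //= mul1r.
    suff -> : inside B (exit (A :\: B) (upd g y None) (Some y)) = false by rewrite mul0r.
    have yAB : y \in A :\: B by rewrite inE yB.
    rewrite (@exit_iter _ _ _ _ 1) /= yAB ffunE eqxx //.
  apply: ler_sum => z _.
  have peel (g : {ffun T -> option T}) : acyclic (A :\ y) g -> exit (A :\ y) g (Some z) != Some y ->
      (exit A (upd g y (Some z)) (Some y) = exit (A :\ y) g (Some z)) /\
      exit (A :\: B) (upd g y (Some z)) (Some y) = exit ((A :\ y) :\: B) g (Some z).
    move=> ac ne; split; first exact: exit_upd_self.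
    have yAB : y \in A :\: B by rewrite inE yB.
    have acT : acyclic A (upd g y (Some z)).
      by rewrite (acyclic_peel _ yA) ffunE eqxx (eq_acyclic (@upd_in _ A y g (Some z))) ac
             (eq_exit _ (@upd_in _ A y g (Some z))).
    rewrite (exit_peel_self yAB (acyclic_sub (finset.subsetDl _ _) acT)) ffunE eqxx setD_peel.
    by apply: eq_exit; apply: upd_in.
  case: ifP => zA.
    apply: ler_wpM2l => //; apply: ler_tree_sum => // g _ ac.
    have [e|ne] := eqVneq (exit (A :\ y) g (Some z)) (Some y); first by rewrite mul0r mulr_ge0.
    by rewrite mul1r; have [-> ->] := peel g ac ne.
  rewrite -[X in _ <= X](mulr0 (omega y (Some z))); apply: ler_wpM2l => //.
  rewrite -(mul0r (treeZ omega (A :\ y))) /treeZ -tree_sumZ; apply: ler_tree_sum => // g _ ac.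
  rewrite mulr1; have [e|ne] := eqVneq (exit (A :\ y) g (Some z)) (Some y); first by rewrite mul0r.
  rewrite mul1r; have [-> _] := peel g ac ne.
  by rewrite [exit (A :\ y) g _]exit_outside /= ?zA // mulr0.
apply: le_trans (_ : \sum_(z in A :\ y) omega y (Some z) *
    \sum_(b in B :&: A) (omega b None + beta * \sum_u omega b (Some u)) *
       treeY omega ((A :\ y) :\ b) (Some z) (pred1 (Some b)) <= _).
  apply: ler_sum => z zA; have := omega_ge0 y (Some z).
  rewrite le_eqVlt => /orP[/eqP <-|oz]; first by rewrite !mul0r.
  apply: ler_wpM2l => //; have -> : B :&: A = B :&: (A :\ y).
    by apply/finset.setP => b; rewrite !inE; case: eqVneq => [->|_] //=; rewrite (negbTE yB).
  apply: IH => //; first by rewrite !inE; move: xA'; rewrite !inE => ->; rewrite orbT.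
  apply: connect_trans cA' (connect1 _).
  by rewrite /chain oz andbT !inE eqxx.
under eq_bigr do rewrite mulr_sumr.
rewrite exchange_big; apply: ler_sum => b; rewrite inE => /andP[bB bA] /=.
have yb : y != b by apply: contraNneq yB => ->.
rewrite (@treeY_peel _ _ _ (A :\ b) y) ?inE ?yb //.
under eq_bigr do rewrite mulrCA; rewrite -mulr_sumr ler_wpM2l //.
rewrite [X in X <= _]big_mkcond [X in _ <= X]big_option /=.
have -> : A :\ b :\ y = A :\ y :\ b by apply/finset.setP => a; rewrite !inE andbCA.
rewrite ler_wpDl ?mulr_ge0 ?treeY_ge0 //; apply: ler_sum => z _.
by case: ifP => // _; rewrite mulr_ge0 ?treeY_ge0.
Qed.

Lemma descendant_le : 
  tree_sum omega [set: T]%SET (fun f => (descendant B f x)%:R * (exit [set: T]%SET f (Some x) == None)%:R) <=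
  \sum_(b in B) (omega b None + beta * \sum_z omega b (Some z)) *
     treeY omega ([set: T]%SET :\ b) (Some x) (pred1 (Some b)).
Proof.
have := @path_to_le [set: T]%SET x; rewrite !inE eqxx connect0 finset.setIT.
have -> : [set: T]%SET :\: B = ~: B by apply/finset.setP => y; rewrite !inE andbT.
by apply.
Qed.
End path_to.

(** * Branches of a net of points, drawn before that of a given site *)

Section net.
Variables (B : {set T}) (x : T) (N : seq T) (eps : R).
Hypothesis eps_ge0 : 0 <= eps.

(** All that is remembered of the drawn branches is this connection to the sink. *)
Definition linked Q z := exists y, [/\ z \in Q, y \in Q, 0 < omega y None &
  connect (fun a b => [&& a \in Q, b \in Q & 0 < omega a (Some b)]) z y].

Hypothesis blocked : forall A, B \subset A -> (forall z, z \in N -> linked (~: A) z) ->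
  tree_sum omega A (fun f => (inside B (exit (A :\: B) f (Some x)))%:R) <= eps * treeZ omega A.

Definition avoids A f v := ~~ inside B (exit (A :\: B) f v).

Definition net_event A v zs f := [&& inside B (exit (A :\: B) f (Some x)),
  all (fun z => avoids A f (Some z)) zs & avoids A f v].

Lemma linked_sub Q Q' z : Q \subset Q' -> linked Q z -> linked Q' z.
Proof.
move=> /fintype.subsetP s [y [zQ yQ o c]]; exists y; split; rewrite ?s //.
apply: connect_sub c => a b /and3P[aQ bQ ab]; apply: connect1.
by rewrite !s.
Qed.

Lemma linked_step Q z y : z \in Q -> 0 < omega z (Some y) -> linked Q y -> linked Q z.
Proof.
move=> zQ o [u [yQ uQ ou c]]; exists u; split => //.
by apply: connect_trans c; apply: connect1; rewrite zQ yQ.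
Qed.

(** The state of Wilson's algorithm started from the net: [A] is undrawn, [Q] consists of completed
    branches, [v] is the tip of the current one and [zs] lists the points to come. The fourth clause
    postpones the claim that the current branch is linked until its tip reaches the sink or a linked
    site. *)
Definition net_state A Q (C : pred (option T)) v (zs : seq T) :=
  [/\ B \subset A, Q \subset ~: A,
     (forall q, q \in Q -> linked Q q) /\
     (forall u, C u -> u = None \/ exists2 q, u = Some q & q \in Q),
     forall Q' : {set T}, ~: A \subset Q' -> (v = None \/ exists2 q, v = Some q & linked Q' q) ->
       forall q, q \in ~: A -> linked Q' q &
     forall z, z \in N -> [|| z \in zs, z \notin A | v == Some z]].

(** The branches of [x] and of [zs] may run through [y]; they then share its exit, which the event
    keeps out of [B]. *)
Lemma net_peel A y (C : pred (option T)) zs : y \in A -> y \notin B -> ~~ C (Some y) ->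
  tree_sum omega A (fun f => (C (exit A f (Some y)) && net_event A (Some y) zs f)%:R) <=
  \sum_u omega y u * tree_sum omega (A :\ y)
    (fun g => (C (exit (A :\ y) g u) && net_event (A :\ y) u zs g)%:R).
Proof.
move=> yA yB nC; rewrite (tree_sum_peel _ _ yA); apply: ler_sum => u _.
apply: ler_wpM2l => //; apply: ler_tree_sum => // g _ ac.
have [e|ne] := eqVneq (exit (A :\ y) g u) (Some y); first by rewrite mul0r ler0n.
rewrite mul1r exit_upd_self // ler_nat; case: (C _) => //=.
set f := upd g y u; set D := A :\: B.
have yD : y \in D by rewrite inE yB.
have acA : acyclic A f.
  by rewrite (acyclic_peel _ yA) ffunE eqxx (eq_acyclic (@upd_in _ A y g u)) ac
             (eq_exit _ (@upd_in _ A y g u)).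
have acD : acyclic D f by exact: acyclic_sub (finset.subsetDl _ _) acA.
have eD v : exit ((A :\ y) :\: B) g v = exit (D :\ y) f v.
  by rewrite setD_peel; apply: eq_exit => z zD; rewrite -(@upd_in _ D y g u).
have ey : exit D f (Some y) = exit (D :\ y) f u.
  by rewrite (exit_peel_self yD acD) ffunE eqxx.
suff : net_event A (Some y) zs f -> net_event (A :\ y) u zs g.
  by case: (net_event A _ _ _) => // ->.
case/and3P => h1 /allP h2 h3; apply/and3P; split; rewrite /avoids ?eD.
- have [e|n] := eqVneq (exit (D :\ y) f (Some x)) (Some y); last first.
    by rewrite -(exit_peel_neq acD n).
  move: h1 h3; rewrite /avoids -/D (exit_peel_eq yD acD e) ey ffunE eqxx => -> //.
- apply/allP => z /h2; rewrite /avoids eD -/D.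
  have [->|n] := eqVneq (exit (D :\ y) f (Some z)) (Some y); first by rewrite /= yB.
  by rewrite -(exit_peel_neq acD n).
- by rewrite -ey.
Qed.

(** Completes the current branch by induction on [A]. A tip in [B] contradicts the event, so [B]
    remains within the undrawn set. *)
Lemma net_inside zs :
  (forall A Q (C : pred (option T)) v, ~~ inside A v -> net_state A Q C v zs ->
    tree_sum omega A (fun f => (C (exit A f v) && net_event A v zs f)%:R) <= eps * treeY omega A v C) ->
  forall A Q (C : pred (option T)) v, net_state A Q C v zs ->
    tree_sum omega A (fun f => (C (exit A f v) && net_event A v zs f)%:R) <= eps * treeY omega A v C.
Proof.
move=> out A; move: {2}#|A| (erefl #|A|) => n; elim: n A => [|n IH] A eA Q C v st.
  apply: out st => //; case: v => //= y; move: eA => /eqP; rewrite cards_eq0 => /eqP ->.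
  by rewrite inE.
have [|o] := boolP (inside A v); last exact: out o st.
case: v st => //= y [BA QA [lQ CQ] path NA] yA.
have eA' : #|A :\ y| = n by apply/eqP; rewrite -eqSS -eA (cardsD1 y A) yA.
have nC : ~~ C (Some y).
  apply/negP => /CQ[//|[q [<-] yQ]]; by have := fintype.subsetP QA _ yQ; rewrite inE yA.
have [yB|yB] := boolP (y \in B).
  apply: le_trans (_ : 0 <= _); last by rewrite mulr_ge0 ?treeY_ge0.
  rewrite -(mul0r (treeZ omega A)) /treeZ -tree_sumZ; apply: ler_tree_sum => // f _ _.
  rewrite mul0r /net_event /avoids [exit (A :\: B) f (Some y)]exit_outside /= ?inE ?yB //.
  by rewrite /= !andbF.
apply: le_trans (net_peel _ yA yB nC) _.
rewrite treeY_peel // mulr_sumr; apply: ler_sum => u _; rewrite mulrCA.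
have := omega_ge0 y u; rewrite le_eqVlt => /orP[/eqP <-|ou]; first by rewrite !mul0r.
apply: ler_wpM2l => //; apply: (IH _ eA' Q).
have sQ : ~: A \subset ~: (A :\ y).
  by apply/fintype.subsetP => z; rewrite !inE negb_and => ->; rewrite orbT.
split => //.
- by apply/fintype.subsetP => b bB; rewrite !inE (fintype.subsetP BA) // andbT; apply: contraNneq yB => <-.
- exact: fintype.subset_trans QA sQ.
- move=> Q' sQ' hu q; rewrite !inE negb_and negbK.
  have yQ' : y \in Q' by apply: (fintype.subsetP sQ'); rewrite !inE eqxx.
  have ly : linked Q' y.
    case: hu => [eu|[z eu lz]]; last by apply: linked_step lz => //; rewrite -eu.
    by exists y; split => //; rewrite -eu.
  case/orP => [/eqP -> //|qA]; apply: (path Q') => //; last by rewrite inE.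
    exact: fintype.subset_trans sQ sQ'.
  by right; exists y.
- move=> z /NA /or3P[-> //|zA|/eqP[<-]]; rewrite !inE ?eqxx ?orbT //.
  by rewrite negb_and zA !orbT.
Qed.

(** When a branch is complete, the next one starts at the head of [zs] and may end on any drawn
    site. Once [zs] is exhausted, every point of the net is linked and [blocked] applies. *)
Lemma net_le zs : forall A Q (C : pred (option T)) v, net_state A Q C v zs ->
    tree_sum omega A (fun f => (C (exit A f v) && net_event A v zs f)%:R) <= eps * treeY omega A v C.
Proof.
elim: zs => [|z0 zs IHzs]; apply: net_inside => A Q C v o [BA QA [lQ CQ] path NA].
all: have [Cv|nC] := boolP (C v); last first.
1,3: by rewrite !treeY_outside // (negbTE nC) mul0r mulr0 -(mul0r (treeZ omega A)) /treeZ -tree_sumZ;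
  apply: ler_tree_sum => // f _ _; rewrite exit_outside // (negbTE nC) mul0r.
all: have lA q : q \in ~: A -> linked (~: A) q.
1,3: by move=> qA; apply: (path (~: A)) => //; case: (CQ _ Cv) => [->|[p -> pQ]];
  [left|right; exists p => //; apply: linked_sub (lQ _ pQ)].
all: rewrite treeY_outside // Cv mul1r.
- apply: le_trans (blocked BA _); last first.
    move=> z /NA /or3P[//|zA|/eqP ev]; apply: lA; rewrite inE //.
    by move: o; rewrite ev.
  apply: ler_tree_sum => // f _ _; rewrite ler_nat /net_event.
  case: (inside B _); first exact: leq_b1.
  by rewrite /= andbF.
apply: le_trans (_ : tree_sum omega A (fun f => ([pred u | ~~ inside A u] (exit A f (Some z0)) &&
    net_event A (Some z0) zs f)%:R) <= _).
  apply: ler_tree_sum => // f _ /acyclicP ac; rewrite ler_nat /= ac /net_event /=.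
  case: (C _) => //=; case: (inside B _) => //=.
  by case: (avoids A f (Some z0)) => //=; case: all => //=; case: avoids.
apply: le_trans (IHzs A (~: A) _ _ _) _.
  split => //.
  - split => // -[q|] /= qA; [right; exists q => //; by rewrite inE|by left].
  - by move=> Q' sQ' _ q /lA; apply: linked_sub.
  - move=> z /NA /or3P[|->|/eqP ev]; rewrite ?orbT //.
      by rewrite inE => /orP[/eqP ->|->]; rewrite ?eqxx ?orbT.
    by move: o; rewrite ev /= => ->; rewrite orbT.
by rewrite ler_wpM2l // treeY_leZ.
Qed.

Lemma net_descendant_le :
  tree_sum omega [set: T]%SET
    (fun f => (descendant B f x && all (fun z => ~~ descendant B f z) N)%:R) <=
  eps * treeZ omega [set: T]%SET.
Proof.
have eB : [set: T]%SET :\: B = ~: B by apply/finset.setP => y; rewrite !inE andbT.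
apply: le_trans (_ : tree_sum omega [set: T]%SET (fun f =>
   (pred1 None (exit [set: T]%SET f None) && net_event [set: T]%SET None N f)%:R) <= _).
  apply: ler_tree_sum => // f _ _; rewrite exit_outside //= ler_nat /net_event /avoids.
  by rewrite eB [exit _ f None]exit_outside //= andbT.
apply: le_trans (@net_le N [set: T]%SET finset.set0 _ _ _) _.
  split; rewrite ?finset.subsetT ?finset.sub0set //.
  - by split=> [q|u /eqP ->]; [rewrite inE|left].
  - by move=> Q' _ _ q; rewrite !inE.
  - by move=> z ->.
by rewrite ler_wpM2l // treeY_leZ.
Qed.

End net.
End descendants.

(** * Volume of burnable configurations *)

Section lebesgue_coordinates.
Variable R : realType.
Local Notation RT := (measurableTypeR R).

Definition unit_itv : set RT := `[0, 1[%classic.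

Lemma measurable_unit_itv : measurable unit_itv.
Proof. exact: measurable_itv. Qed.

Lemma lebesgue_unit_itv : lebesgue_measure (unit_itv : set RT) = 1%E.
Proof. by rewrite /unit_itv lebesgue_measure_itv /= lte_fin ltr01 sube0. Qed.

(** Fubini in one coordinate; with the unit interval as reference, the other coordinates need not be
    split off as a space of their own. *)
Lemma lebesgue_tuple_coord n (j : 'I_n) (S : set (n.-tuple RT)) (J : set RT) :
  measurable S -> measurable J ->
  (forall t t' : n.-tuple RT, (forall i, i != j -> tnth t i = tnth t' i) -> S t -> S t') ->
  (lebesgue_tuple R n (S `&` [set t | J (tnth t j)]) =
   lebesgue_measure J * lebesgue_tuple R n (S `&` [set t | unit_itv (tnth t j)]))%E.
Proof.
elim: n j S => [[]//|n IH] j S mS mJ indS.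
have mC (X : set (n.+1.-tuple RT)) : measurable X -> measurable ((@tuple_cons R n) @^-1` X).
  by move=> mX; apply: (measurable_funPTI (@tuple_cons R n)).
have mK k (K : set RT) (i : 'I_k) : measurable K -> measurable [set t : k.-tuple RT | K (tnth t i)].
  by move=> mK; rewrite -[X in measurable X]setTI; apply: measurable_tnth.
have [j' ej|j0] := unliftP ord0 j; last first.
  rewrite j0.
  have rect (K : set RT) : measurable K -> lebesgue_tuple R n.+1 (S `&` [set t | K (tnth t ord0)]) =
      (lebesgue_measure K * lebesgue_tuple R n [set t | S (tuple_cons (0%R, t))])%E.
    move=> mK'; rewrite -product_measure1E //; last first.
      have -> : [set t : n.-tuple RT | S (tuple_cons (0, t))] = xsection (@tuple_cons R n @^-1` S) (0 : RT).
        by apply/seteqP; split => t; rewrite /xsection /= in_setE.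
      by apply: measurable_xsection; apply: mC.
    rewrite /= /lebesgue_cons /pushforward; congr (product_measure1 _ _ _).
    apply/seteqP; split => -[a t] /= [].
      rewrite (tnth0) => Sa Ka; split => //; apply: indS Sa => i.
      by case: (unliftP ord0 i) => [i' ->|->]; rewrite j0 ?eqxx // => _; rewrite !tnthS.
    move=> Ka Sa; split; last by rewrite tnth0.
    apply: indS Sa => i.
    by case: (unliftP ord0 i) => [i' ->|->]; rewrite j0 ?eqxx // => _; rewrite !tnthS.
  by rewrite !rect ?lebesgue_unit_itv ?mul1e //; exact: measurable_unit_itv.
have mK' (K : set RT) : measurable K ->
    measurable (S `&` [set t | K (tnth t (lift ord0 j'))]).
  by move=> mK0; apply: measurableI => //; exact: mK.
have sec (K : set RT) a : xsection (@tuple_cons R n @^-1` (S `&` [set t | K (tnth t (lift ord0 j'))])) a =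
    [set t | S (tuple_cons (a, t))] `&` [set t | K (tnth t j')].
  by apply/seteqP; split => t; rewrite /xsection /= ?in_setE /= ?in_setE /= tnthS.
have mSx a : measurable [set t : n.-tuple RT | S (tuple_cons (a, t))].
  have -> : [set t : n.-tuple RT | S (tuple_cons (a, t))] = xsection (@tuple_cons R n @^-1` S) a.
    by apply/seteqP; split => t; rewrite /xsection /= in_setE.
  by apply: measurable_xsection; apply: mC.
have iS a (t t' : n.-tuple RT) : (forall i, i != j' -> tnth t i = tnth t' i) ->
    S (tuple_cons (a, t)) -> S (tuple_cons (a, t')).
  move=> e; apply: indS => i; rewrite ej.
  case: (unliftP ord0 i) => [i' ->|-> _]; last by rewrite !tnth0.
  by rewrite (inj_eq lift_inj) => ne; rewrite !tnthS e.
have meas := measurable_fun_xsection (lebesgue_tuple R n) (mC _ (mK' _ measurable_unit_itv)).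
rewrite ej [LHS]/= [X in (_ * X)%E]/= /lebesgue_cons /pushforward /product_measure1.
rewrite -(ge0_integralZl _ _ meas) //.
by apply: eq_integral => a _; rewrite /= !sec (IH j' _ (mSx a) mJ (iS a)).
Qed.

End lebesgue_coordinates.

Section lebesgue_heights_coordinates.
Variables (R : realType) (T : finType).
Local Notation RT := (measurableTypeR R).
Local Notation lam := (@lebesgue_heights T R).
Implicit Types (S : set (heights T R)) (A : {set T}).

Lemma measurable_coordinate (J : set RT) (i : T) : measurable J ->
  measurable [set h : heights T R | J (h i)].
Proof. by move=> mJ; rewrite -[X in measurable X]setTI; exact: measurable_height. Qed.

Definition independent S A := forall h h' : heights T R,
  (forall j, j \notin A -> h j = h' j) -> S h -> S h'.

Lemma lebesgue_heights_coord (i : T) S (J : set RT) :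
  measurable S -> measurable J -> independent S (finset.set1 i) ->
  (lam (S `&` [set h : heights T R | J (h i)]) =
   lebesgue_measure J * lam (S `&` [set h : heights T R | @unit_itv R (h i)]))%E.
Proof.
move=> mS mJ iS; rewrite /lebesgue_heights /pushforward.
have E (K : set RT) : @heights_of_tuple T R @^-1` (S `&` [set h : heights T R | K (h i)]) =
  (@heights_of_tuple T R @^-1` S) `&` [set t | K (tnth t (enum_rank i))] by [].
rewrite !E; apply: lebesgue_tuple_coord => //.
  exact: (measurable_funPTI (@heights_of_tuple T R)).
move=> t t' e; apply: iS => j; rewrite inE => ji; apply: e.
by apply: contra ji => /eqP/enum_rank_inj ->.
Qed.

Variables (a : T -> R) (omega : T -> option T -> R).
Hypothesis omega_ge0 : forall y v, 0 <= omega y v.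

(* The configurations on [A] which Dhar's algorithm burns entirely, heights being
   measured from [a]. *)
Definition burnable A (om : T -> option T -> R) : set (heights T R) :=
  [set h | (forall y, y \in A -> a y <= h y < a y + \sum_v om y v) /\
    forall U : {set T}, U != finset.set0 -> U \subset A ->
      ~ forall y, y \in U -> h y - a y < \sum_(z in U) om y (Some z)].

(** Of volume one in the coordinates of [A]: intersecting with it gives a finite-dimensional meaning
    to the volume of sets independent of these coordinates. *)
Definition unit_box A : set (heights T R) := [set h | forall y, y \in A -> 0 <= h y < 1].

Lemma measurable_forall A (F : T -> set RT) : (forall y, measurable (F y)) ->
  measurable [set h : heights T R | forall y, y \in A -> F y (h y)].
Proof.
move=> mF.
rewrite (_ : [set h | _] = \bigcap_(y in [set y | y \in A]) [set h : heights T R | F y (h y)]) //.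
apply: fin_bigcap_measurable => [|y _]; first exact: finite_finset.
exact: measurable_coordinate.
Qed.

Lemma measurable_burnable A om : measurable (burnable A om).
Proof.
rewrite (_ : burnable A om = [set h : heights T R | forall y, y \in A ->
      [set` `[a y, a y + \sum_v om y v[] (h y)] `&`
   \bigcap_(U in [set U : {set T} | (U != finset.set0) && (U \subset A)])
   ~` [set h : heights T R | forall y, y \in U -> [set` `]-oo, a y + \sum_(z in U) om y (Some z)[] (h y)]).
  apply: measurableI.
    apply: (@measurable_forall A (fun y => [set` `[a y, a y + \sum_v om y v[])) => y.
    exact: measurable_itv.
  apply: fin_bigcap_measurable => [|U _]; first exact: finite_finset.
  apply: measurableC; apply: (@measurable_forall U (fun y => [set` `]-oo, a y + \sum_(z in U) om y (Some z)[])) => y.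
  exact: measurable_itv.
apply/seteqP; split => h [h1 h2]; split.
- by move=> y /h1; rewrite /= in_itv.
- move=> U /= /andP[U0 UA] bad; apply: (h2 U U0 UA) => y /bad.
  by rewrite /= in_itv /= ltrBlDl.
- by move=> y /h1; rewrite /= in_itv.
- move=> U U0 UA bad; apply: (h2 U); first by rewrite /= U0 UA.
  by move=> y /bad; rewrite /= in_itv /= ltrBlDl.
Qed.

Lemma measurable_unit_box A : measurable (unit_box A).
Proof.
rewrite (_ : unit_box A = [set h : heights T R | forall y, y \in A -> [set` `[0, 1[] (h y)]).
  by apply: (@measurable_forall A (fun=> [set` `[0, 1[])) => y; exact: measurable_itv.
by apply/seteqP; split => h hA y /hA; rewrite /= in_itv.
Qed.

Definition seal A (om : T -> option T -> R) x (y : T) v :=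
  if (y == x) && ~~ inside A v then 0 else om y v.

(** Deletion and contraction of the arrows from [x] out of [A]: a forest avoids them, or else [x]
    acts as one more root. *)
Lemma treeZ_seal A (om : T -> option T -> R) x : x \in A ->
  treeZ om A = treeZ (seal A om x) A + (\sum_(v | ~~ inside A v) om x v) * treeZ om (A :\ x).
Proof.
move=> xA; rewrite /treeZ !(tree_sum_peel _ _ xA).
have E G : tree_sum (seal A om x) (A :\ x) G = tree_sum om (A :\ x) G.
  apply: eq_bigr => f _; congr (_ * _); apply: eq_bigr => y.
  by rewrite !inE => /andP[/negbTE yx _]; rewrite /seal yx.
rewrite (bigID (inside A)) /= [X in _ = X + _](bigID (inside A)) /= -addrA; congr (_ + _).
  by apply: eq_bigr => v iv; rewrite E /seal eqxx iv.
rewrite [X in _ = X + _]big1 ?add0r => [|v nv]; last by rewrite /seal eqxx nv mul0r.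
rewrite mulr_suml; apply: eq_bigr => v nv; congr (_ * _); apply: eq_tree_sum => f _ _.
rewrite exit_outside; last by rewrite inside_peel negb_and nv.
by rewrite (_ : v != Some x) ?mul1r //; apply: contraNneq nv => ->.
Qed.

Lemma treeZ_closed A (om : T -> option T -> R) : A != finset.set0 ->
  (forall y v, y \in A -> ~~ inside A v -> om y v = 0) -> treeZ om A = 0.
Proof.
move=> /set0Pn[x xA] cl; rewrite /treeZ /tree_sum big1 // => f /andP[_ /acyclicP ac].
have [/forall_inP h|] := boolP [forall y in A, inside A (f y)]; last first.
  rewrite negb_forall_in => /exists_inP[y yA ny].
  by rewrite /weight (bigD1 y) //= cl // !mul0r.
have := ac (Some x); rewrite (@next_ind _ (inside A)) //.
by case=> //= y yA; rewrite yA h.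
Qed.

(** With [d] the total weight from [x] into [A], a height at or above [a x + d] lets [x] burn at
    once, and a smaller one leaves [x] as if sealed. These two parts obey the recursion of
    [treeZ_seal], so no bijection with trees is required. *)
Lemma lebesgue_burnable A om S : (forall y v, 0 <= om y v) -> measurable S -> independent S A ->
  lam (S `&` burnable A om) = ((treeZ om A)%:E * lam (S `&` unit_box A))%E.
Proof.
move: {2}#|A| (erefl #|A|) => n; elim: n A S om => [|n IHn] A S om eA om0 mS iS.
  have A0 : A = finset.set0 by apply/eqP; rewrite -cards_eq0 eA.
  rewrite A0 treeZ0 mul1e; congr (lam (_ `&` _)); apply/seteqP; split => h _.
    by move=> y; rewrite inE.
  split=> [y|U U0]; first by rewrite inE.
  by rewrite finset.subset0 (negbTE U0).
(* The sites at which fire can enter [A]; the inner induction is on their number. *)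
pose ex (om : T -> option T -> R) := [set y in A | \sum_(v | ~~ inside A v) om y v != 0]%SET.
move: {2}#|ex om| (erefl #|ex om|) => m; elim: m om om0 => [|m IHm] om om0 eX.
  have A0 : A != finset.set0 by rewrite -card_gt0 eA.
  have cl y v : y \in A -> ~~ inside A v -> om y v = 0.
    move=> yA nv; have : y \notin ex om by move/eqP: eX; rewrite cards_eq0 => /eqP ->; rewrite inE.
    rewrite inE yA /= negbK psumr_eq0 // => /allP/(_ v (mem_index_enum v)).
    by rewrite nv => /eqP.
  (* Without an entrance, [A] itself is forbidden and no forest exists: both sides vanish. *)
  rewrite treeZ_closed // mul0e (_ : S `&` _ = set0) ?measure0 //.
  apply/seteqP; split => // h [_ [h1 h2]]; apply: (h2 A) => // y yA.
  have /andP[_] := h1 y yA; rewrite ltrBlDl big_option cl //= add0r.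
  congr (_ < _ + _); rewrite [RHS]big_mkcond; apply: eq_bigr => z _.
  by case: ifP => // /negbT zA; rewrite cl.
have : (0 < #|ex om|)%N by rewrite eX.
rewrite card_gt0 => /set0Pn[x xX]; move: (xX); rewrite inE => /andP[xA ne].
set e := \sum_(v | _) _ in ne.
have e0 : 0 <= e by apply: sumr_ge0.
pose om' := seal A om x.
have om'0 y v : 0 <= om' y v by rewrite /om' /seal; case: ifP.
have eX' : #|ex om'| = m.
  apply/eqP; rewrite -eqSS -eX (cardsD1 x (ex om)) xX add1n eqSS; apply/eqP/eq_card => y.
  rewrite !inE /om' /seal; case: (eqVneq y x) => [->|_] //=.
  by rewrite big1 ?eqxx ?andbF // => v ->.
pose d := \sum_(z in A) om x (Some z).
have d0 : 0 <= d by apply: sumr_ge0.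
have cE : \sum_v om x v = d + e.
  rewrite (bigID (inside A)) /=; congr (_ + _).
  rewrite big_mkcond big_option /= add0r [RHS]big_mkcond; exact: eq_bigr.
have cE' : \sum_v om' x v = d.
  rewrite (bigID (inside A)) /= [X in _ + X]big1 ?addr0 => [|v nv]; last by rewrite /om' /seal eqxx nv.
  rewrite big_mkcond big_option /= add0r [RHS]big_mkcond; apply: eq_bigr => z _.
  by case: ifP => // zA; rewrite /om' /seal /= zA andbF.
have om'n y v : y != x -> om' y v = om y v by rewrite /om' /seal => /negbTE ->.
have om'i y z : z \in A -> om' y (Some z) = om y (Some z) by rewrite /om' /seal /= => ->; rewrite andbF.
pose J : set RT := [set` `[a x + d, a x + (d + e)[].
have mJ : measurable J by exact: measurable_itv.
have split : burnable A om = burnable A om' `|` ([set h | J (h x)] `&` burnable (A :\ x) om).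
  apply/seteqP; split => h.
    move=> [h1 h2]; have [lt|ge] := ltP (h x) (a x + d).
      left; split=> [y yA|U U0 UA].
        have [->|yx] := eqVneq y x; first by rewrite cE' lt andbT; have /andP[] := h1 x xA.
        by rewrite (eq_bigr (om y)) ?h1 // => v _; rewrite om'n.
      move=> bad; apply: (h2 U U0 UA) => y /bad.
      by rewrite (eq_bigr (fun z => om y (Some z))) // => z zU; rewrite om'i // (fintype.subsetP UA).
    right; split; first by rewrite /J /= in_itv /= ge -cE; have /andP[] := h1 x xA.
    split=> [y|U U0 UA]; first by rewrite inE => /andP[_]; exact: h1.
    by apply: h2 => //; apply: fintype.subset_trans UA (subD1set _ _).
  case=> [[h1 h2]|[Jx [h1 h2]]].
    split=> [y yA|U U0 UA].
      have [->|yx] := eqVneq y x.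
        have := h1 x xA; rewrite cE' cE => /andP[-> lt] /=; apply: lt_le_trans lt _.
        by rewrite lerD2l lerDl.
      by have := h1 y yA; rewrite (eq_bigr (om y)) // => v _; rewrite om'n.
    move=> bad; apply: (h2 U U0 UA) => y /bad.
    by rewrite [X in _ -> is_true (_ < X)](eq_bigr (fun z => om y (Some z))) // => z zU; rewrite om'i // (fintype.subsetP UA).
  move: Jx; rewrite /J /= in_itv /= => /andP[Jl Jr]; split=> [y yA|U U0 UA].
    have [->|yx] := eqVneq y x; last by apply: h1; rewrite !inE yx.
    rewrite cE Jr andbT; apply: le_trans Jl; by rewrite lerDl.
  have [xU|xU] := boolP (x \in U).
    move=> /(_ x xU); rewrite ltrBlDl ltNge => /negP; apply; apply: le_trans Jl.
    rewrite lerD2l /d [X in X <= _]big_mkcond [X in _ <= X]big_mkcond; apply: ler_sum => z _.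
    by case: ifP => [/(fintype.subsetP UA) ->//|_]; case: ifP.
  apply: h2 => //; apply/fintype.subsetP => y yU; rewrite !inE (fintype.subsetP UA) // andbT.
  by apply: contraNneq xU => <-.
have mU : lam (S `&` burnable A om) = (lam (S `&` burnable A om') +
    lam (S `&` ([set h | J (h x)] `&` burnable (A :\ x) om)))%E.
  rewrite split setIUr; apply: measureU.
  - by apply: measurableI => //; exact: measurable_burnable.
  - apply: measurableI => //; apply: measurableI; last exact: measurable_burnable.
    exact: measurable_coordinate.
  - apply/seteqP; split => // h [[_ [h1 _]] [_ [Jx _]]].
    have := h1 x xA; rewrite cE' => /andP[_ lt].
    by move: Jx; rewrite /J /= in_itv /= => /andP[]; rewrite leNgt lt.
rewrite mU (IHm om') // setIA IHn //; first last.
- move=> h h' hh' [Sh Jh]; split.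
    by apply: iS Sh => j jA; apply: hh'; rewrite !inE negb_and jA orbT.
  by rewrite /= -hh' // !inE eqxx.
- by apply: measurableI => //; exact: measurable_coordinate.
- by apply/eqP; rewrite -eqSS -eA (cardsD1 x A) xA.
rewrite [S `&` _ `&` unit_box _]setIAC lebesgue_heights_coord //; first last.
- move=> h h' hh' [Sh Uh]; split.
    by apply: iS Sh => j jA; apply: hh'; rewrite inE; apply: contraNneq jA => ->.
  by move=> y; rewrite !inE => /andP[yx yA]; rewrite -hh' ?inE // Uh // !inE yx.
- by apply: measurableI => //; exact: measurable_unit_box.
rewrite -setIA (_ : unit_box (A :\ x) `&` _ = unit_box A); last first.
  apply/seteqP; split => h.
    move=> [h1 h2] y yA; have [->|yx] := eqVneq y x; last by apply: h1; rewrite !inE yx.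
    by move: h2; rewrite /unit_itv /= in_itv.
  move=> h1; split=> [y|]; first by rewrite !inE => /andP[_]; exact: h1.
  by rewrite /unit_itv /= in_itv /= h1.
rewrite /J lebesgue_measure_itv /= lte_fin ltrD2l ltrDl lt0r ne e0 /=.
rewrite (treeZ_seal om xA) -/om' -/e [in RHS]EFinD [RHS]ge0_muleDl ?lee_fin ?mulr_ge0 ?treeZ_ge0 //.
congr (_ + _)%E; rewrite muleA; congr (_ * _)%E.
by rewrite -EFinB -EFinM; congr _%:E; ring.
Qed.

End lebesgue_heights_coordinates.

Section unit_cube.
Variable R : realType.

Lemma lebesgue_tuple_unit n :
  lebesgue_tuple R n [set t | forall i, unit_itv (tnth t i)] = 1%E.
Proof.
elim: n => [|n IH].
  by rewrite /= /dirac indicE mem_set // => -[].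
have mU k : measurable [set t : k.-tuple (measurableTypeR R) | forall i, unit_itv (tnth t i)].
  rewrite (_ : [set t | _] = \bigcap_(i in [set: 'I_k]) [set t | unit_itv (tnth t i)]).
    apply: fin_bigcap_measurable => // i _.
    rewrite -[X in measurable X]setTI; apply: measurable_tnth => //.
    exact: measurable_unit_itv.
  by apply/seteqP; split => [t h i _|t h i]; exact: h.
rewrite /= /lebesgue_cons /pushforward.
rewrite (_ : _ @^-1` _ = @unit_itv R `*` [set t : n.-tuple (measurableTypeR R) | forall i, unit_itv (tnth t i)]).
  have -> := product_measure1E lebesgue_measure (lebesgue_tuple R n) (@measurable_unit_itv R) (mU n).
  rewrite -[RHS]mul1e; congr (_ * _)%E; [exact: lebesgue_unit_itv|exact: IH].
apply/seteqP; split => -[a t] /=.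
  move=> h; split; first by have := h ord0; rewrite tnth0.
  by move=> i; have := h (lift ord0 i); rewrite tnthS.
move=> [ha ht] i; case: (unliftP ord0 i) => [j ->|->]; by rewrite ?tnthS ?tnth0.
Qed.

Lemma lebesgue_unit_box (T : finType) :
  @lebesgue_heights T R (unit_box [set: T]%SET) = 1%E.
Proof.
rewrite /lebesgue_heights /pushforward -[RHS](lebesgue_tuple_unit #|T|).
congr (lebesgue_tuple R _ _); apply/seteqP; split => t /= h.
  move=> i; have := h (enum_val i) (finset.in_setT _).
  by rewrite /heights_of_tuple enum_valK /unit_itv /= in_itv.
by move=> y _; have := h (enum_rank y); rewrite /unit_itv /= in_itv /=.
Qed.

End unit_cube.

(** * Comparison of killings, starting from zero *)

Section killing_ratio_limit.
Variables (T : finType) (R : realFieldType) (J : T -> T -> R).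
Hypotheses (J_ge0 : forall x y, 0 <= J x y) (J_sym : forall x y, J x y = J y x).
Variables (w : {set T}) (M : R).
Hypothesis M_ge0 : 0 <= M.
Let Zfull kap := treeZ (free_weight J [set: T]%SET kap) [set: T]%SET.
Let Zout kap := treeZ (free_weight J (~: w) kap) (~: w).

(** The chord of a convex function of [s] over [[0, 1]]. *)
Lemma expr1D_le (s : R) n : 0 <= s <= 1 -> (1 + s * M) ^+ n <= 1 + s * ((1 + M) ^+ n - 1).
Proof.
move=> /andP[s0 s1]; elim: n => [|n IH]; first by rewrite !expr0 subrr mulr0 addr0.
rewrite !exprS; set C := (1 + M) ^+ n in IH *.
have C1 : 1 <= C by rewrite exprn_ege1 // lerDl.
apply: le_trans (_ : (1 + s * M) * (1 + s * (C - 1)) <= _).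
  by rewrite ler_wpM2l // addr_ge0 // mulr_ge0.
have : 0 <= s * (1 - s) * (M * (C - 1)).
  by rewrite !mulr_ge0 // subr_ge0.
by rewrite -subr_ge0 => h; rewrite -subr_ge0; apply: le_trans h _; rewrite le_eqVlt; apply/orP; left; apply/eqP; ring.
Qed.

Lemma Zfull_ge0 k : (forall y, 0 <= k y) -> 0 <= Zfull k.
Proof. by move=> k0; apply: treeZ_ge0 => y v; exact: free_weight_ge0. Qed.

Lemma Zout_ge0 k : (forall y, 0 <= k y) -> 0 <= Zout k.
Proof. by move=> k0; apply: treeZ_ge0 => y v; exact: free_weight_ge0. Qed.

(** [killing_ratio] asks for positive killing, so it is applied from [k1 + e]. By [killing_growth]
    the return to [k1] costs a factor [1 + e D], and [e] tends to zero. *)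
Lemma killing_ratio0 k1 (t : R) : 0 <= t -> (forall y, 0 <= k1 y) ->
  (forall k x, (forall y, k1 y <= k y) ->
     treeZ (free_weight J [set: T]%SET k) ([set: T]%SET :\ x) <= M * Zfull k) ->
  Zout k1 * Zfull (fun y => k1 y + t) <=
  (1 + t * M) ^+ #|w| * (Zout (fun y => k1 y + t) * Zfull k1).
Proof.
move=> t0 k10 bM; move: (t0); rewrite le_eqVlt => /orP[/eqP <-|tp].
  rewrite mul0r addr0 expr1n mul1r.
  by rewrite /Zfull /Zout !(@eq_treeZ_kap _ _ _ _ _ (fun y => k1 y + 0) k1) // => y; rewrite addr0.
set k2 := fun y => k1 y + t; set Y := _ ^+ _ * _; set X := _ * _.
have k20 y : 0 <= k2 y by rewrite addr_ge0.
have Y0 : 0 <= Y by rewrite !mulr_ge0 ?exprn_ge0 ?addr_ge0 ?mulr_ge0 ?Zout_ge0 ?Zfull_ge0.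
pose D := (1 + M) ^+ #|T| - 1.
have D0 : 0 <= D by rewrite subr_ge0 exprn_ege1 // lerDl.
have step e : 0 < e -> e <= t -> e <= 1 -> X <= Y * (1 + e * D).
  move=> e0 et e1.
  pose ke y := k1 y + e.
  have kep y : 0 < ke y by rewrite ltr_wpDl.
  have r1 := @killing_ratio _ _ _ J_ge0 J_sym w M M_ge0 ke k2 (t - e) kep.
  have {}r1 : Zout ke * Zfull k2 <= (1 + (t - e) * M) ^+ #|w| * (Zout k2 * Zfull ke).
    apply: r1 => [y|y|k x kk].
    - by rewrite /ke /k2 lerD2l.
    - by rewrite /ke /k2 -addrA lerD2l addrC subrK.
    - by apply: bM => y; apply: le_trans (kk y); rewrite lerDl ltW.
  have r2 : Zfull ke <= (1 + e * M) ^+ #|T| * Zfull k1.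
    apply: killing_growth => // y; rewrite /ke ?lerDl ?ltW //.
  have r3 : Zout k1 <= Zout ke.
    apply: ler_treeZ => [y v|y [z|] _ //=]; first exact: free_weight_ge0.
    by rewrite lerDl ltW.
  apply: le_trans (_ : Zout ke * Zfull k2 <= _).
    by rewrite ler_wpM2r ?Zfull_ge0.
  apply: le_trans r1 _.
  apply: le_trans (_ : (1 + t * M) ^+ #|w| * (Zout k2 * ((1 + e * D) * Zfull k1)) <= _).
    apply: ler_pM; rewrite ?exprn_ge0 ?addr_ge0 ?mulr_ge0 ?subr_ge0 ?Zout_ge0 ?Zfull_ge0 //.
    - by move=> y; exact: ltW.
    - apply: lerXn2r; rewrite ?nnegrE ?addr_ge0 ?mulr_ge0 ?subr_ge0 // lerD2l ler_wpM2r //.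
      by rewrite gerBl ltW.
    - rewrite ler_wpM2l ?Zout_ge0 //; apply: le_trans r2 _.
      rewrite ler_wpM2r ?Zfull_ge0 //; apply: expr1D_le; by rewrite ltW.
  by rewrite le_eqVlt /Y; apply/orP; left; apply/eqP; ring.
apply/ler_addgt0Pr => e e0.
pose e' := Num.min (Num.min t 1) (e / (Y * D + 1)).
have YD : 0 < Y * D + 1 by rewrite ltr_wpDl // mulr_ge0.
have e'0 : 0 < e' by rewrite !lt_min tp ltr01 divr_gt0.
have e't : e' <= t by rewrite /e' !ge_min lexx.
have e'1 : e' <= 1 by rewrite /e' !ge_min lexx orbT.
apply: le_trans (step e' e'0 e't e'1) _; rewrite mulrDr mulr1 lerD2l mulrCA.
apply: le_trans (_ : e' * (Y * D + 1) <= _); first by rewrite ler_wpM2l ?(ltW e'0) // lerDl.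
rewrite -ler_pdivlMr // /e' ge_min; apply/orP; right; exact: lexx.
Qed.

End killing_ratio_limit.

(** * Volumes of recurrent configurations, split by the unburnt set *)

Section finite_sandpile.
Variables (R : realType) (T : finType) (adj : rel T) (c : R).
Hypothesis adj_sym : forall y z, adj y z = adj z y.
Definition edge (y z : T) : R := (adj y z)%:R.
Local Notation deg U y := (\sum_(z in U) edge y z).
Hypothesis deg_le : forall y, deg [set: T]%SET y <= c.
Local Notation lam := (@lebesgue_heights T R).
Implicit Types (E S : set (heights T R)) (w B : {set T}).

(** For [c = 2 d]: the dissipation plus the number of neighbours missing from the volume. *)
Definition killing (g : R) (y : T) := c + g - deg [set: T]%SET y.
Definition tree_weight g := free_weight edge [set: T]%SET (killing g).
Definition Ztree g := treeZ (tree_weight g) [set: T]%SET.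
Definition Zrest g w := treeZ (free_weight edge (~: w) (killing g)) (~: w).

Definition recurrent g : set (heights T R) := [set h | (forall y, 0 <= h y < c + g) /\
  forall U : {set T}, U != finset.set0 -> ~ forall y, y \in U -> h y < deg U y].

Lemma edge_ge0 y z : 0 <= edge y z. Proof. exact: ler0n. Qed.

Lemma edge_sym y z : edge y z = edge z y. Proof. by rewrite /edge adj_sym. Qed.

Lemma deg_sub (U V : {set T}) y : U \subset V -> deg U y <= deg V y.
Proof.
move=> UV; rewrite [X in X <= _]big_mkcond [X in _ <= X]big_mkcond; apply: ler_sum => z _.
by case: ifP => [/(fintype.subsetP UV) ->//|_]; case: ifP => // _; exact: edge_ge0.
Qed.

Lemma deg_ge0 (U : {set T}) y : 0 <= deg U y.
Proof. by apply: sumr_ge0 => z _; exact: edge_ge0. Qed.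

Lemma killing_ge g y : g <= killing g y.
Proof. by rewrite /killing addrAC lerDr subr_ge0. Qed.

Lemma tree_weight_ge0 g : 0 <= g -> forall y v, 0 <= tree_weight g y v.
Proof.
move=> g0 y v; apply: free_weight_ge0 => [*|x]; first exact: edge_ge0.
exact: le_trans (killing_ge _ _).
Qed.

Lemma tree_weight_total g y : \sum_v tree_weight g y v = c + g.
Proof. by rewrite sum_free1 /killing subrK. Qed.

Lemma recurrentE g : recurrent g = burnable (fun=> 0) [set: T]%SET (tree_weight g).
Proof.
have eU (U : {set T}) y : \sum_(z in U) tree_weight g y (Some z) = deg U y.
  by apply: eq_bigr => z _; rewrite /tree_weight /= inE.
apply/seteqP; split => h [h1 h2]; split.
- by move=> y _; rewrite tree_weight_total add0r; exact: h1.
- move=> U U0 _ bad; apply: (h2 U U0) => y /bad.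
  by rewrite eU subr0.
- by move=> y; have := h1 y (finset.in_setT y); rewrite tree_weight_total add0r.
- move=> U U0 bad; apply: (h2 U U0 (finset.subsetT U)) => y /bad.
  by rewrite eU subr0.
Qed.

Lemma measurable_recurrent g : measurable (recurrent g).
Proof. by rewrite recurrentE; exact: measurable_burnable. Qed.

Lemma lebesgue_recurrent g : 0 <= g -> lam (recurrent g) = (Ztree g)%:E.
Proof.
move=> g0; rewrite recurrentE.
have := @lebesgue_burnable _ _ (fun=> 0) [set: T]%SET (tree_weight g) setT (tree_weight_ge0 g0) measurableT.
by rewrite !setTI lebesgue_unit_box mule1; apply.
Qed.

Variable B : {set T}.

Definition cylindrical E := independent E (~: B).
(** Heights below [c] are admissible on [B] at every dissipation; this keeps [core] independent of
    [g]. *)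
Definition low_on_B : set (heights T R) := [set h | forall b, b \in B -> 0 <= h b < c].

(* The part of a recurrent configuration carried by the set [w] of sites which
   remain unburnt when [B] is prevented from burning. *)
Definition core E w : set (heights T R) := E `&`
  [set h | forall y, y \in w :\: B -> 0 <= h y < deg w y] `&`
  [set h | forall U : {set T}, U != finset.set0 -> U \subset w ->
     ~ forall y, y \in U -> h y < deg U y].

(** The complement burns while all of [w] is unburnt, so heights there are counted from the degree
    in [w]. *)
Definition layer g w := burnable (fun y => deg w y) (~: w) (free_weight edge (~: w) (killing g)).

Lemma layer_sum g w y : \sum_v free_weight edge (~: w) (killing g) y v = c + g - deg w y.
Proof.
rewrite sum_free1 /killing.
have -> : deg [set: T]%SET y = deg w y + deg (~: w) y.
  rewrite (bigID (mem w)) /=; congr (_ + _); apply: eq_bigl => z; rewrite ?inE //.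
by ring.
Qed.

Lemma degU (w U : {set T}) y : (forall z, z \in w -> z \notin U) ->
  deg (w :|: U) y = deg w y + deg U y.
Proof.
move=> d; rewrite (bigID (mem w)) /=; congr (_ + _); apply: eq_bigl => z.
  by rewrite !inE andbC; case: (z \in w).
rewrite !inE; case: (boolP (z \in w)) => zw; last by rewrite andbT.
by rewrite andbF (negbTE (d z zw)).
Qed.

Lemma measurable_core E w : measurable E -> measurable (core E w).
Proof.
move=> mE; apply: measurableI.
  apply: measurableI => //.
  rewrite (_ : [set h | _] = [set h : heights T R | forall y, y \in w :\: B -> [set` `[0, deg w y[] (h y)]).
    apply: (@measurable_forall _ _ (w :\: B) (fun y => [set` `[0, deg w y[])) => y.
    exact: measurable_itv.
  by apply/seteqP; split => h hA y /hA; rewrite /= in_itv.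
rewrite (_ : [set h | _] = \bigcap_(U in [set U : {set T} | (U != finset.set0) && (U \subset w)])
   ~` [set h : heights T R | forall y, y \in U -> [set` `]-oo, deg U y[] (h y)]).
  apply: fin_bigcap_measurable => [|U _]; first exact: finite_finset.
  apply: measurableC; apply: (@measurable_forall _ _ U (fun y => [set` `]-oo, deg U y[])) => y.
  exact: measurable_itv.
apply/seteqP; split => h hA U.
  by move=> /= /andP[U0 UA] bad; apply: (hA U U0 UA) => y /bad; rewrite /= in_itv.
move=> U0 UA bad; apply: (hA U); first by rewrite /= U0 UA.
by move=> y /bad; rewrite /= in_itv.
Qed.

Lemma core_independent E w : B \subset w -> cylindrical E -> independent (core E w) (~: w).
Proof.
move=> Bw cE h h' e [[h1 h2] h3].
have e' y : y \in w -> h y = h' y by move=> yw; apply: e; rewrite inE yw.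
split; first split.
- by apply: cE h1 => j; rewrite inE negbK => jB; apply: e'; exact: (fintype.subsetP Bw).
- by move=> y yw; rewrite -e' ?h2 //; move: yw; rewrite inE => /andP[].
- move=> U U0 Uw bad; apply: (h3 U U0 Uw) => y yU.
  by rewrite e' ?bad // (fintype.subsetP Uw).
Qed.

(** A forbidden set lies in [w], against the core condition, or its part outside [w] violates the
    burning of the layer. *)
Lemma core_layer E g w : 0 <= g -> E `<=` low_on_B -> B \subset w ->
  core E w `&` layer g w `<=` E `&` recurrent g.
Proof.
move=> g0 El Bw h [[[Eh h2] h3] [h4 h5]]; split => //; split=> [y|U U0 bad].
  have [yw|yw] := boolP (y \in w); last first.
    have := h4 y; rewrite inE yw layer_sum => /(_ isT) /andP[l u].
    by rewrite (le_trans (deg_ge0 w y) l) /=; move: u; rewrite addrC subrK.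
  have [yB|yB] := boolP (y \in B).
    have /andP[-> u] := El h Eh y yB; by rewrite /= (lt_le_trans u) // lerDl.
  have := h2 y; rewrite inE yB yw => /(_ isT) /andP[-> u] /=.
  apply: lt_le_trans u _; apply: le_trans (deg_sub y (finset.subsetT w)) _.
  by apply: le_trans (deg_le y) _; rewrite lerDl.
have [Uw|] := boolP (U \subset w); first exact: (h3 U U0 Uw bad).
rewrite -finset.setD_eq0 => Uw0; apply: (h5 (U :\: w)) => //.
  by apply/fintype.subsetP => y; rewrite !inE => /andP[].
move=> y; rewrite inE => /andP[yw yU]; rewrite ltrBlDr.
apply: lt_le_trans (bad y yU) _.
rewrite [X in _ <= X + _](_ : _ = deg (U :\: w) y); last first.
  by apply: eq_bigr => z; rewrite !inE => /andP[zw _]; rewrite /= inE zw.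
rewrite -degU => [|z]; last by rewrite inE => /andP[].
by apply: deg_sub; apply/fintype.subsetP => z zU; rewrite !inE zU andbT orNb.
Qed.

(** [w] is a largest set containing [B] whose sites off [B] have height below their degree in [w]; a
    set left unburnt outside [w] could be added to it. *)
Lemma core_layer_exists E g h : E `<=` low_on_B -> E h -> recurrent g h ->
  exists2 w : {set T}, B \subset w & (core E w `&` layer g w) h.
Proof.
move=> El Eh [r1 r2].
pose P (w : {set T}) := (B \subset w) && [forall y in w :\: B, h y < deg w y].
have PB : P B.
  by rewrite /P subxx; apply/forall_inP => y; rewrite !inE andNb.
have [w /andP[Bw /forall_inP wP] wmax] : exists2 w, P w & forall w', P w' -> (#|w'| <= #|w|)%N.
  case: (arg_maxnP (fun w : {set T} => #|w|) PB) => w Pw wm; by exists w.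
exists w => //; split.
  split; first split => //.
    by move=> y yw; rewrite wP // andbT; have /andP[] := r1 y.
  by move=> U U0 _; exact: r2.
have noU (U : {set T}) : U != finset.set0 -> U \subset ~: w ->
    ~ forall y, y \in U -> h y < deg (w :|: U) y.
  move=> U0 Uw bad; have /wmax : P (w :|: U).
    rewrite /P (fintype.subset_trans Bw (finset.subsetUl _ _)) /=; apply/forall_inP => y.
    rewrite !inE => /andP[yB /orP[yw|/bad //]].
    apply: lt_le_trans (wP y _) (deg_sub _ (finset.subsetUl _ _)); by rewrite inE yB.
  rewrite leqNgt => /negP; apply; rewrite cardsU (_ : w :&: U = finset.set0); last first.
    by apply/finset.setP => z; rewrite !inE; apply/negP => /andP[zw /(fintype.subsetP Uw)]; rewrite inE zw.
  by rewrite cards0 subn0 -[X in (X < _)%N]addn0 ltn_add2l card_gt0.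
split=> [y yw|U U0 Uw bad].
  rewrite layer_sum addrC subrK; have /andP[_ ->] := r1 y; rewrite andbT leNgt.
  apply/negP => lt; apply: (noU (finset.set1 y)).
  - by apply/finset.set0Pn; exists y; rewrite finset.in_set1.
  - by rewrite finset.sub1set.
  move=> z; rewrite inE => /eqP ->; apply: lt_le_trans lt _.
  exact: deg_sub (finset.subsetUl _ _).
apply: (noU U) => // y yU; have := bad y yU; rewrite ltrBlDl degU => [|z zw]; last by apply/negP => /(fintype.subsetP Uw); rewrite inE zw.
rewrite [X in is_true (_ < _ + X) -> _](eq_bigr (edge y)) // => z zU; have := fintype.subsetP Uw _ zU.
by rewrite /= => ->.
Qed.

(** If [w'] were not contained in [w], the sites of [w' :\: w] would block the burning of the layer
    of [w]. *)
Lemma core_layer_unique E g w w' h : B \subset w -> B \subset w' ->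
  (core E w `&` layer g w) h -> (core E w' `&` layer g w') h -> w = w'.
Proof.
suff H : forall w w', B \subset w -> B \subset w' -> (core E w `&` layer g w) h ->
   (core E w' `&` layer g w') h -> w' \subset w.
  by move=> Bw Bw' h1 h2; apply/eqP; rewrite finset.eqEsubset (H w' w) // (H w w').
move=> {w w'} w w' Bw Bw' [_ [_ l2]] [[[_ c2] _] _].
rewrite -finset.setD_eq0; apply/negPn/negP => U0; apply: (l2 _ U0).
  by apply/fintype.subsetP => y; rewrite !inE => /andP[].
move=> y; rewrite inE => /andP[yw yw']; rewrite ltrBlDl.
have yB : y \notin B by apply: contra yw; exact: (fintype.subsetP Bw).
have := c2 y; rewrite inE yB yw' => /(_ isT) /andP[_ lt]; apply: lt_le_trans lt _.
rewrite [X in _ <= _ + X](_ : _ = deg (w' :\: w) y); last first.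
  by apply: eq_bigr => z; rewrite !inE => /andP[zw _]; rewrite /= inE zw.
rewrite -degU => [|z zw]; last by rewrite inE zw.
by apply: deg_sub; apply/fintype.subsetP => z zU; rewrite !inE zU andbT orbN.
Qed.

Definition core_volume E w := lam (core E w `&` unit_box (~: w)).

Lemma measure_finite_union d (X : measurableType d) (mu : {measure set X -> \bar R})
    (I : finType) (P : pred I) (F : I -> set X) (S : set X) :
  (forall i, P i -> measurable (F i)) ->
  (forall i j x, P i -> P j -> F i x -> F j x -> i = j) ->
  (forall x, S x <-> exists2 i, P i & F i x) ->
  mu S = (\sum_(i | P i) mu (F i))%E.
Proof.
move=> mF dF SE.
pose U (r : seq I) : set X := [set x | exists2 i, i \in r & P i /\ F i x].
have -> : S = U (index_enum I).
  apply/seteqP; split => x; first by move=> /SE[i Pi Fi]; exists i => //; rewrite mem_index_enum.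
  by move=> [i _ [Pi Fi]]; apply/SE; exists i.
suff H : forall r : seq I, uniq r -> measurable (U r) /\ mu (U r) = (\sum_(i <- r | P i) mu (F i))%E.
  by have [_ ->] := H _ (index_enum_uniq I).
elim=> [_|i r IH /= /andP[ir /IH[mU eU]]].
  have -> : U [::] = set0 by apply/seteqP; split => // x [].
  by rewrite big_nil measure0.
rewrite big_cons; case: ifP => Pi; last first.
  suff -> : U (i :: r) = U r by [].
  apply/seteqP; split => x [j jr [Pj Fj]]; exists j => //; last by rewrite inE jr orbT.
  by move: jr; rewrite inE => /orP[/eqP ej|//]; rewrite ej Pi in Pj.
have -> : U (i :: r) = F i `|` U r.
  apply/seteqP; split => x.
    by move=> [j]; rewrite inE => /orP[/eqP -> [_ ?]|jr ?]; [left|right; exists j].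
  by move=> [Fi|[j jr h]]; [exists i => //; rewrite mem_head|exists j => //; rewrite inE jr orbT].
split; first by apply: measurableU => //; exact: mF.
rewrite -eU; apply: measureU => //; first exact: mF.
apply/seteqP; split => // x [Fi [j jr [Pj Fj]]].
by move: ir; rewrite (dF _ _ _ Pi Pj Fi Fj) jr.
Qed.

(** The core is burnable on [w] for [inner_weight]: sites off [B] have no exit from [w], those of
    [B] keep their full range of heights. *)
Lemma core_volume_le E w g : 0 <= g -> measurable E -> E `<=` low_on_B -> B \subset w ->
  (core_volume E w <= (treeZ (inner_weight (tree_weight g) B w) w)%:E)%E.
Proof.
move=> g0 mE El Bw; set om := inner_weight _ _ _.
have om0 y v : 0 <= om y v by apply: inner_weight_ge0 => *; exact: tree_weight_ge0.
have mub : measurable (@unit_box R T (~: w)) by exact: measurable_unit_box.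
have iub : independent (@unit_box R T (~: w)) w.
  by move=> h h' e hu y; rewrite inE => yw; rewrite -e // hu // inE.
have := @lebesgue_burnable _ _ (fun=> 0) w om _ om0 mub iub.
rewrite (_ : _ `&` unit_box w = unit_box [set: T]%SET); last first.
  apply/seteqP; split => h.
    move=> [h1 h2] y _; have [yw|yw] := boolP (y \in w); first exact: h2.
    by apply: h1; rewrite inE.
  by move=> hu; split => y _; apply: hu; rewrite inE.
rewrite lebesgue_unit_box mule1 => <-; apply: le_measure; rewrite ?inE.
- by apply: measurableI => //; exact: measurable_core.
- by apply: measurableI => //; exact: measurable_burnable.
move=> h [[[h1 h2] h3] hu]; split => //.
have eU (U : {set T}) y : U \subset w -> \sum_(z in U) om y (Some z) = deg U y.
  move=> Uw; apply: eq_bigr => z zU; rewrite /om /inner_weight /= (fintype.subsetP Uw) // orbT.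
  by rewrite inE.
split=> [y yw|U U0 Uw bad].
  have [yB|yB] := boolP (y \in B).
    have /andP[-> lt] := El h h1 y yB; rewrite add0r /=; apply: lt_le_trans lt _.
    rewrite (eq_bigr (tree_weight g y)) ?tree_weight_total ?lerDl // => v _.
    by rewrite /om /inner_weight yB.
  have := h2 y; rewrite inE yB yw => /(_ isT) /andP[-> lt]; rewrite add0r /=; apply: lt_le_trans lt _.
  rewrite big_option -(eU w) // [X in _ <= _ + X](bigID (mem w)) /=.
  by rewrite addrCA lerDl addr_ge0 // sumr_ge0.
by apply: (h3 U U0 Uw) => y yU; have := bad y yU; rewrite subr0 eU.
Qed.

Lemma core_volume_fin E w : measurable E -> E `<=` low_on_B -> B \subset w ->
  core_volume E w = (fine (core_volume E w))%:E.
Proof.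
move=> mE El Bw; rewrite fineK //; apply/fin_real/andP; split.
  by apply: lt_le_trans (measure_ge0 _ _); rewrite ltNyr.
by apply: le_lt_trans (core_volume_le (lexx 0) mE El Bw) _; rewrite ltry.
Qed.

(** The dissipation enters only through [Zrest]; the core volumes are common to all [g]. *)
Lemma lebesgue_decomposition E g : 0 <= g -> measurable E -> cylindrical E -> E `<=` low_on_B ->
  lam (E `&` recurrent g) =
  (\sum_(w : {set T} | B \subset w) Zrest g w * fine (core_volume E w))%:E.
Proof.
move=> g0 mE cE El.
rewrite (@measure_finite_union _ _ _ _ (fun w : {set T} => B \subset w)
  (fun w => core E w `&` layer g w)).
- rewrite -sumEFin; apply: eq_bigr => w Bw; rewrite EFinM -core_volume_fin //.
  apply: lebesgue_burnable; last exact: core_independent.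
    by move=> y v; apply: free_weight_ge0 => [*|x]; [exact: edge_ge0|exact: le_trans (killing_ge _ _)].
  exact: measurable_core.
- by move=> w Bw; apply: measurableI; [exact: measurable_core|exact: measurable_burnable].
- by move=> w w' h Bw Bw' h1 h2; apply: (core_layer_unique Bw Bw' h1 h2).
- move=> h; split; first by move=> [Eh Rh]; exact: core_layer_exists.
  by move=> [w Bw hw]; apply: (core_layer g0 El Bw hw).
Qed.

End finite_sandpile.

(** * Comparison of finite sandpiles *)

Section sandpile_comparison.
Variables (R : realType) (T : finType) (adj : rel T) (c : R).
Hypothesis adj_sym : forall y z, adj y z = adj z y.
Hypothesis deg_le : forall y, \sum_(z in [set: T]%SET) edge R adj y z <= c.
Local Notation lam := (@lebesgue_heights T R).
Local Notation rec g := (recurrent adj c g).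
Local Notation Zt g := (Ztree adj c g).
Local Notation tw g := (tree_weight adj c g).
Local Notation kil g := (killing adj c g).
Implicit Types (E : set (heights T R)) (g s t M : R).

Definition sandpile_mass g E := fine (lam (E `&` rec g)) / Zt g.

Lemma killing_ge0 g y : 0 <= g -> 0 <= kil g y.
Proof. by move=> g0; apply: le_trans (killing_ge deg_le g y). Qed.

Lemma Ztree_ge0 g : 0 <= g -> 0 <= Zt g.
Proof. by move=> g0; apply: treeZ_ge0; exact: tree_weight_ge0. Qed.

Lemma lebesgue_recurrent_fin g E : 0 <= g -> measurable E ->
  lam (E `&` rec g) \is a fin_num.
Proof.
move=> g0 mE; have mR := measurable_recurrent adj c g.
apply/fin_real/andP; split.
  by apply: lt_le_trans (measure_ge0 _ _); rewrite ltNyr.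
apply: le_lt_trans (_ : lam (rec g) < +oo)%E.
  by apply: le_measure; rewrite ?inE //; apply: measurableI.
by rewrite lebesgue_recurrent // ltry.
Qed.

Lemma sandpile_mass_le g E E' : 0 <= g -> measurable E -> measurable E' -> E `<=` E' ->
  sandpile_mass g E <= sandpile_mass g E'.
Proof.
move=> g0 mE mE' EE; rewrite ler_wpM2r ?invr_ge0 ?Ztree_ge0 //.
have mR := measurable_recurrent adj c g.
rewrite fine_le ?lebesgue_recurrent_fin //; apply: le_measure; rewrite ?inE; try exact: measurableI.
exact: setSI.
Qed.

(** Bernoulli's inequality for [(1 + x)^-n]: it linearises the loss in the size of the unburnt
    set. *)
Lemma bernoulli_inverse (x : R) n : 0 <= x -> (1 - n%:R * x) * (1 + x) ^+ n <= 1.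
Proof.
move=> x0; elim: n => [|n IH]; first by rewrite mul0r subr0 expr0 mulr1.
apply: le_trans IH; rewrite exprS mulrA ler_wpM2r ?exprn_ge0 ?addr_ge0 //.
have : 0 <= n.+1%:R * x ^+ 2 by rewrite mulr_ge0 // sqr_ge0.
by rewrite -(natr1 n); nra.
Qed.

Variables (B : {set T}) (s t M : R).
Hypotheses (s_ge0 : 0 <= s) (t_ge0 : 0 <= t) (M_ge0 : 0 <= M).
Hypothesis green_bound : forall (k : T -> R) x, (forall y, kil s y <= k y) ->
  treeZ (free_weight (edge R adj) [set: T]%SET k) ([set: T]%SET :\ x) <=
  M * treeZ (free_weight (edge R adj) [set: T]%SET k) [set: T]%SET.

Lemma Ztree_gt0 : 0 < Zt s.
Proof.
pose k y := kil s y + 1.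
have k0 y : 0 < k y by rewrite ltr_wpDl // killing_ge0.
have J0 := @edge_ge0 R T adj.
have := @treeZ_gt0 _ _ _ J0 [set: T]%SET k [set: T]%SET k0.
have h := @killing_growth T R (edge R adj) J0 M M_ge0 (kil s) k 1.
have {}h := h (fun y => killing_ge0 y s_ge0) _ _ green_bound.
have {}h : treeZ (free_weight (edge R adj) [set: T]%SET k) [set: T]%SET <=
    (1 + 1 * M) ^+ #|T| * Zt s.
  by apply: h => y; rewrite /k ?lerDl.
move=> Zk; have := lt_le_trans Zk h.
by rewrite pmulr_rgt0 // exprn_gt0 // ltr_wpDr // mul1r.
Qed.

Lemma killingD y : kil (s + t) y = kil s y + t.
Proof. by rewrite /killing; ring. Qed.

Definition expected_loss :=
  (Zt s)^-1 * tree_sum (tw s) [set: T]%SET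
    (fun f => Num.min 1 (#|descendants B f|%:R * (t * M))).

(** Carried out term by term in [lebesgue_decomposition]. The loss is measured by the forests at the
    smaller dissipation [s], so no estimate at [s + t] is called for. *)
Lemma sandpile_mass_comparison E : measurable E -> cylindrical B E -> E `<=` low_on_B c B ->
  sandpile_mass s E - expected_loss <= sandpile_mass (s + t) E.
Proof.
move=> mE cE El.
have J0 := @edge_ge0 R T adj; have Js := edge_sym R adj_sym.
have st0 : 0 <= s + t by rewrite addr_ge0.
pose k w := fine (core_volume adj B E w).
have dec g : 0 <= g -> lam (E `&` rec g) =
    (\sum_(w : {set T} | B \subset w) Zrest adj c g w * k w)%:E.
  by move=> g0; exact: lebesgue_decomposition.
rewrite /sandpile_mass !dec //=.
pose a w := Zrest adj c s w.
set z := Zt s; have z0 : 0 < z := Ztree_gt0.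
have y0 : 0 < Zt (s + t).
  move: t_ge0; rewrite le_eqVlt => /orP[/eqP <-|tp]; first by rewrite addr0 z0.
  by apply: treeZ_gt0 => // y; rewrite killingD ltr_wpDl // killing_ge0.
set yy := Zt (s + t) in y0 *.
rewrite lerBlDr !mulr_suml.
have k0 w : 0 <= k w by rewrite fine_ge0 // measure_ge0.
have a0 w : 0 <= a w.
  by apply: treeZ_ge0 => y v; apply: free_weight_ge0 => // x; exact: killing_ge0.
have x0 : 0 <= t * M by rewrite mulr_ge0.
apply: le_trans (_ : \sum_(w : {set T} | B \subset w) (Zrest adj c (s + t) w * k w / yy +
   z^-1 * (Num.min 1 (#|w|%:R * (t * M)) * (k w * a w))) <= _).
  apply: ler_sum => w Bw; rewrite -/(a w).
  have ratio : a w * yy <= (1 + t * M) ^+ #|w| * (Zrest adj c (s + t) w * z).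
    have := @killing_ratio0 _ _ _ J0 Js w M M_ge0 (kil s) t t_ge0 (fun y => killing_ge0 y s_ge0) green_bound.
    rewrite /a /yy /z /Ztree /Zrest !(@eq_treeZ_kap _ _ _ _ _ (fun y => kil s y + t) (kil (s + t))) //; by move=> y; rewrite killingD.
  set b := Zrest _ _ _ w in ratio *; set n := #|w| in ratio *; set q := (1 + t * M) ^+ n in ratio *.
  have q0 : 0 < q by rewrite exprn_gt0 // ltr_wpDr.
  have b0 : 0 <= b.
    by apply: treeZ_ge0 => y v; apply: free_weight_ge0 => // x; exact: killing_ge0.
  have key : a w / z * (1 - Num.min 1 (n%:R * (t * M))) <= b / yy.
    case: (leP 1 (n%:R * (t * M))) => [le1|/ltW lt1].
      by rewrite subrr mulr0 divr_ge0 // ltW.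
    rewrite mulrAC ler_pdivrMr // mulrAC ler_pdivlMr // mulrAC.
    apply: le_trans (_ : q * (b * z) * (1 - n%:R * (t * M)) <= _).
      by rewrite ler_wpM2r // subr_ge0.
    have := bernoulli_inverse n x0; rewrite -/q => bq.
    have : (b * z) * ((1 - n%:R * (t * M)) * q) <= (b * z) * 1.
      by rewrite ler_wpM2l // mulr_ge0 // ltW.
    by rewrite mulr1 => h; apply: le_trans h; rewrite le_eqVlt; apply/orP; left; apply/eqP; ring.
  have := ler_wpM2r (k0 w) key.
  set mm := Num.min _ _ => h; rewrite [b * _ / _]mulrAC.
  have -> : a w * k w / z = a w / z * (1 - mm) * k w + z^-1 * (mm * (k w * a w)) by ring.
  by rewrite lerD2r.
rewrite big_split /= lerD2l -mulr_sumr ler_wpM2l ?invr_ge0 ?(ltW z0) //.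
have w0 := tree_weight_ge0 deg_le s_ge0.
apply: le_trans (descendants_law w0 B (F := fun w => Num.min 1 (#|w|%:R * (t * M))) _); last first.
  by move=> w; rewrite le_min ler01 mulr_ge0.
apply: ler_sum => w Bw; apply: ler_wpM2l; first by rewrite le_min ler01 mulr_ge0.
apply: ler_pM => //.
  have := core_volume_le deg_le s_ge0 mE El Bw.
  by rewrite (core_volume_fin deg_le mE El Bw) lee_fin.
rewrite /a /Zrest le_eqVlt; apply/orP; left; apply/eqP; apply: eq_treeZ => y [u|] yw //=.
by rewrite /outer_weight /= !inE; case: (u \in w).
Qed.

End sandpile_comparison.

(** * The lattice *)

Section lattice.
Variable d : nat.
Implicit Types (x y z b : 'rV[int]_d).

Definition nrm x : nat := \max_(i < d) absz (x 0%R i).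
Definition unit_vec (i : 'I_d) : 'rV[int]_d := delta_mx 0 i.

Lemma nrm_le x n : (nrm x <= n)%N = [forall i, (absz (x 0%R i) <= n)%N].
Proof.
apply/idP/forallP => [h i|h]; first by apply: leq_trans h; exact: (leq_bigmax i).
by apply/bigmax_leqP => i _.
Qed.

Lemma absz_nrm x i : (absz (x 0%R i) <= nrm x)%N.
Proof. exact: (leq_bigmax i). Qed.

Lemma nrmD x y : (nrm (x + y) <= nrm x + nrm y)%N.
Proof.
rewrite nrm_le; apply/forallP => i; rewrite mxE.
have := absz_nrm x i; have := absz_nrm y i.
move: (x 0%R i) (y 0%R i) (nrm x) (nrm y) => a b m n; lia.
Qed.

Lemma nrmN x : nrm (- x) = nrm x.
Proof. by apply: eq_bigr => i _; rewrite mxE abszN. Qed.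

Lemma nrm_sym x y : nrm (x - y) = nrm (y - x).
Proof. by rewrite -nrmN opprB. Qed.

Lemma nrm_tri x y z : (nrm (x - z) <= nrm (x - y) + nrm (y - z))%N.
Proof. by apply: leq_trans (nrmD _ _); rewrite addrA subrK. Qed.

Lemma nrm0 : nrm 0 = 0%N.
Proof. by apply/eqP; rewrite -leqn0 nrm_le; apply/forallP => i; rewrite mxE. Qed.

Lemma nrm_eq0 x : (nrm x == 0)%N = (x == 0).
Proof.
apply/idP/eqP => [|->]; last by rewrite nrm0.
rewrite -leqn0 nrm_le => /forallP h; apply/rowP => i; rewrite mxE.
by have := h i; rewrite leqn0 absz_eq0 => /eqP.
Qed.

Lemma nrm_unit i : nrm (unit_vec i) = 1%N.
Proof.
apply/eqP; rewrite eqn_leq nrm_le; apply/andP; split.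
  by apply/forallP => j; rewrite mxE; case: eqP => //=; case: eqP.
by apply: leq_trans (absz_nrm _ i); rewrite mxE !eqxx.
Qed.

Lemma nnP x y : reflect (exists i, x = y + unit_vec i \/ x = y - unit_vec i) (nearest_neighbours x y).
Proof.
apply: (iffP eqP) => [h|[i h]].
  have [i hi|h0] := pickP (fun i => x 0 i - y 0 i != 0); last first.
    move: h; rewrite big1 // => i _; have /negbFE/eqP -> := h0 i; exact: normr0.
  have ge0 j : 0 <= `|x 0 j - y 0 j| by [].
  move: h; rewrite (bigD1 i) //= => h.
  have n1 : 1 <= `|x 0 i - y 0 i| by move: hi; rewrite -normr_gt0; lia.
  have s0 : 0 <= \sum_(j < d | j != i) `|x 0 j - y 0 j| by apply: sumr_ge0.
  have e0 : \sum_(j < d | j != i) `|x 0 j - y 0 j| = 0.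
    by move: h n1 s0; move: (\sum_(j < d | _) _) (`|_|) => u v; lia.
  have e j : j != i -> x 0 j = y 0 j.
    move=> ji; move/eqP: e0; rewrite psumr_eq0 // => /allP/(_ j (mem_index_enum j)).
    by rewrite ji normr_eq0 subr_eq0 => /eqP.
  exists i; have : x 0 i - y 0 i = 1 \/ x 0 i - y 0 i = -1.
    by move: h; rewrite e0 addr0; move: (x 0 i - y 0 i) => u; lia.
  case=> hx; [left|right]; apply/rowP => j; rewrite !mxE; case: (eqVneq j i) => [->|ji] /=.
  - by rewrite -[LHS](subrK (y 0 i)) hx ?eqxx addrC.
  - by rewrite ?andbF addr0 e.
  - by rewrite -[LHS](subrK (y 0 i)) hx ?eqxx addrC.
  - by rewrite ?andbF subr0 e.
rewrite (bigD1 i) //= big1 => [|j ji].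
  by case: h => ->; rewrite !mxE !eqxx /=; lia.
by case: h => ->; rewrite !mxE (negbTE ji) ?andbF /= ?addr0 ?subr0 subrr normr0.
Qed.

Lemma nn_sym x y : nearest_neighbours x y = nearest_neighbours y x.
Proof. by rewrite /nearest_neighbours; congr (_ == _); apply: eq_bigr => i _; rewrite distrC. Qed.

Lemma nrm_nn x y b : nearest_neighbours x y -> (nrm (x - b)%R <= (nrm (y - b)%R).+1)%N.
Proof.
move=> /nnP[i h]; apply: leq_trans (nrm_tri x y b) _.
apply: (@leq_add _ _ 1%N (nrm (y - b)%R)) => //.
by case: h => ->; rewrite addrAC subrr add0r ?nrmN nrm_unit.
Qed.

Lemma unit_vec_inj i j : unit_vec i = unit_vec j -> i = j.
Proof.
move=> /rowP/(_ i); rewrite !mxE !eqxx /= => h.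
by move: h; case: eqP.
Qed.

Lemma unit_vecN i j : unit_vec i <> - unit_vec j.
Proof.
move=> /rowP/(_ i); rewrite !mxE !eqxx /=; by case: (i == j).
Qed.

Section sums.
Variable R : realType.
Implicit Types F : 'rV[int]_d -> R.

Definition nbr_sum F x : R := \sum_(i < d) (F (x + unit_vec i) + F (x - unit_vec i)).

Definition sq x : R := \sum_(i < d) ((x 0 i)%:~R) ^+ 2.

Lemma nn_indicator x y : (nearest_neighbours x y)%:R =
  \sum_(i < d) ((x == y + unit_vec i)%:R + (x == y - unit_vec i)%:R) :> R.
Proof.
have [/nnP[i h]|nn] := boolP (nearest_neighbours x y); last first.
  rewrite big1 // => i _; have /eqP/negbTE -> : x <> y + unit_vec i.
    by move=> e; case/nnP: nn; exists i; left.
  have /eqP/negbTE -> : x <> y - unit_vec i.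
    by move=> e; case/nnP: nn; exists i; right.
  by rewrite addr0.
rewrite (bigD1 i) //= big1 ?addr0 => [|j ji].
  case: h => ->; rewrite eqxx.
    rewrite (_ : (_ == _) = false) ?addr0 //; apply/eqP => /addrI; exact: unit_vecN.
  rewrite (_ : (_ == _) = false) ?add0r //; apply/eqP => /addrI /esym; exact: unit_vecN.
case: h => ->.
  rewrite (_ : (_ == _) = false); last by apply/eqP => /addrI/unit_vec_inj e; rewrite e eqxx in ji.
  by rewrite (_ : (_ == _) = false) ?addr0 //; apply/eqP => /addrI; exact: unit_vecN.
rewrite (_ : (_ == _) = false); last by apply/eqP => /addrI /esym; exact: unit_vecN.
rewrite (_ : (_ == _) = false) ?addr0 //.
by apply/eqP => /addrI/oppr_inj/unit_vec_inj e; rewrite e eqxx in ji.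
Qed.

Variable L : {fset 'rV[int]_d}.
Definition site_adj (y z : L) := nearest_neighbours (val z) (val y).

Lemma site_adj_sym (y z : L) : site_adj y z = site_adj z y.
Proof. exact: nn_sym. Qed.

Lemma sum_site_eq F p : \sum_(z : L) ((val z == p)%:R * F (val z)) = (p \in L)%:R * F p.
Proof.
have [pL|pL] := boolP (p \in L); last first.
  by rewrite mul0r big1 // => z _; case: eqP => [e|]; rewrite ?mul0r //; rewrite -e (valP z) in pL.
rewrite (bigD1 [` pL]%fset) //= eqxx !mul1r big1 ?addr0 // => z zp.
case: eqP => [e|]; rewrite ?mul0r //; case/negP: zp; apply/eqP/val_inj; exact: e.
Qed.

Lemma sum_edgeE F (y : L) : \sum_(z : L) edge R site_adj y z * F (val z) =
  \sum_(i < d) ((val y + unit_vec i \in L)%:R * F (val y + unit_vec i) +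
                (val y - unit_vec i \in L)%:R * F (val y - unit_vec i)).
Proof.
under eq_bigr do rewrite /edge /site_adj nn_indicator mulr_suml.
rewrite exchange_big /=; apply: eq_bigr => i _.
by under eq_bigr do rewrite mulrDl; rewrite big_split /= !sum_site_eq.
Qed.

Lemma sum_edge_le F (y : L) : (forall x, 0 <= F x) ->
  \sum_(z : L) edge R site_adj y z * F (val z) <= nbr_sum F (val y).
Proof.
move=> F0; rewrite sum_edgeE; apply: ler_sum => i _.
by apply: lerD; case: (_ \in L); rewrite ?mul1r ?mul0r.
Qed.

Lemma sum_edge_interior F (y : L) : (forall x, nearest_neighbours x (val y) -> x \in L) ->
  \sum_(z : L) edge R site_adj y z * F (val z) = nbr_sum F (val y).
Proof.
move=> yi; rewrite sum_edgeE; apply: eq_bigr => i _.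
by rewrite !yi ?mul1r //; apply/nnP; exists i; [right|left].
Qed.

Lemma nbr_sum_cst (a : R) x : nbr_sum (fun=> a) x = (2 * d)%:R * a.
Proof.
rewrite /nbr_sum sumr_const card_ord -mulr_natl natrM; ring.
Qed.

Lemma site_deg_le (y : L) : \sum_(z in [set: L]%SET) edge R site_adj y z <= (2 * d)%:R.
Proof.
rewrite (eq_bigl predT) => [|z]; last by rewrite inE.
rewrite -[X in _ <= X]mulr1 -(nbr_sum_cst 1 (val y)).
apply: le_trans (@sum_edge_le (fun=> 1) y _) => //.
by apply: ler_sum => z _; rewrite mulr1.
Qed.

Lemma killing_interior (g : R) (y : L) : (forall x, nearest_neighbours x (val y) -> x \in L) ->
  killing site_adj ((2 * d)%:R : R) g y = g.
Proof.
move=> yi; rewrite /killing (eq_bigl predT) => [|z]; last by rewrite inE.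
have -> : \sum_z edge R site_adj y z = (2 * d)%:R.
  rewrite -[RHS]mulr1 -(nbr_sum_cst 1 (val y)) -(sum_edge_interior _ yi).
  by apply: eq_bigr => z _; rewrite mulr1.
by rewrite addrAC subrr add0r.
Qed.

Lemma sum_full kap (U : option L -> R) (y : L) :
  \sum_v free_weight (edge R site_adj) [set: L]%SET kap y v * U v =
  kap y * U None + \sum_z edge R site_adj y z * U (Some z).
Proof. by rewrite sum_free; congr (_ + _); apply: eq_bigl => z; rewrite inE. Qed.

Definition lift_fun F (v : option L) : R := if v is Some y then F (val y) else 0.

(** A nonnegative supersolution on the lattice stays one in every finite volume and under larger
    killing: missing neighbours only lower the sum, and the sink has value 0. Green function bounds
    thus hold uniformly in the volume. *)
Lemma lift_superharmonic (g : R) (kap : L -> R) F (b : L) (e : R) : (forall x, 0 <= F x) ->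
  (forall y : L, killing site_adj ((2 * d)%:R : R) g y <= kap y) ->
  e <= ((2 * d)%:R + g) * F (val b) - nbr_sum F (val b) ->
  e <= (\sum_v free_weight (edge R site_adj) [set: L]%SET kap b v) * lift_fun F (Some b) -
       \sum_v free_weight (edge R site_adj) [set: L]%SET kap b v * lift_fun F v.
Proof.
move=> F0 kk le; rewrite sum_full sum_free1 /= mulr0 add0r.
apply: le_trans le _; apply: lerB; last exact: sum_edge_le.
by apply: ler_wpM2r => //; have := kk b; rewrite /killing lerBlDr.
Qed.

Lemma sqE x i (a : R) : sq (x + unit_vec i) + a = sq x + a + 1 + 2 * (x 0 i)%:~R /\
  sq (x - unit_vec i) + a = sq x + a + 1 - 2 * (x 0 i)%:~R.
Proof.
rewrite /sq !(bigD1 i (P := predT)) //=.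
have e1 : \sum_(j < d | j != i) (((x + unit_vec i) 0 j)%:~R : R) ^+ 2 = \sum_(j < d | j != i) ((x 0 j)%:~R) ^+ 2.
  by apply: eq_bigr => j ji; rewrite !mxE (negbTE ji) ?andbF addr0.
have e2 : \sum_(j < d | j != i) (((x - unit_vec i) 0 j)%:~R : R) ^+ 2 = \sum_(j < d | j != i) ((x 0 j)%:~R) ^+ 2.
  by apply: eq_bigr => j ji; rewrite !mxE (negbTE ji) ?andbF subr0.
by rewrite e1 e2 !mxE !eqxx /= rmorphD rmorphB /=; split; ring.
Qed.

Lemma sq_ge0 x : 0 <= sq x.
Proof. by apply: sumr_ge0 => i _; rewrite sqr_ge0. Qed.

Lemma intr_sqr (z : int) : (z%:~R : R) ^+ 2 = (absz z)%:R ^+ 2.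
Proof. by case: z => n; rewrite ?NegzE ?mulrNz ?sqrrN /= ?pmulrn. Qed.

Lemma sq_ge x n : (n <= nrm x)%N -> n%:R ^+ 2 <= sq x.
Proof.
case: n => [|n nx]; first by rewrite expr0n sq_ge0.
have : ~~ (nrm x <= n)%N by rewrite -ltnNge.
rewrite nrm_le negb_forall => /existsP[i]; rewrite -ltnNge => ni.
rewrite /sq (bigD1 i) //= intr_sqr; apply: ler_wpDr; first by apply: sumr_ge0 => j _; rewrite sqr_ge0.
by rewrite lerXn2r ?nnegrE ?ler0n // ler_nat.
Qed.

Lemma sq_le x n : (nrm x <= n)%N -> sq x <= d%:R * n%:R ^+ 2.
Proof.
move=> xn; rewrite mulr_natl -[X in _ *+ X]card_ord -sumr_const; apply: ler_sum => i _.
by rewrite intr_sqr lerXn2r ?nnegrE ?ler0n // ler_nat (leq_trans (absz_nrm x i)).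
Qed.

Lemma sq_eq0 x : (sq x == 0) = (x == 0).
Proof.
apply/idP/eqP => [|->]; last by rewrite /sq big1 // => i _; rewrite mxE expr0n.
rewrite /sq psumr_eq0 => [/allP h|i _]; last by rewrite sqr_ge0.
apply/rowP => i; rewrite mxE; have := h i (mem_index_enum i).
by rewrite sqrf_eq0 intr_eq0 => /eqP.
Qed.

Lemma sq_ge1 x : x != 0 -> 1 <= sq x.
Proof.
move=> x0; have := @sq_ge x 1; rewrite expr1n; apply.
by rewrite lt0n nrm_eq0.
Qed.

End sums.

Definition cube N : {fset 'rV[int]_d} :=
  seq_fset tt [seq (\row_i ((f i : nat)%:Z - N%:Z))%R | f : {ffun 'I_d -> 'I_(N + N).+1} <- enum {ffun 'I_d -> 'I_(N + N).+1}].

Lemma in_cube N x : (x \in cube N) = (nrm x <= N)%N.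
Proof.
rewrite seq_fsetE; apply/mapP/idP => [[f _ ->]|].
  rewrite nrm_le; apply/forallP => i; rewrite mxE; have := ltn_ord (f i).
  by move: (nat_of_ord (f i)) => m; lia.
rewrite nrm_le => /forallP h.
exists [ffun i => inord (absz (x 0 i + N%:Z))]; first by rewrite mem_enum.
apply/rowP => i; rewrite mxE ffunE; have := h i; move: (x 0 i) => u hu.
rewrite inordK; lia.
Qed.

Lemma card_near (L : {fset 'rV[int]_d}) b r :
  (#|[set y : L | nrm (val y - b)%R <= r]%SET| <= (r + r).+1 ^ d)%N.
Proof.
pose f (y : L) : {ffun 'I_d -> 'I_(r + r).+1} := [ffun i => inord (absz ((val y - b) 0 i + r%:Z)%R)].
rewrite -[X in (_ <= X ^ _)%N]card_ord -[X in (_ <= _ ^ X)%N]card_ord -card_ffun.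
rewrite -(@card_in_imset _ _ f); first exact: max_card.
move=> y z; rewrite !inE !nrm_le => /forallP hy /forallP hz e.
apply/val_inj; rewrite -[LHS](subrK b) -[RHS](subrK b); congr (_ + _).
apply/rowP => i; have := hy i; have := hz i; move/ffunP: e => /(_ i); rewrite !ffunE.
move: ((val y - b) 0 i) ((val z - b) 0 i) => u v e' hz' hy'.
move: e' => /(congr1 val) /=; rewrite !inordK; lia.
Qed.

Lemma card_cube N : (#|` cube N| <= (N + N).+1 ^ d)%N.
Proof.
rewrite size_seq_fset; apply: leq_trans (size_undup _) _.
by rewrite size_map -cardE card_ffun !card_ord.
Qed.

End lattice.

(** Discrete intermediate values. The second alternative records that the site found is the source
    of a step, hence belongs to the set carrying the chain. *)
Lemma chain_levels (T : finType) (e : rel T) (f : T -> nat) x y j :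
  (forall a b, e a b -> (f a <= (f b).+1)%N) -> connect e x y -> (f y <= j <= f x)%N ->
  exists2 a, f a = j & (a = y \/ exists b, e a b).
Proof.
move=> st /connectP[p]; elim: p x => [|a p IH] x /=.
  by move=> _ -> /andP[h1 h2]; exists x; [lia|left].
move=> /andP[xa pa] ey /andP[h1 h2].
have [le|lt] := leqP j (f a); first by apply: (IH a pa ey); rewrite h1.
exists x; last by right; exists a.
by have := st _ _ xa; lia.
Qed.

(** * Dimension two *)

Section logarithms.
Variable R : realType.
Implicit Types (x y : R).

Lemma ln_leB1 x : 0 < x -> ln x <= x - 1.
Proof.
move=> x0; have h : -1 < x - 1 by lra.
by have := le_ln1Dx h; rewrite (_ : 1 + (x - 1) = x) //; ring.
Qed.

Lemma ln_ge1B x : 0 < x -> 1 - x^-1 <= ln x.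
Proof.
move=> x0; have := @ln_leB1 x^-1; rewrite invr_gt0 => /(_ x0).
by rewrite lnV ?posrE //; lra.
Qed.

Lemma ln3_ge : 9 / 10 <= ln 3 :> R.
Proof.
have h1 : 1 - (5 / 4)^-1 <= ln (5 / 4) :> R by apply: ln_ge1B; rewrite divr_gt0.
have h2 : 1 - (6 / 5)^-1 <= ln (6 / 5) :> R by apply: ln_ge1B; rewrite divr_gt0.
have h3 : 1 - (4 / 3)^-1 <= ln (4 / 3) :> R by apply: ln_ge1B; rewrite divr_gt0.
have e1 : ln (5 / 4) + ln (6 / 5) = ln (3 / 2) :> R.
  by rewrite -lnM ?posrE ?divr_gt0 //; congr ln; field.
have e2 : ln (3 / 2) + ln (4 / 3) = ln 2 :> R.
  by rewrite -lnM ?posrE ?divr_gt0 //; congr ln; field.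
have e3 : ln (3 / 2) + ln 2 = ln 3 :> R.
  by rewrite -lnM ?posrE ?divr_gt0 //; congr ln; field.
rewrite !invf_div in h1 h2 h3; lra.
Qed.

Lemma ln2_bounds : 1 / 2 <= ln (2 : R) <= 1.
Proof.
have h1 : 1 - 2^-1 <= ln 2 :> R by apply: ln_ge1B.
have h2 : ln 2 <= 2 - 1 :> R by apply: ln_leB1.
by apply/andP; split; lra.
Qed.

Lemma ln_prod4 x y z t : 0 < x -> 0 < y -> 0 < z -> 0 < t ->
  ln x + ln y + (ln z + ln t) = ln (x * y * (z * t)).
Proof. by move=> x0 y0 z0 t0; rewrite !lnM ?posrE ?mulr_gt0. Qed.

Lemma ln_exp4 x : 0 < x -> 4 * ln x = ln (x ^+ 4).
Proof. by move=> x0; rewrite lnXn // mulr_natl. Qed.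

Lemma ln_le_mono x y : 0 < x -> x <= y -> ln x <= ln y.
Proof. by move=> x0 xy; rewrite ler_ln ?posrE // (lt_le_trans x0). Qed.

(* [ln (|x|^2 + 1/2)] is subharmonic on Z^2. *)
Lemma ln_subharmonic (a b q : R) : q = a ^+ 2 + b ^+ 2 ->
  4 * ln (q + 1 / 2) <= ln (q + 1 / 2 + 1 + 2 * a) + ln (q + 1 / 2 + 1 - 2 * a) +
    (ln (q + 1 / 2 + 1 + 2 * b) + ln (q + 1 / 2 + 1 - 2 * b)).
Proof.
move=> ->.
have a0 := sqr_ge0 a; have b0 := sqr_ge0 b.
have ap := sqr_ge0 (a + 1); have am := sqr_ge0 (a - 1).
have bp := sqr_ge0 (b + 1); have bm := sqr_ge0 (b - 1).
have t0 : 0 < a ^+ 2 + b ^+ 2 + 1 / 2 by lra.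
rewrite ln_prod4; [|nra..]; rewrite ln_exp4 //.
apply: ln_le_mono; first exact: exprn_gt0.
rewrite -subr_ge0; set t := a ^+ 2 + b ^+ 2 + 1 / 2.
have -> : (t + 1 + 2 * a) * (t + 1 - 2 * a) * ((t + 1 + 2 * b) * (t + 1 - 2 * b)) - t ^+ 4 =
   4 * t + 3 + 16 * (a ^+ 2 * b ^+ 2) by rewrite /t; field.
have := mulr_ge0 a0 b0; rewrite -/t in t0; lra.
Qed.

(* [ln (q - 1 / 2)] continued to [q = 0] by a value so low that superharmonicity
   persists at the neighbours of the origin. *)
Definition psi (q : R) := if q < 1 / 2 then - 7 else ln (q - 1 / 2).

Lemma psi_ge q : (q < 1/2) || (1 <= q) -> - 7 <= psi q.
Proof.
rewrite /psi => /orP[->//|q1]; case: ifP => // _.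
apply: le_trans (_ : ln (1 / 2) <= _); last by apply: ln_le_mono; lra.
by apply: le_trans (_ : 1 - (1 / 2)^-1 <= _); [rewrite invf_div; lra|apply: ln_ge1B; lra].
Qed.

Lemma psiE q : 1 <= q -> psi q = ln (q - 1 / 2).
Proof. by move=> q1; rewrite /psi ltNge (_ : 1 / 2 <= q = true) //; apply/idP; lra. Qed.

(* [psi (|x|^2)] is superharmonic on Z^2 off the origin. *)
Lemma psi_superharmonic (m n : int) :
  let a : R := m%:~R in let b : R := n%:~R in let q := a ^+ 2 + b ^+ 2 in
  (m != 0) || (n != 0) ->
  psi (q + 1 + 2 * a) + psi (q + 1 - 2 * a) + (psi (q + 1 + 2 * b) + psi (q + 1 - 2 * b)) <= 4 * psi q.
Proof.
move=> a b q mn0.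
have qE : q = (m * m + n * n)%:~R by rewrite /q /a /b rmorphD /= !rmorphM /=; ring.
have key : (m * m + n * n = 1) \/ (2 <= m * m + n * n) by nia.
(* The origin of the value -7 of [psi] at 0: at a neighbour of the origin the claim reads
   [ln (63 / 8) - 7 <= - 4 * ln 2]. *)
have q7 : ln (63 / 8) <= 7 - 4 * ln 2 :> R.
  have h : ln (63 / 8) <= 3 * ln 2 :> R by rewrite [X in _ <= X]mulr_natl -lnXn //; apply: ln_le_mono; lra.
  by have /andP[_ l2] := ln2_bounds; lra.
case: key => [e1|ge2].
  have unit_case (u v : R) : (u = 1 \/ u = -1) -> v = 0 ->
    psi (u ^+ 2 + v ^+ 2 + 1 + 2 * u) + psi (u ^+ 2 + v ^+ 2 + 1 - 2 * u) +
    (psi (u ^+ 2 + v ^+ 2 + 1 + 2 * v) + psi (u ^+ 2 + v ^+ 2 + 1 - 2 * v)) <= 4 * psi (u ^+ 2 + v ^+ 2).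
    have p0 : psi 0 = - 7 by rewrite /psi (_ : 0 < 1 / 2 = true) //; apply/idP; lra.
    have p4 : psi 4 = ln (7 / 2) by rewrite psiE; [congr ln; lra|lra].
    have p2 : psi 2 = ln (3 / 2) by rewrite psiE; [congr ln; lra|lra].
    have p1 : psi 1 = - ln 2.
      by rewrite psiE // -lnV ?posrE //; congr ln; lra.
    have s : ln (7 / 2) + ln (3 / 2) + ln (3 / 2) = ln (63 / 8) :> R.
      by rewrite -!lnM ?posrE; [congr ln; lra|lra..].
    case=> -> ->.
      rewrite (_ : 1 ^+ 2 + 0 ^+ 2 + 1 + 2 * 1 = 4 :> R); last by lra.
      rewrite (_ : 1 ^+ 2 + 0 ^+ 2 + 1 - 2 * 1 = 0 :> R); last by lra.
      rewrite (_ : 1 ^+ 2 + 0 ^+ 2 + 1 + 2 * 0 = 2 :> R); last by lra.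
      rewrite (_ : 1 ^+ 2 + 0 ^+ 2 + 1 - 2 * 0 = 2 :> R); last by lra.
      by rewrite (_ : 1 ^+ 2 + 0 ^+ 2 = 1 :> R) ?p0 ?p1 ?p2 ?p4; lra.
    rewrite (_ : (-1) ^+ 2 + 0 ^+ 2 + 1 + 2 * -1 = 0 :> R); last by lra.
    rewrite (_ : (-1) ^+ 2 + 0 ^+ 2 + 1 - 2 * -1 = 4 :> R); last by lra.
    rewrite (_ : (-1) ^+ 2 + 0 ^+ 2 + 1 + 2 * 0 = 2 :> R); last by lra.
    rewrite (_ : (-1) ^+ 2 + 0 ^+ 2 + 1 - 2 * 0 = 2 :> R); last by lra.
    by rewrite (_ : (-1) ^+ 2 + 0 ^+ 2 = 1 :> R) ?p0 ?p1 ?p2 ?p4; lra.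
  have : (m = 1 \/ m = -1) /\ n = 0 \/ (n = 1 \/ n = -1) /\ m = 0 by nia.
  case=> -[h1 h2].
    apply: (unit_case a b); last by rewrite /b h2.
    by case: h1 => e; rewrite /a e; [left|right].
  rewrite /q [a ^+ 2 + _]addrC [X in X <= _]addrC; apply: (unit_case b a); last by rewrite /a h2.
  by case: h1 => e; rewrite /b e; [left|right].
have q2 : 2 <= q by rewrite qE (_ : 2 = (2%:Z)%:~R) // ler_int.
have ge1 (z : R) (k : int) : z = q + 1 + 2 * k%:~R -> (1 <= m * m + n * n + 1 + 2 * k) -> 1 <= z.
  move=> -> h; have : (1%:~R <= (m * m + n * n + 1 + 2 * k)%:~R :> R) by rewrite ler_int.
  by rewrite qE !rmorphD /= !rmorphM.
have g1 : 1 <= q + 1 + 2 * a by apply: (ge1 _ m) => //; nia.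
have g2 : 1 <= q + 1 - 2 * a.
  by apply: (ge1 _ (- m)); [rewrite rmorphN mulrN|nia].
have g3 : 1 <= q + 1 + 2 * b by apply: (ge1 _ n) => //; nia.
have g4 : 1 <= q + 1 - 2 * b.
  by apply: (ge1 _ (- n)); [rewrite rmorphN mulrN|nia].
rewrite !psiE //; last by lra.
rewrite ln_prod4 ?ln_exp4; try lra.
apply: ln_le_mono; first by rewrite !mulr_gt0 //; lra.
rewrite -subr_ge0.
have -> : (q - 1 / 2) ^+ 4 - (q + 1 + 2 * a - 1 / 2) * (q + 1 - 2 * a - 1 / 2) *
   ((q + 1 + 2 * b - 1 / 2) * (q + 1 - 2 * b - 1 / 2)) = 4 * (a ^+ 2 - b ^+ 2) ^+ 2.
  by rewrite /q; field.
by rewrite mulr_ge0 // sqr_ge0.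
Qed.

(** From [ln n! >= n ln n - n], which exceeds [n ln c - c] for every [c]. The free [c] lets two
    factorials of different lengths be bounded with the same logarithm. *)
Lemma lnS_sum_ge (c : R) n : 0 < c -> n%:R * ln c - c <= \sum_(i < n) ln (i.+1%:R).
Proof.
move=> c0; have H : n%:R * ln n%:R - n%:R <= \sum_(i < n) ln (i.+1%:R) :> R.
  elim: n => [|n IH]; first by rewrite big_ord0 mul0r subrr.
  rewrite big_ord_recr /=; apply: le_trans (lerD IH (lexx _)).
  case: n {IH} => [|n]; first by rewrite mul0r mul1r ln1; lra.
  have n0 : 0 < n.+1%:R :> R by [].
  have : ln (n.+2%:R / n.+1%:R) <= n.+1%:R^-1 :> R.
    apply: le_trans (ln_leB1 _) _; first by rewrite divr_gt0.
    by rewrite -natr1 mulrDl divff ?gt_eqF // mul1r addrAC subrr add0r.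
  rewrite ln_div ?posrE // => h.
  have : n.+1%:R * (ln n.+2%:R - ln n.+1%:R) <= 1 :> R.
    by rewrite mulrC -ler_pdivlMr // mul1r.
  by rewrite -(natr1 n.+1); lra.
apply: le_trans H; case: n => [|n]; first by rewrite !mul0r; lra.
have n0 : 0 < n.+1%:R :> R by [].
have : ln (c / n.+1%:R) <= c / n.+1%:R - 1 by apply: ln_leB1; rewrite divr_gt0.
rewrite ln_div ?posrE // => h.
have : n.+1%:R * (ln c - ln n.+1%:R) <= n.+1%:R * (c / n.+1%:R - 1) by rewrite ler_wpM2l.
have -> : n.+1%:R * (c / n.+1%:R - 1) = c - n.+1%:R by field; rewrite addrC natr1 gt_eqF.
lra.
Qed.

Definition gap (t j : nat) : nat := (t - j) + (j - t).

Lemma gap_sum (f : nat -> R) t m : f 0%N = 0 ->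
  \sum_(j < t.+1 + m) f (gap t j) = \sum_(i < t) f i.+1 + \sum_(i < m) f i.+1.
Proof.
move=> f0; elim: m => [|m IH].
  rewrite addn0 big_ord0 addr0; elim: t => [|t IH].
    by rewrite big_ord_recl !big_ord0 addr0 -[RHS]f0.
  rewrite [LHS]big_ord_recl [RHS]big_ord_recr /= addrC -IH; congr (_ + _).
  by congr f; rewrite /gap; lia.
rewrite addnS big_ord_recr /= IH big_ord_recr /= addrA; congr (_ + f _).
by rewrite /gap; lia.
Qed.

Lemma ln_gap_sum t m : \sum_(j < t.+1 + m) ln (gap t j)%:R =
  \sum_(i < t) ln (i.+1%:R) + \sum_(i < m) ln (i.+1%:R) :> R.
Proof. by apply: (gap_sum (f := fun n => ln n%:R)); exact: ln0. Qed.

Lemma harmonic_le n m : (0 < m)%N -> (n <= m)%N -> \sum_(i < n) (i.+1%:R)^-1 <= 1 + ln m%:R :> R.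
Proof.
move=> m0 nm; have H k : \sum_(i < k.+1) (i.+1%:R)^-1 <= 1 + ln k.+1%:R :> R.
  elim: k => [|k IH]; first by rewrite big_ord_recl big_ord0 ln1 invr1.
  rewrite big_ord_recr /=; apply: le_trans (lerD IH (lexx _)) _; rewrite -addrA lerD2l.
  have k1 : 0 < k.+1%:R :> R by []. have k2 : 0 < k.+2%:R :> R by [].
  have := @ln_leB1 (k.+1%:R / k.+2%:R); rewrite divr_gt0 // => /(_ isT).
  rewrite ln_div ?posrE // => h.
  have e : (k.+2%:R)^-1 = 1 - k.+1%:R / k.+2%:R :> R.
    apply: (mulIf (lt0r_neq0 k2)); rewrite mulrBl mulVf ?lt0r_neq0 // divfK ?lt0r_neq0 // mul1r.
    by rewrite -(natr1 k.+1) addrAC subrr add0r.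
  rewrite e; move: h; move: (_ / _) (ln _) (ln _) => x y w; lra.
have l0 : 0 <= ln m%:R :> R by apply: ln_ge0; rewrite ler1n.
case: n nm => [|n] nm; first by rewrite big_ord0; lra.
by apply: le_trans (H n) _; rewrite lerD2l ln_le_mono // ler_nat.
Qed.

End logarithms.

(** * Logarithmic potentials in the plane *)

Section plane.
Variable R : realType.
Local Notation Z2 := 'rV[int]_2.
Implicit Types (x p b : Z2).
Let i0 : 'I_2 := ord0.
Let i1 : 'I_2 := lift ord0 ord0.

Lemma sq2E x : sq R x = ((x 0 i0)%:~R) ^+ 2 + ((x 0 i1)%:~R) ^+ 2.
Proof. by rewrite /sq !big_ord_recl big_ord0 addr0. Qed.

Lemma nbr_sum_radial2 (G : R -> R) p x :
  let q := sq R (x - p) in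
  let a : R := ((x - p) 0 i0)%:~R in let b : R := ((x - p) 0 i1)%:~R in
  nbr_sum (fun y => G (sq R (y - p))) x =
  G (q + 1 + 2 * a) + G (q + 1 - 2 * a) + (G (q + 1 + 2 * b) + G (q + 1 - 2 * b)).
Proof.
move=> q a b; rewrite /nbr_sum !big_ord_recl big_ord0 addr0.
have sh i : sq R (x + unit_vec i - p) = q + 1 + 2 * ((x - p) 0 i)%:~R /\
   sq R (x - unit_vec i - p) = q + 1 - 2 * ((x - p) 0 i)%:~R.
  have [h1 h2] := sqE (x - p) i (0 : R); rewrite !addr0 in h1; rewrite !addr0 in h2.
  have -> : x + unit_vec i - p = x - p + unit_vec i by rewrite addrAC.
  have -> : x - unit_vec i - p = x - p - unit_vec i by rewrite addrAC.
  by split.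
by have [-> ->] := sh i0; have [-> ->] := sh i1.
Qed.

(* The discrete Laplacian of [ln (|x|^2 + 1 / 2)] at the origin is [4 * ln 3]. *)
Definition plane_al : R := (4 * ln 3)^-1.

Lemma plane_al_bounds : 0 < plane_al <= 1.
Proof.
have l3 := @ln3_ge R; have p : 0 < 4 * ln 3 :> R by lra.
rewrite /plane_al invr_gt0 p invf_le1 //=; lra.
Qed.

(** A supersolution for the Green function with killing [s]. The term [s * q] has Laplacian [4 s],
    offset by [s] times the constant 4; scaling the logarithm by [s] keeps the whole nonnegative. *)
Definition plane_green (s : R) p x : R :=
  plane_al * (- ln ((sq R (x - p) + 1 / 2) * s) + s * sq R (x - p) + 4).

Lemma plane_green_ge0 s p x : 0 < s <= 1 -> 0 <= plane_green s p x.
Proof.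
move=> /andP[s0 s1]; have /andP[a0 _] := plane_al_bounds.
have q0 := sq_ge0 R (x - p).
rewrite mulr_ge0 ?(ltW a0) //.
have h : 0 < (sq R (x - p) + 1 / 2) * s by rewrite mulr_gt0 //; lra.
have := ln_leB1 h; nra.
Qed.

Lemma plane_green_super s p x : 0 < s <= 1 ->
  (x == p)%:R <= ((2 * 2)%:R + s) * plane_green s p x - nbr_sum (plane_green s p) x.
Proof.
move=> /andP[s0 s1]; have /andP[a0 _] := plane_al_bounds.
pose G q := plane_al * (- ln ((q + 1 / 2) * s) + s * q + 4) : R.
rewrite (nbr_sum_radial2 G p x) /plane_green -/(G _).
set q := sq R (x - p); set a := ((x - p) 0 i0)%:~R; set b := ((x - p) 0 i1)%:~R.
have qE : q = a ^+ 2 + b ^+ 2 by exact: sq2E.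
have q0 : 0 <= q by exact: sq_ge0.
have ap := sqr_ge0 (a + 1); have am := sqr_ge0 (a - 1).
have bp := sqr_ge0 (b + 1); have bm := sqr_ge0 (b - 1).
have a2 := sqr_ge0 a; have b2 := sqr_ge0 b.
have lnE z : 0 < z + 1 / 2 -> G z = plane_al * (- ln (z + 1 / 2) - ln s + s * z + 4).
  by move=> z0; rewrite /G lnM ?posrE //; congr (_ * _); ring.
rewrite (lnE q) ?(lnE (q + 1 + 2 * a)) ?(lnE (q + 1 - 2 * a)) ?(lnE (q + 1 + 2 * b)) ?(lnE (q + 1 - 2 * b)); [|nra..].
set l0 := ln (q + 1 / 2); set l1 := ln (q + 1 + 2 * a + 1 / 2); set l2 := ln (q + 1 - 2 * a + 1 / 2).
set l3 := ln (q + 1 + 2 * b + 1 / 2); set l4 := ln (q + 1 - 2 * b + 1 / 2).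
have -> : ((2 * 2)%:R + s) * (plane_al * (- l0 - ln s + s * q + 4)) -
  (plane_al * (- l1 - ln s + s * (q + 1 + 2 * a) + 4) + plane_al * (- l2 - ln s + s * (q + 1 - 2 * a) + 4) +
   (plane_al * (- l3 - ln s + s * (q + 1 + 2 * b) + 4) + plane_al * (- l4 - ln s + s * (q + 1 - 2 * b) + 4))) =
  plane_al * (l1 + l2 + (l3 + l4) - 4 * l0) + plane_al * s * (- (l0 + ln s) + s * q) by ring.
have pos : 0 <= - (l0 + ln s) + s * q.
  have h : 0 < (q + 1 / 2) * s by rewrite mulr_gt0 //; lra.
  have := ln_leB1 h; rewrite lnM ?posrE //; last by lra.
  by rewrite -/l0; nra.
have p2 : 0 <= plane_al * s * (- (l0 + ln s) + s * q) by apply: mulr_ge0 => //; rewrite mulr_ge0 // ltW.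
have sub : 4 * l0 <= l1 + l2 + (l3 + l4).
  have := @ln_subharmonic R a b q qE; rewrite /l1 /l2 /l3 /l4 /l0.
  have e z : q + 1 / 2 + 1 + z = q + 1 + z + 1 / 2 by ring.
  by rewrite !e.
have [xp|xp] := eqVneq x p; last first.
  by rewrite addr_ge0 // mulr_ge0 ?(ltW a0) // subr_ge0.
have xp0 : x - p = 0 by rewrite xp subrr.
have a00 : a = 0 by rewrite /a xp0 mxE.
have b00 : b = 0 by rewrite /b xp0 mxE.
have q00 : q = 0 by rewrite qE a00 b00 expr0n addr0.
have l3p := @ln3_ge R.
have e : l1 + l2 + (l3 + l4) - 4 * l0 = 4 * ln 3.
  rewrite /l1 /l2 /l3 /l4 /l0 a00 b00 q00 !mulr0 !subr0 !addr0 !add0r.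
  have -> : ln (1 + 1 / 2) = ln 3 + ln (1 / 2) :> R.
    by rewrite -lnM ?posrE ?divr_gt0 //; congr ln; lra.
  by ring.
by rewrite e /plane_al mulVf ?lerDl // gt_eqF //; lra.
Qed.

Section site_bounds.
Variable L : {fset Z2}.
Local Notation adj := (@site_adj 2 L).

Lemma plane_green_bound s (k : L -> R) (x : L) : 0 < s <= 1 ->
  (forall y, killing adj ((2 * 2)%:R : R) s y <= k y) ->
  treeZ (free_weight (edge R adj) [set: L]%SET k) ([set: L]%SET :\ x) <=
  (ln (s^-1) + 5) * treeZ (free_weight (edge R adj) [set: L]%SET k) [set: L]%SET.
Proof.
move=> s01 kk; have /andP[s0 s1] := s01.
have k0 y : 0 <= k y.
  apply: le_trans (kk y); apply: le_trans (ltW s0) (killing_ge _ s y).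
  exact: site_deg_le.
have o0 y v : 0 <= free_weight (edge R adj) [set: L]%SET k y v.
  by apply: free_weight_ge0 => //; exact: edge_ge0.
pose V := lift_fun (plane_green s (val x)) : option L -> R.
have V0 v : 0 <= V v by case: v => //= y; exact: plane_green_ge0.
have sup (y : L) : (y == x)%:R <= (\sum_v free_weight (edge R adj) [set: L]%SET k y v) * V (Some y) -
    \sum_v free_weight (edge R adj) [set: L]%SET k y v * V v.
  apply: (@lift_superharmonic 2 R L s) => // [z|]; first exact: plane_green_ge0.
  by have := @plane_green_super s (val x) (val y) s01; rewrite (inj_eq val_inj).
apply: le_trans (@green_diag_le _ _ _ o0 _ V x _ V0 _ _) _.
- by rewrite inE.
- move=> y _; rewrite -subr_ge0; apply: le_trans (sup y); exact: ler0n.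
- by have := sup x; rewrite eqxx.
rewrite mulrC; apply: ler_wpM2r; first exact: treeZ_ge0.
rewrite /V /= /plane_green subrr (_ : sq R 0 = 0); last by rewrite sq2E !mxE expr0n addr0.
have /andP[a0 a1] := plane_al_bounds.
have lns : 0 <= ln s^-1 by apply: ln_ge0; rewrite invf_ge1.
have /andP[l2 l2'] := @ln2_bounds R.
have -> : ln ((0 + 1 / 2) * s) = - ln 2 - ln s^-1.
  rewrite add0r lnM ?posrE // lnV ?posrE // opprK; congr (_ + _).
  by rewrite mul1r lnV ?posrE.
nra.
Qed.

End site_bounds.

Section barrier.
Variables (b : Z2) (a : nat -> Z2) (r : nat).
Hypotheses (r8 : (8 <= r)%N) (ab : forall j, (j < r)%N -> nrm (a j - b) = j).

(** The sites [a j] are taken on the obstacle, one at each distance [j] from [b]. At distance [8 r]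
    from [b] the squared distances are at least [49 r^2], so with 48 the barrier is nonpositive
    there; within [r] they are at most [8 r^2], which gives [ln 6] per site. *)
Definition barrier x : R := \sum_(j < r) (ln (48 * r%:R ^+ 2) - psi (sq R (x - a j))).

Let r_gt0 : 0 < r%:R :> R. Proof. by rewrite ltr0n; apply: leq_trans r8. Qed.

Lemma barrier_subharmonic x : (forall j, (j < r)%N -> x != a j) ->
  4 * barrier x <= nbr_sum barrier x.
Proof.
move=> xa; rewrite /nbr_sum /barrier.
rewrite [X in _ <= X](eq_bigr (fun i => \sum_(j < r) ((ln (48 * r%:R ^+ 2) - psi (sq R (x + unit_vec i - a j))) +
  (ln (48 * r%:R ^+ 2) - psi (sq R (x - unit_vec i - a j)))))) => [|i _]; last by rewrite [RHS]big_split.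
rewrite exchange_big mulr_sumr; apply: ler_sum => j _ /=.
set K := ln _.
have e := nbr_sum_radial2 (@psi R) (a j) x; rewrite /nbr_sum /= in e.
have -> : \sum_(i < 2) (K - psi (sq R (x + unit_vec i - a j)) + (K - psi (sq R (x - unit_vec i - a j)))) =
   4 * K - \sum_(i < 2) (psi (sq R (x + unit_vec i - a j)) + psi (sq R (x - unit_vec i - a j))).
  by rewrite !big_ord_recl !big_ord0; ring.
rewrite e mulrBr lerD2l lerN2.
have := @psi_superharmonic R ((x - a j) 0 i0) ((x - a j) 0 i1).
rewrite /= -sq2E; apply.
rewrite -negb_and; apply/negP => /andP[/eqP h0 /eqP h1].
case/eqP: (xa j (ltn_ord j)); apply/eqP; rewrite -subr_eq0; apply/eqP/rowP => i.
rewrite [RHS]mxE; case: (unliftP ord0 i) => [i' ->|-> //].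
by rewrite (ord1 (i' : 'I_1)).
Qed.

Lemma barrier_far x : (8 * r <= nrm (x - b)%R)%N -> barrier x <= 0.
Proof.
move=> xb; apply: sumr_le0 => j _; rewrite subr_le0.
have jr := ltn_ord j.
have nx : (7 * r <= nrm (x - a j)%R)%N.
  have := nrm_tri x (a j) b; rewrite ab //; move: (nrm _) (nrm _) xb => u v; lia.
have := @sq_ge _ R _ _ nx; rewrite natrM exprMn => h.
have r2 : 1 <= r%:R ^+ 2 :> R by rewrite exprn_ege1 // ler1n; apply: leq_trans r8.
rewrite psiE; last by lra.
by apply: ln_le_mono; [rewrite mulr_gt0 // exprn_gt0|lra].
Qed.

Lemma barrier_near x : (nrm (x - b)%R <= r)%N -> r%:R * ln 6 <= barrier x.
Proof.
move=> xb; rewrite mulr_natl -[X in _ *+ X]card_ord -sumr_const; apply: ler_sum => j _.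
have jr := ltn_ord j.
have nx : (nrm (x - a j)%R <= 2 * r)%N.
  have := nrm_tri x b (a j); rewrite (nrm_sym b) ab //; move: (nrm _) (nrm _) xb => u v; lia.
have := @sq_le _ R _ _ nx; rewrite natrM exprMn => h.
have r2 : 1 <= r%:R ^+ 2 :> R by rewrite exprn_ege1 // ler1n; apply: leq_trans r8.
have -> : ln (48 * r%:R ^+ 2) = ln 6 + ln (8 * r%:R ^+ 2) :> R.
  by rewrite -lnM ?posrE ?mulr_gt0 ?exprn_gt0 //; congr ln; ring.
rewrite -addrA lerDl subr_ge0 /psi; case: ifP => [_|/negbT].
  by apply: le_trans (_ : 0 <= _); [lra|apply: ln_ge0; lra].
rewrite -leNgt le_eqVlt => /orP[/eqP <-|q0]; last by apply: ln_le_mono; lra.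
by rewrite subrr ln0 // ln_ge0 //; lra.
Qed.

(** A point at distance [t] from [b] is at distance at least [|t - j|] from [a j], so two factorials
    bound the sum, the term [j = t] costing at most 7. The ratio of this maximum to [barrier_near]
    is 6, hence the decay 5/6. *)
Lemma barrier_max x : barrier x <= 6 * r%:R * ln 6.
Proof.
rewrite /barrier sumrB sumr_const card_ord -mulr_natl.
set K := ln _; set rr : R := r%:R.
have rr8 : 8 <= rr by rewrite /rr (ler_nat R 8 r).
pose t := minn (nrm (x - b)) r.-1.
have tr : (t < r)%N by rewrite /t; lia.
have low (j : 'I_r) : 2 * ln (gap t j)%:R - ln 2 - 7 *+ (j == t :> nat) <= psi (sq R (x - a j)).
  have jr := ltn_ord j.
  have nx : (gap t j <= nrm (x - a j)%R)%N.
    have h1 := nrm_tri x (a j) b; have h2 := nrm_tri b x (a j).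
    move: h1 h2; rewrite (nrm_sym b x) (nrm_sym b (a j)) ab // /t /gap.
    by move: (nrm _) (nrm _) => u v; lia.
  have /andP[l2 l2'] := @ln2_bounds R.
  have [jt|jt] := eqVneq (j : nat) t.
    rewrite jt /gap subnn ln0 // mulr0 sub0r mulr1n.
    apply: le_trans (_ : - 7 <= _); first by lra.
    apply: psi_ge; rewrite -jt; have [->|] := eqVneq (sq R (x - a j)) 0.
      by rewrite divr_gt0.
    by rewrite sq_eq0 => h; rewrite sq_ge1 ?orbT.
  rewrite mulr0n subr0.
  have g1 : (1 <= gap t j)%N by rewrite /gap; move: jt; lia.
  have G1 : 1 <= (gap t j)%:R :> R by rewrite ler1n.
  have G2 : 1 <= (gap t j)%:R ^+ 2 :> R by rewrite exprn_ege1.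
  have h := @sq_ge _ R _ _ nx.
  rewrite psiE; last by lra.
  have -> : 2 * ln (gap t j)%:R - ln 2 = ln ((gap t j)%:R ^+ 2 / 2) :> R.
    by rewrite ln_div ?posrE ?exprn_gt0 ?ltr0n // lnXn ?ltr0n // mulr_natl.
  by apply: ln_le_mono; [rewrite divr_gt0 // exprn_gt0 // ltr0n|lra].
have sumlow : 2 * (\sum_(j < r) ln (gap t j)%:R) - rr * ln 2 - 7 <= \sum_(j < r) psi (sq R (x - a j)).
  apply: le_trans (ler_sum (index_enum 'I_r) (fun j _ => low j)).
  rewrite !sumrB -mulr_sumr sumr_const card_ord -[ln 2 *+ r]mulr_natl -/rr lerD2l lerN2.
  rewrite (bigD1 (Ordinal tr)) //= eqxx mulr1n big1 ?addr0 // => j jt.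
  by rewrite (_ : (_ == _) = false) // ; apply: contraNF jt => /eqP e; apply/eqP/val_inj.
have er : (t.+1 + (r.-1 - t))%N = r by lia.
have := ln_gap_sum R t (r.-1 - t); rewrite er => gapE.
have c0 : 0 < rr / 2 by rewrite divr_gt0.
have h1 := lnS_sum_ge t c0; have h2 := lnS_sum_ge (r.-1 - t) c0.
have lnr : ln (rr / 2) = ln rr - ln 2 by rewrite ln_div ?posrE.
have tE : t%:R + (r.-1 - t)%:R = rr - 1 :> R.
  rewrite -natrD (_ : (t + (r.-1 - t))%N = r.-1); last by lia.
  by rewrite /rr -[in RHS](prednK (n := r)) ?(leq_trans _ r8) // -natr1 addrK.
have KE : K = 4 * ln 2 + ln 3 + 2 * ln rr.
  rewrite /K lnM ?posrE ?exprn_gt0 // lnXn // -[ln rr *+ 2]mulr_natl; congr (_ + _).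
  by rewrite ln_exp4 // -lnM ?posrE ?exprn_gt0 //; congr ln; lra.
have l6 : ln 6 = ln 2 + ln 3 :> R by rewrite -lnM ?posrE //; congr ln; lra.
have /andP[l2 l2'] := @ln2_bounds R; have l3 := @ln3_ge R.
have lnr4 : ln rr <= rr / 4 - 1 + 2 * ln 2.
  have := @ln_leB1 R (rr / 4); rewrite divr_gt0 // => /(_ isT).
  rewrite ln_div ?posrE // (_ : ln 4 = 2 * ln 2); first by lra.
  by rewrite mulr_natl -lnXn //; congr ln; lra.
have gsum : (rr - 1) * (ln rr - ln 2) - rr <= \sum_(j < r) ln (gap t j)%:R.
  rewrite gapE -tE mulrDl -lnr; lra.
rewrite KE l6; nra.
Qed.

End barrier.
End plane.

(** * The mean number of descendants *)

Section mean_descendants.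
Variables (R : realType) (T : finType) (adj : rel T) (c : R).
Hypothesis adj_sym : forall y z, adj y z = adj z y.
Hypothesis deg_le : forall y, \sum_(z in [set: T]%SET) edge R adj y z <= c.
Variables (B : {set T}) (s : R).
Hypotheses (s_ge0 : 0 <= s) (Z_gt0 : 0 < Ztree adj c s).
Local Notation om := (tree_weight adj c s).
Local Notation desc x := (fun f : {ffun T -> option T} => (descendant B f x)%:R : R).

Let om_ge0 y v : 0 <= om y v. Proof. exact: tree_weight_ge0. Qed.

Lemma tree_sum_exit_setT (F : {ffun T -> option T} -> R) v :
  tree_sum om [set: T]%SET (fun f => F f * (exit [set: T]%SET f v == None)%:R) =
  tree_sum om [set: T]%SET F.
Proof.
apply: eq_tree_sum => f _ /acyclicP/(_ v).
by case: (exit _ f v) => [x|] /=; rewrite ?inE ?eqxx ?mulr1.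
Qed.

Definition mean_descendants : R :=
  (Ztree adj c s)^-1 * \sum_x tree_sum om [set: T]%SET (desc x).

Lemma expected_loss_le_mean t M : 0 <= t -> 0 <= M ->
  expected_loss adj c B s t M <= mean_descendants * (t * M).
Proof.
move=> t0 M0; rewrite /expected_loss /mean_descendants -mulrA ler_wpM2l ?invr_ge0 ?(ltW Z_gt0) //.
rewrite -tree_sum_sum [X in _ <= X]mulrC -tree_sumZ; apply: ler_tree_sum => // f _ _.
rewrite ge_min; apply/orP; right; rewrite mulrC ler_wpM2l ?mulr_ge0 //.
rewrite -sum1_card natr_sum (big_mkcond (fun x => x \in descendants B f)) /=.
by apply: ler_sum => x _; rewrite inE; case: (descendant B f x).
Qed.

Lemma mean_descendants_le_card : mean_descendants <= #|T|%:R.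
Proof.
rewrite /mean_descendants mulrC ler_pdivrMr // mulr_natl -sumr_const.
apply: ler_sum => x _; apply: ler_tree_sum => // f _ _.
by case: (descendant B f x).
Qed.

(** Sites of [near] count one each. For the others the Green function is summed over [x], which
    gives at most [1 / s] by [green_sum_le]. *)
Lemma mean_descendants_escape (near : {set T}) beta : 0 < s -> 0 <= c -> 0 <= beta ->
  (forall x, x \notin near -> tree_sum om [set: T]%SET (desc x) <=
     \sum_(b in B) (s + c * beta) * treeY om ([set: T]%SET :\ b) (Some x) (pred1 (Some b))) ->
  mean_descendants <= #|near|%:R + #|B|%:R * ((s + c * beta) / s).
Proof.
move=> s0 c0 b0 far; rewrite /mean_descendants mulrC ler_pdivrMr //.
have k0 y : 0 < killing adj c s y by apply: lt_le_trans (killing_ge deg_le s y).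
have tr : transient om [set: T]%SET by exact: free_transient.
have C0 : 0 <= s + c * beta by rewrite addr_ge0 // mulr_ge0.
rewrite mulrDl (bigID (mem near)) /=; apply: lerD.
  rewrite mulr_natl -sumr_const; apply: ler_sum => x _; apply: ler_tree_sum => // f _ _.
  by case: (descendant B f x).
apply: le_trans (_ : \sum_x \sum_(b in B) (s + c * beta) *
    treeY om ([set: T]%SET :\ b) (Some x) (pred1 (Some b)) <= _).
  rewrite [X in _ <= X](bigID (mem near)) /= -[X in X <= _]add0r; apply: lerD.
    by apply: sumr_ge0 => x _; apply: sumr_ge0 => b _; rewrite mulr_ge0 ?treeY_ge0.
  by apply: ler_sum => x xn; exact: far.
rewrite exchange_big /= -mulrA mulr_natl -sumr_const; apply: ler_sum => b _.
rewrite -mulr_sumr -mulrA ler_wpM2l // mulrC ler_pdivlMr // mulrC.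
have := @green_sum_le _ _ om om_ge0 [set: T]%SET tr _ b s; rewrite /Ztree.
rewrite (eq_bigl predT) => [|x]; last by rewrite inE.
apply=> [x y _ _||x _]; last 1 first.
- rewrite (bigD1 None) //= ler_wpDr ?sumr_ge0 //.
  exact: (killing_ge deg_le).
- by rewrite /tree_weight /= !inE; exact: edge_sym.
- by rewrite inE.
Qed.
End mean_descendants.

(** * A discrete Beurling estimate *)

Section beurling.
Variables (R : realType) (L : {fset 'rV[int]_2}) (s : R) (A : {set L}) (b : L).
Local Notation c := ((2 * 2)%:R : R).
Local Notation om := (tree_weight (@site_adj 2 L) c s).
Local Notation far y := (nrm (val (y : L) - val b)%R).
Hypotheses (s01 : 0 < s <= 1).
Variable U : option L -> R.
Hypotheses (hU : harmonic om A U) (U1 : forall v, U v <= 1)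
  (UA : forall y, y \notin A -> U (Some y) <= 0).

Let s_gt0 : 0 < s. Proof. by case/andP: s01. Qed.
Let om_ge0 y v : 0 <= om y v. Proof. by apply: tree_weight_ge0 (ltW s_gt0) _ _; exact: site_deg_le. Qed.
Let tA D : transient om D.
Proof.
apply: free_transient => x; apply: lt_le_trans s_gt0 _.
by apply: killing_ge; exact: site_deg_le.
Qed.

Lemma nbr_sum_sq2 (p : 'rV[int]_2) x :
  nbr_sum (fun y => sq R (y - p)) x = 4 * sq R (x - p) + 4.
Proof. by rewrite (nbr_sum_radial2 id p x); ring. Qed.

(** The supersolution [W] has two terms. The barrier takes off at least a sixth of [E] near [b]. The
    quadratic term has Laplacian [- s] and pays for killing at rate [s] into the sink, where [U] may
    be 1; [128 r^2] is [2 (8 r)^2], which bounds the squared length on the ball. *)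
Lemma beurling_step (a : nat -> 'rV[int]_2) r (E : R) : (8 <= r)%N -> 0 <= E ->
  (forall j, (j < r)%N -> nrm (a j - val b) = j) ->
  (forall j (y : L), (j < r)%N -> val y = a j -> y \notin A) ->
  (forall x, (nrm (x - val b)%R <= 8 * r)%N -> x \in L) ->
  (forall y : L, (far y <= 8 * r)%N -> U (Some y) <= E) ->
  forall y : L, (far y <= r)%N -> U (Some y) <= 5 / 6 * E + 32 * s * r%:R ^+ 2.
Proof.
move=> r8 E0 ab aA Lb UE y yr.
have r0 : 0 < r%:R :> R by rewrite ltr0n; apply: leq_trans r8.
have l6 : 0 < ln 6 :> R by apply: ln_gt0; lra.
pose K : R := 6 * r%:R * ln 6.
have K0 : 0 < K by rewrite !mulr_gt0.
pose W x := E * (1 - barrier R a r x / K) + s / 4 * (128 * r%:R ^+ 2 - sq R (x - val b)).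
pose V v := if v is Some z then (if (far z <= 8 * r)%N then W (val z) else 1) else 1.
pose D := [set z in A | (far z < 8 * r)%N]%SET.
have W0 x : (nrm (x - val b)%R <= 8 * r)%N -> 0 <= W x.
  move=> xr; apply: addr_ge0; apply: mulr_ge0 => //.
  - by rewrite subr_ge0 ler_pdivrMr // mul1r; exact: (@barrier_max R _ _ _ r8 ab).
  - by rewrite divr_ge0 // ltW.
  - rewrite subr_ge0; apply: le_trans (sq_le R xr) _.
    by rewrite natrM exprMn; lra.
have VW z : (far z <= 8 * r)%N -> V (Some z) = W (val z) by move=> /= ->.
have hUD : harmonic om D U by move=> x; rewrite inE => /andP[xA _]; exact: hU.
have sV : superharmonic om D V.
  move=> x; rewrite inE => /andP[xA xr].
  have nx z : nearest_neighbours z (val x) -> (nrm (z - val b)%R <= 8 * r)%N.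
    by move=> h; apply: leq_trans (nrm_nn _ h) _.
  have int z : nearest_neighbours z (val x) -> z \in L by move=> /nx; exact: Lb.
  rewrite tree_weight_total sum_full killing_interior // VW ?(ltnW xr) // [V None]/= mulr1.
  have -> : \sum_z edge R (site_adj (L:=L)) x z * V (Some z) = nbr_sum W (val x).
    rewrite -(sum_edge_interior _ int); apply: eq_bigr => z _; rewrite /edge.
    have [h|] := boolP (site_adj x z); last by rewrite !mul0r.
    by rewrite VW //; exact: nx.
  have xa j : (j < r)%N -> val x != a j.
    by move=> jr; apply/negP => /eqP e; have := aA j x jr e; rewrite xA.
  have sub : 4 * barrier R a r (val x) <= nbr_sum (barrier R a r) (val x) by apply: barrier_subharmonic.
  have -> : nbr_sum W (val x) = 4 * E - E / K * nbr_sum (barrier R a r) (val x) +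
      s / 4 * (4 * (128 * r%:R ^+ 2) - nbr_sum (fun z => sq R (z - val b)) (val x)).
    rewrite /nbr_sum /W !big_ord_recl !big_ord0; field; exact: lt0r_neq0.
  rewrite nbr_sum_sq2.
  have EK : 0 <= E / K by rewrite divr_ge0 // ltW.
  have h1 := ler_wpM2l EK sub.
  have Wx : W (val x) = E - E / K * barrier R a r (val x) + s / 4 * (128 * r%:R ^+ 2 - sq R (val x - val b)).
    by rewrite /W; field; exact: lt0r_neq0.
  have h2 := W0 (val x) (ltnW xr).
  have h3 : 0 <= s * W (val x) by rewrite mulr_ge0 // ltW.
  have -> : (c + s) * W (val x) = 4 * W (val x) + s * W (val x) by rewrite natrM; ring.
  move: h1 h3 Wx {h2 sub}; rewrite mulrCA.
  move: (W _) (E / K * barrier _ _ _ _) (E / K * nbr_sum _ _) (sq _ _) => w hb nb q.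
  lra.
have h8 : forall v, ~~ inside D v -> U v <= V v.
  case=> [z|_]; last exact: U1.
  rewrite /inside inE negb_and -leqNgt.
  have [zr|zr] := leqP (far z) (8 * r); last by move=> _; rewrite /V leqNgt zr; exact: U1.
  rewrite VW // => /orP[zA|zr'].
    by apply: le_trans (UA zA) (W0 _ zr).
  apply: le_trans (UE z zr) _.
  have bf : barrier R a r (val z) <= 0 by apply: (@barrier_far R (val b)).
  rewrite /W mulrBr mulr1 -addrA lerDl addr_ge0 //.
    by rewrite -mulrN mulr_ge0 // -mulNr divr_ge0 ?oppr_ge0 // ltW.
  rewrite mulr_ge0 ?divr_ge0 ?(ltW s_gt0) // subr_ge0; apply: le_trans (sq_le R zr) _.
  by rewrite natrM exprMn; lra.
apply: le_trans (comparison om_ge0 (tA D) sV hUD h8 (Some y)) _.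
have y8 : (far y <= 8 * r)%N by apply: leq_trans yr _; rewrite leq_pmull.
rewrite VW // /W; apply: lerD.
  rewrite mulrC ler_wpM2r // lerBlDr -lerBlDl ler_pdivlMr //.
  have bn : r%:R * ln 6 <= barrier R a r (val y) by apply: (@barrier_near R (val b)).
  by apply: le_trans bn; rewrite /K; lra.
have q0 := sq_ge0 R (val y - val b).
by move: (mulr_ge0 (ltW s_gt0) q0); move: (sq _ _) => q; lra.
Qed.

Lemma beurling (a : nat -> 'rV[int]_2) J : (0 < J)%N -> s * 64 ^+ J <= 1 ->
  (forall j, (j < 8 ^ J)%N -> nrm (a j - val b) = j) ->
  (forall j (y : L), (j < 8 ^ J)%N -> val y = a j -> y \notin A) ->
  (forall x, (nrm (x - val b)%R <= 8 ^ J)%N -> x \in L) ->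
  forall y : L, (far y <= 8)%N -> U (Some y) <= 2 * (5 / 6) ^+ J.-1.
Proof.
move=> J0 sJ ab aA Lb.
(* The subtracted [(64 ^+ i)^-1] absorbs the additive errors: for [r = 8 ^ (J - i.+1)] the term
   [32 s r^2] is at most half of it. *)
have H i : (i < J)%N -> forall y : L, (far y <= 8 ^ (J - i))%N ->
    U (Some y) <= 2 * (5 / 6) ^+ i - (64 ^+ i)^-1.
  elim: i => [|i IH] iJ y yr; first by rewrite !expr0 invr1; apply: le_trans (U1 _) _; lra.
  pose r := (8 ^ (J - i.+1))%N.
  have rE : (8 * r = 8 ^ (J - i))%N by rewrite /r -expnS; congr (8 ^ _)%N; lia.
  have r8 : (8 <= r)%N by rewrite -[X in (X <= _)%N]expn1 leq_exp2l //; lia.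
  have rJ : (8 * r <= 8 ^ J)%N by rewrite rE leq_exp2l //; lia.
  have rJ' : (r <= 8 ^ J)%N by apply: leq_trans rJ; rewrite leq_pmull.
  have p0 : 0 < 64 ^+ i :> R by rewrite exprn_gt0.
  have e0 : 0 <= 2 * (5 / 6) ^+ i - (64 ^+ i)^-1 :> R.
    rewrite subr_ge0 -exprVn; apply: le_trans (_ : (5 / 6) ^+ i <= _).
      by rewrite lerXn2r ?nnegrE ?divr_ge0 ?invr_ge0 //; lra.
    by rewrite ler_peMl ?exprn_ge0 ?divr_ge0 //; lra.
  apply: le_trans (beurling_step r8 e0 _ _ _ _ yr) _ => [j jr|j z jr|x xr|z zr|].
  - by apply: ab; apply: leq_trans jr rJ'.
  - by apply: aA; apply: leq_trans jr rJ'.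
  - by apply: Lb; apply: leq_trans xr rJ.
  - by apply: IH; [exact: ltnW|rewrite -rE].
  have r2 : r%:R ^+ 2 * (64 * 64 ^+ i) = 64 ^+ J :> R.
    rewrite -exprS /r -natrX -expnM mulnC expnM -(natrX _ 64) -natrM -natrX; congr (_%:R).
    by rewrite -expnD; congr (_ ^ _)%N; lia.
  have sr : s * r%:R ^+ 2 <= (64 * 64 ^+ i)^-1.
    by rewrite -[X in _ <= X]mul1r ler_pdivlMr ?mulr_gt0 // -mulrA r2.
  rewrite !exprS invfM; rewrite invfM in sr.
  have i0 : 0 < (64 ^+ i)^-1 :> R by rewrite invr_gt0.
  lra.
move=> y y8; case: J J0 H {sJ ab aA Lb} => // J _ H.
apply: le_trans (H J _ y _) _ => //; first by rewrite subSnn expn1.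
by rewrite lerBlDr lerDl invr_ge0 exprn_ge0.
Qed.
End beurling.

Section plane_escape.
Variables (R : realType) (L : {fset 'rV[int]_2}) (s : R).
Local Notation c := ((2 * 2)%:R : R).
Local Notation om := (tree_weight (@site_adj 2 L) c s).
Hypotheses (s01 : 0 < s <= 1).

Let s_gt0 : 0 < s. Proof. by case/andP: s01. Qed.
Let om_ge0 y v : 0 <= om y v. Proof. by apply: tree_weight_ge0 (ltW s_gt0) _ _; exact: site_deg_le. Qed.

Lemma chain_sites (Q : {set L}) (x b : L) n : b \in Q -> (n <= nrm (val x - val b)%R)%N ->
  connect (chain om Q) x b ->
  exists a : nat -> 'rV[int]_2, (forall j, (j < n)%N -> nrm (a j - val b) = j) /\
    (forall j (y : L), (j < n)%N -> val y = a j -> y \in Q).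
Proof.
move=> bQ nx cxb.
have lip y z : chain om Q y z -> (nrm (val y - val b)%R <= (nrm (val z - val b)%R).+1)%N.
  rewrite /chain /tree_weight /= inE /edge => /andP[_ h]; apply: nrm_nn.
  have [yz|/negbTE yz] := boolP (site_adj y z); last by move: h; rewrite yz ltxx.
  by move: yz; rewrite /site_adj nn_sym.
have H j : exists p : 'rV[int]_2, (j < n)%N -> nrm (p - val b) = j /\
    forall y : L, val y = p -> y \in Q.
  have [jn|jn] := ltnP j n; last by exists 0.
  have lv : (nrm (val b - val b)%R <= j <= nrm (val x - val b)%R)%N.
    by rewrite subrr nrm0 /=; apply: leq_trans (ltnW jn) nx.
  have [p pj pQ] := chain_levels lip cxb lv.
  exists (val p) => _; split => // y /val_inj ->.
  by case: pQ => [->|[z /andP[]]].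
have [a ha] := boolp.choice H; exists a; split => [j jn|j y jn].
  by have [] := ha j jn.
by have [_] := ha j jn; exact.
Qed.

(** The chain from [x] to [b] meets every sphere about [b] of radius below [8 ^ J]. The function
    [U], the probability of exiting at the sink, vanishes on it, so [beurling] applies at the
    neighbours of [b]. *)
Lemma plane_escape (A : {set L}) (x b z : L) J : (0 < J)%N -> s * 64 ^+ J <= 1 ->
  b \notin A -> (8 ^ J <= nrm (val x - val b)%R)%N ->
  (forall p, (nrm (p - val b)%R <= 8 ^ J)%N -> p \in L) ->
  connect (chain om (~: A)) x b -> 0 < om b (Some z) ->
  treeY om A (Some z) (pred1 None) <= 2 * (5 / 6) ^+ J.-1 * treeZ om A.
Proof.
move=> J0 sJ bA xJ Lb cxb obz.
have bQ : b \in ~: A by rewrite inE.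
have [a [ab aQ]] := chain_sites bQ xJ cxb.
have tA : transient om A.
  apply: free_transient => y; apply: lt_le_trans s_gt0 _.
  by apply: killing_ge; exact: site_deg_le.
pose q (v : option L) : R := (v == None)%:R.
have [U [Uq hU]] := dirichlet om_ge0 q tA.
rewrite (treeY_harmonic _ hU) => [|w wA]; last by rewrite Uq.
rewrite mulrC ler_wpM2r ?treeZ_ge0 //.
have U1 v : U v <= 1.
  have := @comparison _ _ om om_ge0 A U (fun=> 1) tA _ hU; apply => [y _|w wA].
    by rewrite -mulr_suml.
  by rewrite Uq // /q; case: (_ == _).
have UA y : y \notin A -> U (Some y) <= 0 by move=> yA; rewrite Uq.
apply: (beurling s01 hU U1 UA J0 sJ ab _ Lb).
  by move=> j y jJ e; have := aQ j y jJ e; rewrite inE.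
have bz : site_adj b z.
  move: obz; rewrite /tree_weight /= inE /edge.
  by case: (site_adj b z) => //; rewrite ltxx.
apply: leq_trans (nrm_nn (val b) (_ : nearest_neighbours (val z) (val b))) _ => //.
by rewrite subrr nrm0.
Qed.

(** [9 * 64 ^+ J] bounds the number of sites within [8 ^ J] of a site of [B]; the 8 is the total
    edge weight 4 times the constant 2 of [plane_escape]. *)
Lemma plane_mean_descendants (B : {set L}) J : (0 < J)%N -> s * 64 ^+ J <= 1 ->
  0 < Ztree (@site_adj 2 L) c s ->
  (forall (b : L) p, b \in B -> (nrm (p - val b)%R <= 8 ^ J)%N -> p \in L) ->
  mean_descendants (@site_adj 2 L) c B s <=
    #|B|%:R * (9 * 64 ^+ J + 1 + 8 * (5 / 6) ^+ J.-1 / s).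
Proof.
move=> J0 sJ Z0 LB.
pose near := (\bigcup_(b in B) [set y : L | (nrm (val y - val b)%R <= 8 ^ J)%N])%SET.
have beta0 : 0 <= 2 * (5 / 6) ^+ J.-1 :> R by rewrite mulr_ge0 ?exprn_ge0 ?divr_ge0.
have sym := @site_adj_sym 2 L; have dl := @site_deg_le 2 R L.
have far x : x \notin near -> forall b, b \in B -> (8 ^ J <= nrm (val x - val b)%R)%N.
  move=> xn b bB; rewrite leqNgt; apply: contra xn => h.
  by apply/bigcupP; exists b => //; rewrite inE ltnW.
have B0 b : b \in B -> om b None = s.
  move=> bB; rewrite /tree_weight /= killing_interior // => p /(nrm_nn (val b)) h.
  apply: (LB b) => //; apply: leq_trans h _; rewrite subrr nrm0.
  by rewrite expn_gt0.
have Bs b : b \in B -> \sum_z om b (Some z) <= c.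
  move=> bB; have := tree_weight_total (@site_adj 2 L) c s b.
  by rewrite big_option B0 // => h; lra.
apply: le_trans (mean_descendants_escape sym dl (ltW s_gt0) Z0 (near := near) (beta := 2 * (5 / 6) ^+ J.-1) s_gt0 _ beta0 _) _.
- by [].
- move=> x xn; apply: le_trans (_ : tree_sum om [set: L]%SET (fun f => (descendant B f x)%:R *
    (exit [set: L]%SET f (Some x) == None)%:R) <= _); first by rewrite tree_sum_exit_setT.
  apply: le_trans (descendant_le om_ge0 beta0 _) _.
    move=> A b z bB bA xA cxb ob zA; apply: (plane_escape J0 sJ bA _ _ cxb ob) => //.
      exact: far.
    by move=> p; exact: LB.
  apply: ler_sum => b bB; rewrite ler_wpM2r ?treeY_ge0 // B0 // lerD2l mulrC ler_wpM2r //.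
  exact: Bs.
have nearC : (#|near|%:R : R) <= #|B|%:R * (9 * 64 ^+ J).
  have -> : 9 * 64 ^+ J = (9 * 64 ^ J)%:R :> R by rewrite natrM natrX.
  rewrite -natrM ler_nat.
  apply: leq_trans (_ : \sum_(b in B) #|[set y : L | (nrm (val y - val b)%R <= 8 ^ J)%N]%SET| <= _)%N.
    by apply: (big_ind2 (fun (X : {set L}) n => #|X| <= n)%N) => [|X1 n1 X2 n2 h1 h2|//];
      rewrite ?cards0 //; apply: leq_trans (leq_card_setU _ _) _; exact: leq_add.
  rewrite -sum_nat_const; apply: leq_sum => b _; apply: leq_trans (card_near _ _ _) _.
  have -> : (64 ^ J = (8 ^ J) ^ 2)%N by rewrite -expnM mulnC expnM.
  have : (0 < 8 ^ J)%N by rewrite expn_gt0.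
  by move: (8 ^ J)%N => n; nia.
apply: le_trans (lerD nearC (lexx _)) _.
rewrite -mulrDr ler_wpM2l // -addrA lerD2l.
rewrite mulrDl divff ?gt_eqF // lerD2l.
by rewrite ler_wpM2r ?invr_ge0 ?(ltW s_gt0) // natrM; lra.
Qed.
End plane_escape.

(** * A crude Green function bound on cubes *)

Section quadratic.
Variables (R : realType) (d N : nat).
Hypothesis d_gt0 : (0 < d)%N.

(** Its height leaves it quadratic on the cube and all neighbours of the cube; the truncation makes
    it nonnegative on the lattice. It certifies transience at zero dissipation, with a bound that
    depends on [N]. *)
Definition paraboloid (x : 'rV[int]_d) : R := Num.max 0 (d%:R * N.+1%:R ^+ 2 - sq R x).

Lemma paraboloid_ge0 x : 0 <= paraboloid x.
Proof. by rewrite /paraboloid le_max lexx. Qed.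

Lemma paraboloid_super x : (nrm x <= N)%N ->
  ((2 * d)%:R + 0) * paraboloid x - nbr_sum paraboloid x = (2 * d)%:R.
Proof.
move=> xN.
have E z : (nrm z <= N.+1)%N -> paraboloid z = d%:R * N.+1%:R ^+ 2 - sq R z.
  by move=> zN; apply: max_r; rewrite subr_ge0; exact: sq_le.
have nb i : (nrm (x + unit_vec i)%R <= N.+1)%N /\ (nrm (x - unit_vec i)%R <= N.+1)%N.
  have h := nrmD x (unit_vec i); have h' := nrmD x (- unit_vec i).
  by rewrite nrmN in h'; rewrite nrm_unit in h h'; split; lia.
rewrite /nbr_sum; under eq_bigr => i _.
  have [h1 h2] := nb i; rewrite !E //.
  have [e1 e2] := sqE x i (0 : R); rewrite !addr0 in e1; rewrite !addr0 in e2; rewrite e1 e2.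
  have -> : d%:R * N.+1%:R ^+ 2 - (sq R x + 1 + 2 * (x 0 i)%:~R) + (d%:R * N.+1%:R ^+ 2 - (sq R x + 1 - 2 * (x 0 i)%:~R)) =
     2 * (d%:R * N.+1%:R ^+ 2 - sq R x - 1) by ring.
  over.
rewrite sumr_const card_ord -mulr_natl E ?(leq_trans xN) // natrM; ring.
Qed.

Local Notation L := (cube d N).
Local Notation adj := (@site_adj d L).

Lemma cube_green_bound (k : L -> R) (x : L) :
  (forall y, killing adj ((2 * d)%:R : R) 0 y <= k y) ->
  treeZ (free_weight (edge R adj) [set: L]%SET k) ([set: L]%SET :\ x) <=
  (d%:R * N.+1%:R ^+ 2) * treeZ (free_weight (edge R adj) [set: L]%SET k) [set: L]%SET.
Proof.
move=> kk; have k0 y : 0 <= k y.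
  by apply: le_trans (kk y); apply: killing_ge; exact: site_deg_le.
have o0 y v : 0 <= free_weight (edge R adj) [set: L]%SET k y v.
  by apply: free_weight_ge0 => //; exact: edge_ge0.
have sup (y : L) : 1 <= (\sum_v free_weight (edge R adj) [set: L]%SET k y v) * lift_fun paraboloid (Some y) -
    \sum_v free_weight (edge R adj) [set: L]%SET k y v * lift_fun paraboloid v.
  apply: (@lift_superharmonic d R L 0) => // [z|]; first exact: paraboloid_ge0.
  rewrite paraboloid_super; last by rewrite -in_cube; exact: valP.
  by rewrite ler1n muln_gt0.
apply: le_trans (@green_diag_le _ _ _ o0 _ (lift_fun paraboloid) x _ _ _ _) _.
- by rewrite inE.
- by case=> //= y; exact: paraboloid_ge0.
- by move=> y _; rewrite -subr_ge0; apply: le_trans (sup y).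
- exact: sup.
rewrite mulrC; apply: ler_wpM2r; first exact: treeZ_ge0.
by rewrite /= /paraboloid ge_max mulr_ge0 ?exprn_ge0 // gerBl sq_ge0.
Qed.

End quadratic.

Lemma box_card_bound k : (0 < k)%N -> ((k + k).+1 ^ 2 <= 9 * k ^ 2)%N.
Proof.
move=> k0; have -> : (9 * k ^ 2 = (3 * k) ^ 2)%N by rewrite expnMn.
by rewrite leq_exp2r //; lia.
Qed.

Lemma cube_card_bound k n N : (0 < k)%N -> (0 < n)%N -> (N < k + n)%N ->
  ((N + N).+1 ^ 2 <= 36 * k ^ 2 * n ^ 2)%N.
Proof.
move=> k0 n0 h; have -> : (36 * k ^ 2 * n ^ 2 = (6 * (k * n)) ^ 2)%N by rewrite !expnMn mulnA.
rewrite leq_exp2r //; have : (k + n <= 2 * (k * n))%N by nia.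
by lia.
Qed.

Lemma nrm_shift_le d (p b : 'rV[int]_d) m k N : (nrm (p - b)%R <= m)%N -> (nrm b <= k)%N ->
  (k + m <= N)%N -> (nrm p <= N)%N.
Proof.
move=> pb bk kN; rewrite -[p](subrK b); apply: leq_trans (nrmD _ _) _.
by rewrite addnC; apply: leq_trans kN; exact: leq_add.
Qed.

(** * Summation over the scales of dissipation in the plane *)

Section plane_volume.
Variable R : realType.

(** Absorbs the logarithmic growth of the Green function into a slightly larger ratio: [36 / 35] is
    [(6 / 7) / (5 / 6)]. *)
Lemma bernoulli_geometric J : J.+1%:R * (5 / 6) ^+ J <= 36 * (6 / 7) ^+ J :> R.
Proof.
have h : 35 + J%:R <= 35 * (36 / 35) ^+ J :> R.
  elim: J => [|J IH]; first by rewrite expr0; lra.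
  have j0 : 0 <= J%:R :> R by [].
  rewrite exprS -(natr1 J); lra.
have -> : 6 / 7 = 5 / 6 * (36 / 35) :> R by field.
have j0 : 0 <= J%:R :> R by [].
rewrite [X in _ <= _ * X]exprMn; have p0 : 0 <= (5 / 6) ^+ J :> R by rewrite exprn_ge0 // divr_ge0.
have h2 : J.+1%:R <= 36 * (36 / 35) ^+ J :> R by rewrite -(natr1 J); lra.
have := ler_wpM2l p0 h2; rewrite mulrCA => h3.
by rewrite mulrC.
Qed.

Lemma scale_ratio J : (0 < J)%N ->
  8 * (5 / 6) ^+ J.-1 / (80 ^+ J.+1)^-1 = (8 * 80 * (6 / 5)) * ((5 / 6) ^+ J * 80 ^+ J) :> R.
Proof.
case: J => // j _; rewrite invrK [J in J.-1]/= [_.+1.-1]/= (exprS _ j.+1) [(_ / _) ^+ j.+1]exprS [80 ^+ j.+1]exprS.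
by field.
Qed.

Variables (N k : nat).
Hypotheses (k0 : (0 < k)%N) (kN : (k <= N)%N).
Local Notation L := (cube 2 N).
Local Notation adj := (@site_adj 2 L).
Local Notation c := ((2 * 2)%:R : R).
Local Notation B := [set y : L | (nrm (val y) <= k)%N]%SET.
Let sym := @site_adj_sym 2 L.
Let dl := @site_deg_le 2 R L.
Let s_ (J : nat) : R := (80 ^+ J)^-1.

Let s_gt0 J : 0 < s_ J. Proof. by rewrite invr_gt0 exprn_gt0. Qed.
Let s_le1 J : s_ J <= 1. Proof. by rewrite invf_le1 ?exprn_gt0 // exprn_ege1 //; lra. Qed.
Let green s : 0 < s <= 1 -> forall (kap : L -> R) (x : L), (forall y, killing adj c s y <= kap y) ->
  treeZ (free_weight (edge R adj) [set: L]%SET kap) ([set: L]%SET :\ x) <=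
  (ln (s^-1) + 5) * treeZ (free_weight (edge R adj) [set: L]%SET kap) [set: L]%SET.
Proof. by move=> s01 kap x; exact: plane_green_bound. Qed.

Let Z_gt0 s : 0 < s <= 1 -> 0 < Ztree adj c s.
Proof.
move=> s01; have /andP[s0 s1] := s01.
apply: (@Ztree_gt0 R L adj c dl s (ln (s^-1) + 5)); [exact: ltW| |exact: green].
by rewrite addr_ge0 // ln_ge0 // invf_ge1.
Qed.

Lemma plane_step_loss J t : (0 < J)%N -> 0 <= t <= (80 ^+ J)^-1 ->
  expected_loss adj c B (80 ^+ J.+1)^-1 t (ln (((80 ^+ J.+1)^-1)^-1) + 5) <=
  (80 * 90 * 84 * 36) * k%:R ^+ 2 * (6 / 7) ^+ J.
Proof.
move=> J0 /andP[t0 tJ]; set s := (80 ^+ J.+1)^-1.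
have s01 : 0 < s <= 1 by rewrite [0 < s]s_gt0 [s <= 1]s_le1.
have K1 : 1 <= k%:R :> R by rewrite ler1n.
have lnE : ln (s^-1) = J.+1%:R * ln 80 by rewrite /s invrK lnXn // mulr_natl.
have l80 : 0 <= (ln 80 : R) <= 79.
  by rewrite ln_ge0 ?(le_trans (ln_leB1 _)) //; lra.
have M0 : 0 <= ln s^-1 + 5.
  by rewrite lnE addr_ge0 // mulr_ge0 //; case/andP: l80.
apply: le_trans (expected_loss_le_mean dl _ (ltW (s_gt0 _)) (Z_gt0 s01) t0 M0) _.
(* The choice of 80: as [80 * 5 / 6 > 64], the count of near sites is dominated by the escape term
   [P]. *)
pose P : R := (5 / 6) ^+ J * 80 ^+ J.
have P64 : 64 ^+ J <= P by rewrite /P -exprMn lerXn2r ?nnegrE //; lra.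
have P1 : 1 <= P by apply: le_trans P64; rewrite exprn_ege1 //; lra.
have B9 : (#|B|%:R : R) <= 9 * k%:R ^+ 2.
  have -> : 9 * k%:R ^+ 2 = (9 * k ^ 2)%:R :> R by rewrite natrM natrX.
  rewrite ler_nat; apply: leq_trans (_ : (k + k).+1 ^ 2 <= _)%N; last first.
    exact: box_card_bound.
  apply: leq_trans (card_near L 0 k); apply: subset_leq_card.
  by apply/fintype.subsetP => y; rewrite !inE subr0.
have mean : mean_descendants adj c B s <= 80 * 90 * k%:R ^+ 2 * P.
  (* Either the balls of radius [8 ^ J] about the box fit into the cube, or the cube is small enough
     for all its sites to be counted. *)
  have [kJ|kJ] := leqP (k + 8 ^ J) N.
    apply: le_trans (plane_mean_descendants s01 J0 _ (Z_gt0 s01) _) _.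
    - rewrite /s exprS invfM -mulrA ler_pdivrMl //.
      rewrite mulr1 ler_pdivrMl ?exprn_gt0 //.
      by apply: le_trans (_ : 80 ^+ J <= _); [rewrite lerXn2r ?nnegrE //; lra|
         rewrite ler_peMr ?exprn_ge0 //; lra].
    - move=> b p; rewrite inE => bk pb; rewrite in_cube.
      exact: nrm_shift_le pb bk kJ.
    apply: le_trans (ler_wpM2r _ B9) _.
      by rewrite !addr_ge0 ?mulr_ge0 ?exprn_ge0 ?divr_ge0 // ?invr_ge0 ?exprn_ge0 // ?(ltW (s_gt0 _)).
    rewrite scale_ratio // -/P.
    have -> : 80 * 90 * k%:R ^+ 2 * P = 9 * k%:R ^+ 2 * (800 * P) by ring.
    by rewrite ler_wpM2l ?mulr_ge0 ?exprn_ge0 //; lra.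
  apply: le_trans (mean_descendants_le_card dl _ (ltW (s_gt0 _)) (Z_gt0 s01)) _.
  rewrite -cardfE; apply: le_trans (_ : 36 * k%:R ^+ 2 * 64 ^+ J <= _).
    have -> : 36 * k%:R ^+ 2 * 64 ^+ J = (36 * k ^ 2 * 64 ^ J)%:R :> R by rewrite !natrM !natrX.
    rewrite ler_nat; apply: leq_trans (card_cube 2 N) _.
    have -> : (64 ^ J = (8 ^ J) ^ 2)%N by rewrite -expnM mulnC expnM.
    have : (0 < 8 ^ J)%N by rewrite expn_gt0.
    by move=> n0; exact: cube_card_bound.
  by apply: ler_pM; rewrite ?mulr_ge0 ?exprn_ge0 //; apply: ler_wpM2r; rewrite ?exprn_ge0 //; lra.
apply: le_trans (ler_wpM2r (mulr_ge0 t0 M0) mean) _.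
have tM : t * (ln s^-1 + 5) <= (80 ^+ J)^-1 * (84 * J.+1%:R).
  apply: ler_pM => //; rewrite lnE; have j1 : 1 <= J.+1%:R :> R by rewrite ler1n.
  by case/andP: l80 => l0 l1; nra.
apply: le_trans (ler_wpM2l _ tM) _; first by rewrite !mulr_ge0 ?exprn_ge0 //; lra.
have -> : 80 * 90 * k%:R ^+ 2 * P * ((80 ^+ J)^-1 * (84 * J.+1%:R)) =
   80 * 90 * 84 * k%:R ^+ 2 * (J.+1%:R * (5 / 6) ^+ J).
  by rewrite /P; field; exact: lt0r_neq0 (exprn_gt0 _ _).
have -> : 80 * 90 * 84 * 36 * k%:R ^+ 2 * (6 / 7) ^+ J = 80 * 90 * 84 * k%:R ^+ 2 * (36 * (6 / 7) ^+ J) :> R by ring.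
by rewrite ler_wpM2l ?mulr_ge0 ?exprn_ge0 //; exact: bernoulli_geometric.
Qed.

(** The dissipation goes from 0 to a tiny [80^-(J+i+1)], then up the scales to [g]. The losses on
    the scales form a geometric series of ratio 6/7, whence the factor 7. The initial step uses the
    bound depending on [N]; its loss vanishes as [i] grows with [N] fixed. *)
Lemma plane_finite_volume (E : set (heights L R)) (g : R) J : (0 < J)%N ->
  measurable E -> cylindrical B E -> E `<=` low_on_B c B ->
  (80 ^+ J.+1)^-1 <= g <= (80 ^+ J)^-1 ->
  sandpile_mass adj c 0 E <= sandpile_mass adj c g E +
    7 * (80 * 90 * 84 * 36) * k%:R ^+ 2 * (6 / 7) ^+ J.
Proof.
move=> J0 mE cE El /andP[gl gu].
set C : R := 80 * 90 * 84 * 36 * k%:R ^+ 2.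
have step j t : (0 < j)%N -> 0 <= t <= s_ j ->
    sandpile_mass adj c (s_ j.+1) E <= sandpile_mass adj c (s_ j.+1 + t) E + C * (6 / 7) ^+ j.
  move=> j0 tj; have /andP[t0 _] := tj.
  have s01 : 0 < s_ j.+1 <= 1 by rewrite s_gt0 s_le1.
  have M0 : 0 <= ln (s_ j.+1)^-1 + 5 by rewrite addr_ge0 // ln_ge0 // invf_ge1.
  have := sandpile_mass_comparison sym dl (ltW (s_gt0 j.+1)) t0 M0 (green s01) mE cE El.
  rewrite lerBlDr => /le_trans; apply; rewrite lerD2l; exact: plane_step_loss.
have chain i : sandpile_mass adj c (s_ (J + i).+1) E <= sandpile_mass adj c g E +
    7 * C * ((6 / 7) ^+ J - (6 / 7) ^+ (J + i).+1).
  elim: i => [|i IH].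
    rewrite addn0; have := step J (g - s_ J.+1) J0; rewrite (_ : s_ J.+1 + _ = g); last by rewrite addrC subrK.
    move=> /(_ _)/le_trans; apply.
      rewrite subr_ge0 gl /= lerBlDr; apply: le_trans gu _; rewrite lerDl; exact: ltW.
    by rewrite lerD2l exprS; lra.
  rewrite addnS; have := step (J + i).+1 (s_ (J + i).+1 - s_ (J + i).+2) isT.
  rewrite (_ : s_ (J + i).+2 + _ = s_ (J + i).+1); last by rewrite addrC subrK.
  move=> /(_ _)/le_trans; apply.
    apply/andP; split; last by rewrite gerBl ltW.
    rewrite subr_ge0 lef_pV2 ?posrE ?exprn_gt0 //.
    by rewrite [X in _ <= X]exprS ler_peMl ?exprn_ge0 //; lra.
  apply: le_trans (lerD IH (lexx _)) _.
  by rewrite (exprS _ (J + i).+1); lra.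
have C0 : 0 <= C by rewrite /C !mulr_ge0 ?exprn_ge0.
have bound i : sandpile_mass adj c 0 E <= sandpile_mass adj c g E + 7 * C * (6 / 7) ^+ J +
    #|{: L}|%:R * (2%:R * N.+1%:R ^+ 2) / i.+1%:R.
  pose M : R := 2%:R * N.+1%:R ^+ 2.
  have M0 : 0 <= M by rewrite /M mulr_ge0 ?exprn_ge0.
  pose t := s_ (J + i).+1.
  have g0 := @cube_green_bound R 2 N isT.
  have := sandpile_mass_comparison sym dl (lexx 0) (ltW (s_gt0 (J + i).+1)) M0 g0 mE cE El.
  rewrite add0r lerBlDr => /le_trans; apply; apply: lerD.
    apply: le_trans (chain i) _; rewrite lerD2l ler_wpM2l ?mulr_ge0 //.
    by rewrite gerBl exprn_ge0 // divr_ge0.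
  have Z0 : 0 < Ztree adj c 0 by apply: (@Ztree_gt0 R L adj c dl 0 M).
  apply: le_trans (expected_loss_le_mean dl _ (lexx 0) Z0 (ltW (s_gt0 _)) M0) _.
  apply: le_trans (ler_wpM2r _ (mean_descendants_le_card dl _ (lexx 0) Z0)) _ => //.
    by rewrite mulr_ge0 // ltW.
  rewrite -mulrA -/M ler_wpM2l // mulrC ler_wpM2l // lef_pV2 ?posrE ?exprn_gt0 //.
  apply: (@le_trans _ _ ((2 ^ (J + i).+1)%:R)).
    rewrite ler_nat; apply: leq_trans (_ : (J + i).+1 <= _)%N; first by rewrite ltnS leq_addl.
    by apply: ltnW; apply: ltn_expl.
  by rewrite natrX lerXn2r ?nnegrE //; lra.
apply/ler_addgt0Pr => e e0.
pose D : R := #|{: L}|%:R * (2%:R * N.+1%:R ^+ 2).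
have D0 : 0 <= D by rewrite /D !mulr_ge0 ?exprn_ge0.
apply: le_trans (bound (Num.truncn (D / e))) _; rewrite -/D.
have -> : 7 * C * (6 / 7) ^+ J = 7 * (80 * 90 * 84 * 36) * k%:R ^+ 2 * (6 / 7) ^+ J by rewrite /C !mulrA.
rewrite lerD2l ler_pdivrMr ?ltr0n // mulrC -ler_pdivrMr //.
by apply: ltW; apply: truncnS_gt.
Qed.
End plane_volume.

(** * Dimension three *)

Section inverse_sqrt.
Variable R : realType.
Implicit Types (t u v a b c q : R).

Lemma ler_of_sqr u v : 0 <= v -> u ^+ 2 <= v ^+ 2 -> u <= v.
Proof. by move=> v0 h; rewrite leNgt; apply/negP => vu; nra. Qed.

Definition isq t : R := (Num.sqrt t)^-1.

Lemma isq_ge0 t : 0 <= isq t. Proof. by rewrite invr_ge0 sqrtr_ge0. Qed.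

Lemma isq_mono t t' : 0 < t -> t <= t' -> isq t' <= isq t.
Proof.
move=> t0 tt; rewrite lef_pV2 ?posrE ?sqrtr_gt0 //; first exact: ler_wsqrtr.
exact: lt_le_trans tt.
Qed.

Lemma isq_natX2 n : (0 < n)%N -> isq (n%:R ^+ 2) = n%:R^-1.
Proof. by move=> n0; rewrite /isq sqrtr_sqr ger0_norm. Qed.

(** The Taylor polynomial of [(1 + u)^(-1/2)]. For [|u| <= 3/5] it lies below that function, and
    above it once [u^4] is added. *)
Let cubic u := 1 - u / 2 + 3 / 8 * u ^+ 2 - 5 / 16 * u ^+ 3.

Let cubic_sqr u : cubic u ^+ 2 * (1 + u) =
  1 - u ^+ 4 * (35 / 64 - 14 / 64 * u + 35 / 256 * u ^+ 2 - 25 / 256 * u ^+ 3).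
Proof. by rewrite /cubic; field. Qed.

Let small_powers u : - (3 / 5) <= u <= 3 / 5 -> 0 <= u ^+ 2 <= 9 / 25.
Proof. by move=> /andP[h1 h2]; rewrite sqr_ge0 /=; nra. Qed.

Lemma isq_cubic_ge t v : 0 < t -> - (3 / 5) <= v / t <= 3 / 5 -> isq t * cubic (v / t) <= isq (t + v).
Proof.
move=> t0; set u := v / t => ub; have /andP[q0 q1] := small_powers ub; have /andP[u1 u2] := ub.
have -> : t + v = t * (1 + u) by rewrite mulrDr mulr1 /u mulrC divfK // gt_eqF.
have p1 : 0 < 1 + u by lra.
rewrite /isq sqrtrM ?(ltW t0) // invfM ler_wpM2l ?isq_ge0 //.
have s0 : 0 < Num.sqrt (1 + u) by rewrite sqrtr_gt0.
rewrite -[X in _ <= X]mul1r ler_pdivlMr //.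
have [c0|c0] := lerP (cubic u) 0; first by apply: le_trans (mulr_le0_ge0 c0 (ltW s0)) _.
apply: ler_of_sqr => //; rewrite expr1n exprMn sqr_sqrtr ?(ltW p1) // cubic_sqr.
rewrite gerBl; apply: mulr_ge0; first by rewrite (exprM u 2 2) sqr_ge0.
rewrite (_ : u ^+ 3 = u * u ^+ 2); last by rewrite -exprS.
by move: (u ^+ 2) q0 q1 => w w0 w1; nra.
Qed.

Lemma isq_quartic_le t v : 0 < t -> - (3 / 5) <= v / t <= 3 / 5 ->
  isq (t + v) <= isq t * (cubic (v / t) + (v / t) ^+ 4).
Proof.
move=> t0; set u := v / t => ub; have /andP[q0 q1] := small_powers ub; have /andP[u1 u2] := ub.
have -> : t + v = t * (1 + u) by rewrite mulrDr mulr1 /u mulrC divfK // gt_eqF.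
have p1 : 0 < 1 + u by lra.
rewrite /isq sqrtrM ?(ltW t0) // invfM ler_wpM2l ?isq_ge0 //.
have s0 : 0 < Num.sqrt (1 + u) by rewrite sqrtr_gt0.
rewrite -[X in X <= _]mul1r ler_pdivrMr //.
have u4 : 0 <= u ^+ 4 by rewrite (exprM u 2 2) sqr_ge0.
have u3 : u ^+ 3 = u * u ^+ 2 by rewrite -exprS.
have c0 : 0 <= cubic u.
  by rewrite /cubic u3; move: (u ^+ 2) q0 q1 => w w0 w1; nra.
apply: ler_of_sqr; first by apply: mulr_ge0; [exact: addr_ge0|exact: ltW].
rewrite expr1n exprMn sqr_sqrtr ?(ltW p1) //.
have -> : (cubic u + u ^+ 4) ^+ 2 * (1 + u) = cubic u ^+ 2 * (1 + u) +
    u ^+ 4 * (2 * (cubic u * (1 + u))) + u ^+ 4 * u ^+ 4 * (1 + u) by ring.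
have h2 : 0 <= u ^+ 4 * u ^+ 4 * (1 + u).
  by apply: mulr_ge0; [exact: mulr_ge0|exact: ltW].
suff h1 : 0 <= u ^+ 4 * (2 * (cubic u * (1 + u)) -
    (35 / 64 - 14 / 64 * u + 35 / 256 * u ^+ 2 - 25 / 256 * u ^+ 3)).
  rewrite cubic_sqr; move: h1; rewrite mulrBr; move: (u ^+ 4 * (2 * _)) (u ^+ 4 * (35 / 64 - _ + _ - _)) h2 => y z.
  by move: (_ * (1 + u)) => w; lra.
apply: mulr_ge0; [exact: u4|rewrite subr_ge0].
have -> : 2 * (cubic u * (1 + u)) = 2 + u - 1 / 4 * u ^+ 2 + 1 / 8 * u ^+ 3 - 5 / 8 * (u ^+ 2 * u ^+ 2).
  by rewrite /cubic; field.
rewrite u3; move: (u ^+ 2) q0 q1 => w w0 w1; nra.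
Qed.

Lemma inv_cubic_ge t v : 0 < t -> 0 < t + v ->
  t^-1 * (1 - v / t + (v / t) ^+ 2 - (v / t) ^+ 3) <= (t + v)^-1.
Proof.
move=> t0 tv0; rewrite -[X in _ <= X]mul1r ler_pdivlMr //.
have -> : t^-1 * (1 - v / t + (v / t) ^+ 2 - (v / t) ^+ 3) * (t + v) = 1 - (v / t) ^+ 4.
  by field; exact: lt0r_neq0.
by rewrite gerBl (exprM _ 2 2) sqr_ge0.
Qed.

(** The averaged Taylor bounds, with [i = q^(-1/2)] and [s = 1 / q]. The terms linear in [i * s]
    cancel; of order [s^2] there remain a gain 4 and a loss [21/4 * i], and the other terms are
    small since [q >= 16]. *)
Lemma shell_inequality (i s : R) : 0 <= i <= 1 / 4 -> 0 < s <= 16^-1 ->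
  6 * (i + 2 * s) <= i * (6 - 3 * s + 3 * (4^-1 * (3 * (s * s) + 4 * s)) -
     5 * (8^-1 * (3 * (s * (s * s)) + 12 * (s * s)))) +
    2 * (s * (6 - 6 * s + (6 * (s * s) + 8 * s) - (6 * (s * (s * s)) + 24 * (s * s)))).
Proof.
move=> /andP[i0 i4] /andP[s0 s16].
have w0 : 0 <= s * s by rewrite mulr_ge0 // ltW.
have sw : s * (s * s) <= 16^-1 * (s * s) by rewrite ler_wpM2r.
have ssw : s * (s * (s * s)) <= 16^-1 * (16^-1 * (s * s)).
  by apply: le_trans (ler_wpM2l (ltW s0) sw) _; rewrite mulrCA ler_wpM2l.
have sw0 : 0 <= s * (s * s) by rewrite mulr_ge0 // ltW.
have iw := ler_wpM2r w0 i4; have isw := ler_wpM2r sw0 i4.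
lra.
Qed.

(** At [q = |x|^2], the Newtonian potential plus a correction: [2 / |x|^2] has a positive Laplacian
    of order [|x|^-4], which beats the discretisation error of [1 / |x|], of order [|x|^-5]. *)
Definition shell q : R := isq q + 2 / q.

Section three_coordinates.
Variables (a b c q : R).
Hypothesis qE : q = a ^+ 2 + b ^+ 2 + c ^+ 2.

Let ratio_bound t a' : 16 <= t -> a' ^+ 2 <= t -> 
  (- (3 / 5) <= (1 + 2 * a') / t <= 3 / 5) /\ (- (3 / 5) <= (1 - 2 * a') / t <= 3 / 5).
Proof.
move=> t16 at_; have t0 : 0 < t by lra.
have [h1 h2] : 4 * a' <= t /\ - t <= 4 * a' by split; nra.
by rewrite !ler_pdivrMr // !ler_pdivlMr //; split; apply/andP; split; lra.
Qed.

Lemma shell_subharmonic : 16 <= q ->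
  6 * shell q <= shell (q + 1 + 2 * a) + shell (q + 1 - 2 * a) +
    (shell (q + 1 + 2 * b) + shell (q + 1 - 2 * b)) + (shell (q + 1 + 2 * c) + shell (q + 1 - 2 * c)).
Proof.
move=> q16; have q0 : 0 < q by lra.
have a2 := sqr_ge0 a; have b2 := sqr_ge0 b; have c2 := sqr_ge0 c.
pose T u := isq q * cubic u + 2 * (q^-1 * (1 - u + u ^+ 2 - u ^+ 3)).
have low v : - (3 / 5) <= v / q <= 3 / 5 -> T (v / q) <= shell (q + v).
  move=> vb; apply: lerD; first exact: isq_cubic_ge.
  rewrite ler_wpM2l //; apply: inv_cubic_ge => //.
  by case/andP: vb; rewrite ler_pdivlMr // => h _; lra.
have pair a' : a' ^+ 2 <= q -> T ((1 + 2 * a') / q) + T ((1 - 2 * a') / q) <=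
    shell (q + 1 + 2 * a') + shell (q + 1 - 2 * a').
  move=> h; have [h1 h2] := ratio_bound q16 h.
  have -> : q + 1 + 2 * a' = q + (1 + 2 * a') by ring.
  have -> : q + 1 - 2 * a' = q + (1 - 2 * a') by ring.
  by apply: lerD; exact: low.
have [aq bq cq] : [/\ a ^+ 2 <= q, b ^+ 2 <= q & c ^+ 2 <= q] by rewrite qE; split; lra.
apply: le_trans (lerD (lerD (pair a aq) (pair b bq)) (pair c cq)).
pose s := q^-1.
have s16 : 0 < s <= 16^-1 by rewrite /s invr_gt0 q0 lef_pV2 ?posrE.
have qs : q * s = 1 by rewrite /s divff // gt_eqF.
have -> : T ((1 + 2 * a) / q) + T ((1 - 2 * a) / q) + (T ((1 + 2 * b) / q) + T ((1 - 2 * b) / q)) +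
  (T ((1 + 2 * c) / q) + T ((1 - 2 * c) / q)) =
  isq q * (6 - 3 * s + 3 / 4 * (3 * s ^+ 2 + 4 * (a ^+ 2 + b ^+ 2 + c ^+ 2) * s * s)
     - 5 / 8 * (3 * s ^+ 3 + 12 * (a ^+ 2 + b ^+ 2 + c ^+ 2) * s * s ^+ 2)) +
  2 * s * (6 - 6 * s + (6 * s ^+ 2 + 8 * (a ^+ 2 + b ^+ 2 + c ^+ 2) * s * s) -
     (6 * s ^+ 3 + 24 * (a ^+ 2 + b ^+ 2 + c ^+ 2) * s * s ^+ 2)).
  by rewrite /T /cubic -/s; field.
rewrite -qE -!mulrA !(mulrA q s) qs !mul1r /shell -/s.
have i4 : 0 <= isq q <= 1 / 4.
  rewrite isq_ge0 /=; apply: le_trans (isq_mono _ q16) _ => //.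
  by have := @isq_natX2 4 isT; rewrite -natrX => ->; lra.
rewrite (_ : s ^+ 3 = s * (s * s)) // (_ : s ^+ 2 = s * s) //.
exact: shell_inequality.
Qed.

(** The shift by 16 softens the pole: the continuum Laplacian of [(|x|^2 + 16)^(-1/2)] is
    [- 48 (|x|^2 + 16)^(-5/2)], enough to beat the quartic Taylor remainder at every site. *)
Lemma isq_superharmonic : 
  isq (q + 16 + 1 + 2 * a) + isq (q + 16 + 1 - 2 * a) + (isq (q + 16 + 1 + 2 * b) + isq (q + 16 + 1 - 2 * b)) +
    (isq (q + 16 + 1 + 2 * c) + isq (q + 16 + 1 - 2 * c)) <= 6 * isq (q + 16).
Proof.
have a2 := sqr_ge0 a; have b2 := sqr_ge0 b; have c2 := sqr_ge0 c.
set t := q + 16; have t16 : 16 <= t by rewrite /t qE; lra.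
have t0 : 0 < t by lra.
pose T u := isq t * (cubic u + u ^+ 4).
have pair a' : a' ^+ 2 <= t -> isq (t + 1 + 2 * a') + isq (t + 1 - 2 * a') <=
    T ((1 + 2 * a') / t) + T ((1 - 2 * a') / t).
  move=> h; have [h1 h2] := ratio_bound t16 h.
  have -> : t + 1 + 2 * a' = t + (1 + 2 * a') by ring.
  have -> : t + 1 - 2 * a' = t + (1 - 2 * a') by ring.
  by apply: lerD; exact: isq_quartic_le.
have [aq bq cq] : [/\ a ^+ 2 <= t, b ^+ 2 <= t & c ^+ 2 <= t] by rewrite /t qE; split; lra.
apply: le_trans (lerD (lerD (pair a aq) (pair b bq)) (pair c cq)) _.
pose s := t^-1.
have s16 : 0 < s <= 16^-1 by rewrite /s invr_gt0 t0 lef_pV2 ?posrE.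
have ts : t * s = 1 by rewrite /s divff // gt_eqF.
have qs : q * s = t * s - 16 * s by rewrite /t mulrDl addrK.
rewrite ts in qs.
pose F := a ^+ 2 * a ^+ 2 + b ^+ 2 * b ^+ 2 + c ^+ 2 * c ^+ 2.
have -> : T ((1 + 2 * a) / t) + T ((1 - 2 * a) / t) + (T ((1 + 2 * b) / t) + T ((1 - 2 * b) / t)) +
  (T ((1 + 2 * c) / t) + T ((1 - 2 * c) / t)) =
  isq t * (6 - 3 * s + 3 / 4 * (3 * s ^+ 2 + 4 * ((a ^+ 2 + b ^+ 2 + c ^+ 2) * s) * s)
     - 5 / 8 * (3 * s ^+ 3 + 12 * ((a ^+ 2 + b ^+ 2 + c ^+ 2) * s) * s ^+ 2) +
     (6 * s ^+ 4 + 48 * ((a ^+ 2 + b ^+ 2 + c ^+ 2) * s) * s ^+ 3 + 32 * (F * s ^+ 2) * s ^+ 2)).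
  by rewrite /T /cubic /F -/s; field.
have Fq : F * s ^+ 2 <= (1 - 16 * s) ^+ 2.
  rewrite -qs exprMn ler_wpM2r ?sqr_ge0 // qE /F.
  by move: (a ^+ 2) (b ^+ 2) (c ^+ 2) a2 b2 c2 => x y z x0 y0 z0; nra.
rewrite -qE qs [X in _ <= X]mulrC ler_wpM2l ?isq_ge0 //.
have s2 : 0 <= s ^+ 2 by exact: sqr_ge0.
apply: (@le_trans _ _ (6 - 3 * s + 3 / 4 * (3 * s ^+ 2 + 4 * (1 - 16 * s) * s)
     - 5 / 8 * (3 * s ^+ 3 + 12 * (1 - 16 * s) * s ^+ 2) +
     (6 * s ^+ 4 + 48 * (1 - 16 * s) * s ^+ 3 + 32 * (1 - 16 * s) ^+ 2 * s ^+ 2))).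
  by rewrite !lerD2l ler_wpM2r // ler_wpM2l.
have -> : 6 - 3 * s + 3 / 4 * (3 * s ^+ 2 + 4 * (1 - 16 * s) * s)
     - 5 / 8 * (3 * s ^+ 3 + 12 * (1 - 16 * s) * s ^+ 2) +
     (6 * s ^+ 4 + 48 * (1 - 16 * s) * s ^+ 3 + 32 * (1 - 16 * s) ^+ 2 * s ^+ 2) =
  6 - s ^+ 2 * (85 / 4 + s * (15 / 8 - 120 - 48 + 32 * 32) - s ^+ 2 * (6 - 48 * 16 + 32 * 16 * 16)) by field.
rewrite gerBl mulr_ge0 // subr_ge0.
case/andP: s16 => s0 s16.
have ss : s ^+ 2 <= s / 16 by rewrite expr2; nra.
by move: (s ^+ 2) s2 ss => w w0 ws; lra.
Qed.

End three_coordinates.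
End inverse_sqrt.

(** * Newtonian potentials in three dimensions *)

Section space.
Variable R : realType.
Local Notation Z3 := 'rV[int]_3.
Implicit Types (x p b : Z3).

Lemma nbr_sum_radial d (G : R -> R) (p x : 'rV[int]_d) :
  nbr_sum (fun y => G (sq R (y - p))) x =
  \sum_(i < d) (G (sq R (x - p) + 1 + 2 * ((x - p) 0 i)%:~R) + G (sq R (x - p) + 1 - 2 * ((x - p) 0 i)%:~R)).
Proof.
apply: eq_bigr => i _; have [h1 h2] := sqE (x - p) i (0 : R); rewrite !addr0 in h1; rewrite !addr0 in h2.
have -> : x + unit_vec i - p = x - p + unit_vec i by rewrite addrAC.
have -> : x - unit_vec i - p = x - p - unit_vec i by rewrite addrAC.
by rewrite h1 h2.
Qed.

Let i0 : 'I_3 := ord0.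
Let i1 : 'I_3 := lift ord0 ord0.
Let i2 : 'I_3 := lift ord0 (lift ord0 ord0).

Lemma sq3E x : sq R x = ((x 0 i0)%:~R) ^+ 2 + ((x 0 i1)%:~R) ^+ 2 + ((x 0 i2)%:~R) ^+ 2.
Proof. by rewrite /sq !big_ord_recl big_ord0 addr0 addrA. Qed.

Lemma shell_nbr_sum p x : 16 <= sq R (x - p) ->
  6 * shell (sq R (x - p)) <= nbr_sum (fun y => shell (sq R (y - p))) x.
Proof.
move=> h; rewrite (nbr_sum_radial (@shell R)) !big_ord_recl big_ord0 addr0 addrA.
exact: (shell_subharmonic (sq3E _)).
Qed.

(** The factor 24 gives a charge of at least one at the pole: [6 * 24 * (1/4 - 17/70) >= 1], where
    [17/70] bounds [isq 17]. *)
Definition space_green b x : R := 24 * isq (sq R (x - b) + 16).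

Lemma space_green_ge0 b x : 0 <= space_green b x.
Proof. by rewrite mulr_ge0 ?isq_ge0. Qed.

Lemma space_green_super b x :
  (x == b)%:R <= ((2 * 3)%:R + 0) * space_green b x - nbr_sum (space_green b) x.
Proof.
have c6 : (2 * 3)%:R = 6 :> R by [].
rewrite (nbr_sum_radial (fun q => 24 * isq (q + 16))) !big_ord_recl big_ord0 !addr0 c6 -!mulrDr /space_green mulrCA -mulrBr.
set q := sq R (x - b).
have [xb|xb] := eqVneq x b; last first.
  rewrite mulr_ge0 // subr_ge0 addrA.
  have e (z : R) : q + 1 + z + 16 = q + 16 + 1 + z by ring.
  by rewrite !e; exact: (isq_superharmonic (sq3E _)).
rewrite /q xb subrr (_ : sq R 0 = 0); last by apply/eqP; rewrite sq_eq0.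
rewrite !mxE !mulr0 !subr0 !addr0 !add0r.
have -> : isq (16 : R) = 1 / 4 by have := @isq_natX2 R 4 isT; rewrite -natrX => ->; lra.
have h : isq (1 + 16 : R) <= 17 / 70.
  have h : 70 / 17 <= Num.sqrt (1 + 16 : R).
    apply: ler_of_sqr; first exact: sqrtr_ge0.
    by rewrite sqr_sqrtr; lra.
  rewrite /isq -[X in _ <= X]invf_div lef_pV2 ?posrE ?divr_gt0 //.
by rewrite (_ : true%:R = 1) //; lra.
Qed.
End space.

Lemma sq_nat (R : realType) d (x : 'rV[int]_d) : exists n : nat, sq R x = n%:R.
Proof.
exists (\sum_(i < d) absz (x 0%R i) ^ 2)%N; rewrite natr_sum; apply: eq_bigr => i _.
by rewrite intr_sqr natrX.
Qed.

(** * An obstacle across a ball in three dimensions *)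

Section space_step.
Variables (R : realType) (L : {fset 'rV[int]_3}) (A : {set L}).
Local Notation c := ((2 * 3)%:R : R).
Local Notation om := (tree_weight (@site_adj 3 L) c 0).
Variable U : option L -> R.
Hypotheses (hU : harmonic om A U) (tA : forall D, transient om D) (U1 : forall v, U v <= 1).
Variables (z : 'rV[int]_3) (a : nat -> 'rV[int]_3) (r : nat) (E : R).
Local Notation far y := (nrm (val (y : L) - z)%R).
Hypotheses (r8 : (8 <= r)%N) (E0 : 0 <= E)
  (az : forall j, (j < r)%N -> nrm (a j - z) = j)
  (Lz : forall x, (nrm (x - z)%R <= 8 * r)%N -> x \in L)
  (UE : forall y : L, (far y <= 8 * r)%N -> U (Some y) <= E)
  (UA : forall y : L, y \notin A -> (far y <= 8 * r)%N -> U (Some y) <= 0)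
  (aA : forall j (y : L), (j < r)%N -> val y = a j -> y \notin A).

Let om_ge0 y v : 0 <= om y v. Proof. by apply: tree_weight_ge0 (lexx 0) _ _; exact: site_deg_le. Qed.
Let r_gt0 : 0 < r%:R :> R. Proof. by rewrite ltr0n; apply: leq_trans r8. Qed.
Let c6 : c = 6. Proof. by []. Qed.

Let interior (y : L) : (far y < 8 * r)%N -> forall x, nearest_neighbours x (val y) -> x \in L.
Proof. by move=> yr x /(nrm_nn z) h; apply: Lz; apply: leq_trans h _. Qed.

Lemma site_average (V : option L -> R) (y : L) : (far y < 8 * r)%N ->
  \sum_v om y v * V v = \sum_x edge R (@site_adj 3 L) y x * V (Some x).
Proof. by move=> yr; rewrite sum_full killing_interior ?mul0r ?add0r //; exact: interior. Qed.

Lemma closer_neighbour (x : 'rV[int]_3) : x != 0 -> exists2 e, (forall y, nearest_neighbours (y + e) y) & sq R (x + e) <= sq R x - 1.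
Proof.
move=> x0; have [i xi] : exists i, x 0 i != 0.
  apply/existsP; apply: contraR x0 => /existsPn h; apply/eqP/rowP => i; rewrite mxE.
  by have /negPn/eqP := h i.
have [h1 h2] := sqE x i (0 : R); rewrite !addr0 in h1; rewrite !addr0 in h2.
have [xp|xn] := lerP (x 0 i) 0.
  exists (unit_vec i); first by move=> y; apply/nnP; exists i; left.
  have : (x 0 i)%:~R <= (-1)%:~R :> R by rewrite ler_int; move: xi xp; move: (x 0 i) => m; lia.
  by rewrite rmorphN rmorph1 h1; lra.
exists (- unit_vec i); first by move=> y; apply/nnP; exists i; right.
have : 1%:~R <= (x 0 i)%:~R :> R by rewrite ler_int; move: xi xn; move: (x 0 i) => m; lia.
by rewrite rmorph1 h2; lra.
Qed.

(** [shell_subharmonic] starts at squared distance 16. Closer to [a j], a step that lowers the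
    squared distance by at least one has probability 1/6, so the obstacle is met within [n] steps
    with probability at least [6^-n]. *)
Lemma escape_near j n (y : L) : (j < r)%N -> (n < 16)%N -> sq R (val y - a j) <= n%:R ->
  U (Some y) <= (1 - (6 ^+ n)^-1) * E.
Proof.
move=> jr; elim: n y => [|n IH] y n16 yn.
  have /eqP : sq R (val y - a j) = 0 by apply/eqP; rewrite eq_le yn sq_ge0.
  rewrite sq_eq0 subr_eq0 => /eqP ya; rewrite expr0 invr1 subrr mul0r; apply: UA.
    exact: aA ya.
  by rewrite ya az //; clear -jr; lia.
have near (w : L) : sq R (val w - a j) <= n.+1%:R -> (far w <= r + 3)%N.
  move=> wn; have w3 : (nrm (val w - a j)%R <= 3)%N.
    rewrite leqNgt; apply/negP => /(@sq_ge _ R) h.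
    have : 4%:R ^+ 2 <= n.+1%:R :> R by exact: le_trans h wn.
    by rewrite -natrX ler_nat; clear -n16; lia.
  by apply: leq_trans (nrm_tri _ (a j) _) _; rewrite az // addnC leq_add // ltnW.
have yfar := near y yn.
have p0 : 0 < (6 ^+ n.+1)^-1 :> R by rewrite invr_gt0 exprn_gt0.
have p1 : (6 ^+ n.+1)^-1 <= 1 :> R by rewrite invf_le1 ?exprn_gt0 // exprn_ege1 //; lra.
have [yA|yA] := boolP (y \in A); last first.
  apply: le_trans (UA yA _) _; first by clear -yfar r8; lia.
  by rewrite mulr_ge0 // subr_ge0.
have ya : val y - a j != 0.
  by rewrite subr_eq0; apply/negP => /eqP e; have := aA jr e; rewrite yA.
have [e nne sqe] := closer_neighbour ya.
have nn := nne (val y).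
have yr8 : (far y < 8 * r)%N by clear -yfar r8; lia.
have wL := interior yr8 nn.
pose w : L := [` wL]%fset.
have wE : val w - a j = val y - a j + e by rewrite /= addrAC.
have Uw : U (Some w) <= (1 - (6 ^+ n)^-1) * E.
  by apply: IH; [exact: ltnW|rewrite wE; apply: le_trans sqe _; rewrite -(natr1 n) in yn; lra].
have avg := hU yA; rewrite tree_weight_total addr0 c6 site_average // in avg.
have : \sum_x edge R (@site_adj 3 L) y x * U (Some x) <= 6 * E - (6 ^+ n)^-1 * E.
  apply: le_trans (_ : \sum_x (edge R (@site_adj 3 L) y x * E - (x == w)%:R * ((6 ^+ n)^-1 * E)) <= _).
    apply: ler_sum => x _; have [->|xw] := eqVneq x w.
      by rewrite /edge /site_adj /= nn !mul1r; move: Uw; rewrite mulrBl mul1r.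
    rewrite mul0r subr0 /edge; have [yx|] := boolP (site_adj y x); last by rewrite !mul0r.
    rewrite !mul1r; apply: UE; apply: leq_trans (nrm_nn z _) _; first exact: yx.
    by clear -yfar r8; lia.
  have sw k : \sum_(x : L) (x == w)%:R * k = k :> R.
    by rewrite (bigD1 w) //= eqxx mul1r big1 ?addr0 // => x /negbTE ->; rewrite mul0r.
  rewrite sumrB sw.
  rewrite lerD2r -mulr_suml; apply: ler_wpM2r => //.
  by have := site_deg_le R y; rewrite (eq_bigl predT) // => x; rewrite inE.
rewrite avg exprS invfM; move: (6 ^- n) => q; lra.
Qed.

(** Per site and in units of [1 / r], the potential is at most [1/7 + 2/(49 * 8)] in the far region
    and at least [1/4] in the near one. The offset [3/20] lies between, and leaves [1/10] in the
    near region. *)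
Definition shell_barrier x : R := \sum_(j < r) (shell (sq R (x - a j)) - 3 / 20 / r%:R).

(** Unlike in the plane, the bound on the maximum exceeds the near value by a factor of order
    [ln r], coming from two harmonic sums; the gain per step is of order [1 / ln r]. *)
Definition shell_max : R := 3 + 6 * (1 + ln r%:R).

Let shell_le_inv n (q : R) : (0 < n)%N -> n%:R ^+ 2 <= q -> shell q <= n%:R^-1 + 2 / n%:R ^+ 2.
Proof.
move=> n0 nq; have p : 0 < n%:R ^+ 2 :> R by rewrite exprn_gt0 // ltr0n.
apply: lerD; first by rewrite -isq_natX2 //; exact: isq_mono.
by rewrite ler_wpM2l // lef_pV2 ?posrE // (lt_le_trans p).
Qed.

Lemma shell_barrier_far x : (8 * r <= nrm (x - z)%R)%N -> shell_barrier x <= 0.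
Proof.
move=> xz; apply: sumr_le0 => j _; rewrite subr_le0; have jr := ltn_ord j.
have nx : (7 * r <= nrm (x - a j)%R)%N.
  have := nrm_tri x (a j) z; rewrite az //; move: (nrm _) (nrm _) xz => u v; clear -jr; lia.
apply: le_trans (shell_le_inv _ (sq_ge R nx)) _; first by clear -r8; lia.
rewrite natrM; set rr : R := r%:R; have rr8 : 8 <= rr by rewrite /rr (ler_nat R 8 r).
have rr0 : 0 < rr := r_gt0.
have -> : (7 * rr)^-1 + 2 / (7 * rr) ^+ 2 = (1 / 7 + 2 / 49 * rr^-1) / rr by field; exact: lt0r_neq0.
rewrite ler_wpM2r ?invr_ge0 ?(ltW rr0) //.
have : rr^-1 <= 8^-1 by rewrite lef_pV2 ?posrE.
lra.
Qed.

Lemma shell_barrier_near x : (nrm (x - z)%R <= r)%N -> (forall j, (j < r)%N -> x != a j) ->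
  1 / 10 <= shell_barrier x.
Proof.
move=> xz xa; have -> : 1 / 10 = \sum_(j < r) (1 / 10 / r%:R) :> R.
  by rewrite sumr_const card_ord -[RHS]mulr_natl [RHS]mulrC divfK // lt0r_neq0.
apply: ler_sum => j _; have jr := ltn_ord j.
have nx : (nrm (x - a j)%R <= 2 * r)%N.
  have := nrm_tri x z (a j); rewrite (nrm_sym z) az //; move: (nrm _) (nrm _) xz => u v; clear -jr; lia.
have q1 : 1 <= sq R (x - a j) by apply: sq_ge1; rewrite subr_eq0 xa.
have q16 : sq R (x - a j) <= (4 * r)%:R ^+ 2.
  apply: le_trans (sq_le R nx) _; rewrite !natrM !exprMn.
  by have := exprn_ge0 2 (ltW r_gt0); move: (_ ^+ 2) => w; lra.
have h : (4 * r)%:R^-1 <= shell (sq R (x - a j)).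
  rewrite -isq_natX2 //; last by clear -r8; lia.
  apply: le_trans (isq_mono _ q16) _; first by lra.
  by rewrite lerDl divr_ge0 // sq_ge0.
rewrite lerBrDr; apply: le_trans h; rewrite natrM invfM -mulrDl.
by rewrite ler_wpM2r ?invr_ge0 //; lra.
Qed.

Lemma shell_barrier_max x : shell_barrier x <= shell_max.
Proof.
pose t := minn (nrm (x - z)) r.-1.
have tr : (t < r)%N by rewrite /t; clear -r8; lia.
have low (j : 'I_r) : shell (sq R (x - a j)) - 3 / 20 / r%:R <= 3 * (gap t j)%:R^-1 + 3 *+ (j == t :> nat).
  have jr := ltn_ord j.
  have k0 : 0 <= 3 / 20 / r%:R :> R by rewrite divr_ge0 // divr_ge0.
  rewrite lerBlDr; apply: ler_wpDr => //.
  have nx : (gap t j <= nrm (x - a j)%R)%N.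
    have h1 := nrm_tri x (a j) z; have h2 := nrm_tri z x (a j).
    move: h1 h2; rewrite (nrm_sym z x) (nrm_sym z (a j)) az // /t /gap.
    by move: (nrm _) (nrm _) => u v; clear -r8 jr; lia.
  have [jt|jt] := eqVneq (j : nat) t.
    apply: ler_wpDl; first by rewrite mulr_ge0 ?invr_ge0.
    rewrite mulr1n; have [->|x0] := eqVneq (x - a j) 0.
      have -> : sq R (0 : 'rV[int]_3) = 0 by apply/eqP; rewrite sq_eq0.
      by rewrite /shell /isq sqrtr0 invr0 mulr0 addr0.
    have := @shell_le_inv 1 (sq R (x - a j)) isT; rewrite expr1n => /(_ (sq_ge1 R x0)).
    by rewrite divr1 invr1; lra.
  rewrite mulr0n addr0; have g1 : (0 < gap t j)%N by rewrite /gap; clear -jt; lia.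
  apply: le_trans (shell_le_inv g1 (sq_ge R nx)) _.
  have G1 : 1 <= (gap t j)%:R :> R by rewrite ler1n.
  have g0 : 0 < (gap t j)%:R :> R by exact: lt_le_trans G1.
  have w0 : 0 < (gap t j)%:R^-1 :> R by rewrite invr_gt0.
  have w1 : (gap t j)%:R^-1 <= 1 :> R by rewrite invf_le1.
  rewrite -exprVn; move: (_^-1) w0 w1 => w w0 w1; nra.
apply: le_trans (ler_sum (index_enum 'I_r) (fun j _ => low j)) _.
rewrite big_split /= (bigD1 (Ordinal tr)) //= [X in _ + X](bigD1 (Ordinal tr)) //= eqxx mulr1n.
rewrite [X in _ + (3 + X)]big1 ?addr0 => [|j jt]; last first.
  by rewrite (_ : (_ == _) = false) // ; apply: contraNF jt => /eqP e; apply/eqP/val_inj.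
rewrite -(bigD1 (Ordinal tr) (P := predT) (F := fun j : 'I_r => 3 * (gap t j)%:R^-1)) //= -mulr_sumr.
have er : (t.+1 + (r.-1 - t))%N = r by clear -tr; move: (t) tr => u; lia.
have := @gap_sum R (fun n => n%:R^-1) t (r.-1 - t) (invr0 _); rewrite er => ->.
have h1 : \sum_(i < t) (i.+1%:R)^-1 <= 1 + ln r%:R :> R by apply: harmonic_le; clear -tr; move: (t) tr => u; lia.
have h2 : \sum_(i < r.-1 - t) (i.+1%:R)^-1 <= 1 + ln r%:R :> R by apply: harmonic_le; clear -tr; move: (t) tr => u; lia.
rewrite /shell_max; lra.
Qed.

Lemma space_step (y : L) : (far y <= r)%N ->
  U (Some y) <= E * (1 - (10 * 6 ^+ 15 * shell_max)^-1).
Proof.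
move=> yr.
have lr : 0 <= ln r%:R :> R by apply: ln_ge0; rewrite ler1n; apply: leq_trans r8.
have H0 : 0 < shell_max by rewrite /shell_max; lra.
have P0 : 0 < 6 ^+ 15 :> R by rewrite exprn_gt0.
have P1 : 1 <= 6 ^+ 15 :> R by rewrite exprn_ege1 //; lra.
(* With this factor the normalised barrier is at most [6^-15], the gain that [escape_near] provides
   at squared distances up to 15. *)
pose K : R := 6 ^+ 15 * shell_max.
have K0 : 0 < K by rewrite mulr_gt0.
have HK : shell_max <= K by rewrite ler_peMl // ltW.
pose W x := E * (1 - shell_barrier x / K).
pose V v := if v is Some x then (if (far x <= 8 * r)%N then W (val x) else 1) else 1.
pose D := [set x in A | (far x < 8 * r)%N && [forall j : 'I_r, 16 <= sq R (val x - a j)]]%SET.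
have W0 x : 0 <= W x.
  rewrite mulr_ge0 // subr_ge0 ler_pdivrMr // mul1r.
  exact: le_trans (shell_barrier_max x) HK.
have VW x : (far x <= 8 * r)%N -> V (Some x) = W (val x) by move=> /= ->.
have hUD : harmonic om D U by move=> x; rewrite inE => /andP[xA _]; exact: hU.
have sV : superharmonic om D V.
  move=> x; rewrite inE => /andP[xA /andP[xr /forallP xq]].
  have nx p : nearest_neighbours p (val x) -> (nrm (p - z)%R <= 8 * r)%N.
    by move=> h; apply: leq_trans (nrm_nn _ h) _.
  rewrite tree_weight_total addr0 c6 site_average // VW ?(ltnW xr) //.
  have -> : \sum_p edge R (site_adj (L:=L)) x p * V (Some p) = nbr_sum W (val x).
    rewrite -(sum_edge_interior _ (interior xr)); apply: eq_bigr => p _; rewrite /edge.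
    have [h|] := boolP (site_adj x p); last by rewrite !mul0r.
    by rewrite VW //; exact: nx.
  have -> : nbr_sum W (val x) = 6 * E - E / K * nbr_sum shell_barrier (val x).
    by rewrite /nbr_sum /W !big_ord_recl !big_ord0; field; exact: lt0r_neq0.
  have sub : 6 * shell_barrier (val x) <= nbr_sum shell_barrier (val x).
    rewrite /nbr_sum /shell_barrier.
    rewrite [X in _ <= X](eq_bigr (fun i => \sum_(j < r) ((shell (sq R (val x + unit_vec i - a j)) - 3 / 20 / r%:R) +
       (shell (sq R (val x - unit_vec i - a j)) - 3 / 20 / r%:R)))) => [|i _]; last by rewrite [RHS]big_split.
    rewrite exchange_big mulr_sumr; apply: ler_sum => j _ /=.
    have := shell_nbr_sum (xq j); rewrite /nbr_sum !big_ord_recl !big_ord0.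
    move: (3 / 20 / _) => k; lra.
  have EK : 0 <= E / K by rewrite divr_ge0 // ltW.
  have h1 := ler_wpM2l EK sub.
  have -> : W (val x) = E - E / K * shell_barrier (val x) by rewrite /W; field; exact: lt0r_neq0.
  lra.
have h8 : forall v, ~~ inside D v -> U v <= V v.
  case=> [x|_]; last exact: U1.
  rewrite /inside inE !negb_and -leqNgt.
  have [xr|xr] := leqP (far x) (8 * r); last by move=> _; rewrite /V leqNgt xr; exact: U1.
  rewrite VW // => /or3P[xA|xr'|].
  - exact: le_trans (UA xA xr) (W0 _).
  - apply: le_trans (UE xr) _; rewrite /W mulrBr mulr1 lerDl oppr_ge0.
    rewrite mulr_ge0_le0 // pmulr_lle0 ?invr_gt0 //; exact: shell_barrier_far.
  - rewrite negb_forall => /existsP[j]; rewrite -ltNge => q16.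
    have [n qn] := sq_nat R (val x - a j).
    have n15 : (n <= 15)%N by move: q16; rewrite qn ltr_nat ltnS.
    have q15 : sq R (val x - a j) <= 15%:R by rewrite qn ler_nat.
    apply: le_trans (escape_near (ltn_ord j) (n := 15) isT q15) _.
    rewrite mulrC ler_wpM2l // lerD2l lerN2 ler_pdivrMr // /K mulrA mulVf ?lt0r_neq0 // mul1r.
    exact: shell_barrier_max.
have e0 : 0 <= 1 - (10 * 6 ^+ 15 * shell_max)^-1.
  rewrite subr_ge0 invf_le1; last by rewrite !mulr_gt0.
  have S1 : 1 <= shell_max by rewrite /shell_max; lra.
  by rewrite -[X in X <= _]mulr1 ler_pM // mulr_ege1 //; lra.
have y8 : (far y <= 8 * r)%N by apply: leq_trans yr _; rewrite leq_pmull.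
have [yA|yA] := boolP (y \in A); last first.
  by apply: le_trans (UA yA y8) _; rewrite mulr_ge0.
apply: le_trans (comparison om_ge0 (tA D) sV hUD h8 (Some y)) _.
have -> : (10 * 6 ^+ 15 * shell_max)^-1 = 1 / 10 / K by rewrite /K -mulrA invfM mul1r.
rewrite VW // ler_wpM2l // lerD2l lerN2 ler_wpM2r ?invr_ge0 ?(ltW K0) //.
apply: shell_barrier_near => // j jr.
by apply/negP => /eqP e; have := aA jr e; rewrite yA.
Qed.
End space_step.

Lemma ler_tree_sum_support (T : finType) (R : realFieldType) (omega : T -> option T -> R) (A : {set T}) F G :
  (forall y v, 0 <= omega y v) ->
  (forall f, acyclic A f -> weight omega A f != 0 -> F f <= G f) ->
  tree_sum omega A F <= tree_sum omega A G.
Proof.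
move=> o0 FG; apply: ler_sum => f /andP[_ ac].
have [->|w0] := eqVneq (weight omega A f) 0; first by rewrite !mul0r.
by rewrite ler_wpM2l ?weight_ge0 // FG.
Qed.

Lemma cube_transient (R : realType) d N (D : {set cube d N}) : (0 < d)%N ->
  transient (tree_weight (@site_adj d (cube d N)) ((2 * d)%:R : R) 0) D.
Proof.
move=> d0; exists (lift_fun (paraboloid R N)); split => [[y|]//=|y _]; first exact: paraboloid_ge0.
rewrite -subr_gt0; apply: (@lt_le_trans _ _ 1) => //.
apply: (@lift_superharmonic d R _ 0) => // [x|]; first exact: paraboloid_ge0.
have yN : (nrm (val y) <= N)%N by rewrite -in_cube; exact: valP.
by rewrite paraboloid_super // ler1n muln_gt0 d0.
Qed.

Section space_potential.
Variables (R : realType) (L : {fset 'rV[int]_3}).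
Local Notation adj := (@site_adj 3 L).
Local Notation c := ((2 * 3)%:R : R).
Variable kap : L -> R.
Hypothesis kap_ge : forall y, killing adj c 0 y <= kap y.
Local Notation om := (free_weight (edge R adj) [set: L]%SET kap).

Let om_ge0 y v : 0 <= om y v.
Proof.
apply: free_weight_ge0 => [*|x]; first exact: edge_ge0.
by apply: le_trans (kap_ge x); apply: killing_ge; exact: site_deg_le.
Qed.

Let V (b : L) : option L -> R := lift_fun (space_green R (val b)).
Let V_ge0 b v : 0 <= V b v. Proof. by case: v => //= y; exact: space_green_ge0. Qed.

Let V_super (b y : L) : (y == b)%:R <= (\sum_v om y v) * V b (Some y) - \sum_v om y v * V b v.
Proof.
apply: (@lift_superharmonic 3 R L 0) => // [x|]; first exact: space_green_ge0.
by have := @space_green_super R (val b) (val y); rewrite (inj_eq val_inj).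
Qed.

Lemma space_potential_le (A : {set L}) (b : L) v : b \in A ->
  treeY om (A :\ b) v (pred1 (Some b)) <= treeZ om A * lift_fun (space_green R (val b)) v.
Proof.
move=> bA; apply: (green_le om_ge0 _ bA (V_ge0 b)) => [y _|].
  by rewrite -subr_ge0; apply: le_trans (V_super b y).
by have := V_super b b; rewrite eqxx.
Qed.

Lemma space_diag_le (A : {set L}) (b : L) : b \in A -> treeZ om (A :\ b) <= 6 * treeZ om A.
Proof.
move=> bA; apply: le_trans (green_diag_le om_ge0 bA (V_ge0 b) _ _) _ => [y _||].
- by rewrite -subr_ge0; apply: le_trans (V_super b y).
- by have := V_super b b; rewrite eqxx.
rewrite mulrC ler_wpM2r ?treeZ_ge0 // /V /= /space_green subrr.
have -> : sq R (0 : 'rV[int]_3) = 0 by apply/eqP; rewrite sq_eq0.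
by rewrite add0r; have := @isq_natX2 R 4 isT; rewrite -natrX => ->; lra.
Qed.
End space_potential.

(** * A net of obstacles around the box *)

Section space_volume.
Variables (R : realType) (N k m r : nat).
Local Notation n := (18 * m * r)%N.
Hypotheses (r8 : (8 <= r)%N) (m0 : (0 < m)%N) (kn : (8 * k <= n)%N) (nN : (4 * n <= N)%N).
Local Notation L := (cube 3 N).
Local Notation adj := (@site_adj 3 L).
Local Notation c := ((2 * 3)%:R : R).
Local Notation om := (tree_weight adj c 0).
Local Notation B := [set y : L | (nrm (val y) <= k)%N]%SET.

Let om_ge0 y v : 0 <= om y v. Proof. by apply: tree_weight_ge0 (lexx 0) _ _; exact: site_deg_le. Qed.
Let tA (D : {set L}) : transient om D. Proof. exact: cube_transient. Qed.
Let total (y : L) : \sum_v om y v = 6. Proof. by rewrite tree_weight_total addr0. Qed.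
Let mr0 : (8 <= m * r)%N. Proof. by apply: leq_trans r8 _; rewrite leq_pmull. Qed.
Let rmr : (r <= m * r)%N. Proof. by rewrite leq_pmull. Qed.
Let nE : n = (18 * (m * r))%N. Proof. by rewrite mulnA. Qed.

Definition net_point (f : {ffun 'I_3 -> 'I_(72 * m).+1}) : 'rV[int]_3 :=
  \row_i (((f i : nat)%:Z - (36 * m)%:Z) * r%:Z)%R.

(** A grid of mesh [r] in the cube of radius [36 m r = 2 n], without the points close to the box,
    which are too likely to be descendants. *)
Definition net : seq L :=
  [seq z <- pmap insub [seq net_point f | f <- enum {ffun 'I_3 -> 'I_(72 * m).+1}] | (n <= 4 * nrm (val z))%N].

Lemma size_net : (size net <= (72 * m).+1 ^ 3)%N.
Proof.
rewrite size_filter; apply: leq_trans (count_size _ _) _.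
rewrite size_pmap; apply: leq_trans (count_size _ _) _.
by rewrite size_map -cardE card_ffun !card_ord.
Qed.

Lemma net_far z : z \in net -> (n <= 4 * nrm (val z))%N.
Proof. by rewrite mem_filter => /andP[]. Qed.

Lemma net_near (y : 'rV[int]_3) : (9 * (m * r) <= nrm y)%N -> (nrm y <= 27 * (m * r))%N ->
  exists2 z, z \in net & (nrm (y - val z)%R <= r)%N.
Proof.
move=> y1 y2.
have rz : (0 < r%:Z)%R by move: r8; clear; case: (r).
have qb i : let q := (y 0%R i %/ r%:Z)%Z in ((- (36 * m)%:Z <= q) && (q <= (36 * m)%:Z))%R /\
    (absz (y 0%R i - q * r%:Z)%R <= r)%N.
  move=> q; have yi : (absz (y 0%R i) <= 27 * m * r)%N by rewrite -mulnA; apply: leq_trans (absz_nrm y i) y2.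
  have e := divz_eq (y 0%R i) r%:Z; have m1 := modz_ge0 (y 0%R i) (lt0r_neq0 rz).
  have m2 := ltz_pmod (y 0%R i) rz; rewrite -/q in e.
  move: (y 0%R i) (modz _ _) q e m1 m2 yi => v w q e m1 m2 yi; clear -e m1 m2 yi m0 rz.
  have h1 : (q * r%:Z <= (27 * m)%:Z * r%:Z)%R by rewrite -PoszM; clear -e m1 m2 yi; lia.
  have h2 : (- (27 * m)%:Z * r%:Z <= (q + 1) * r%:Z)%R.
    rewrite mulNr -PoszM mulrDl mul1r; clear -e m1 m2 yi; lia.
  rewrite ler_pM2r // in h1; rewrite ler_pM2r // in h2.
  by split; [clear -h1 h2 m0; lia|rewrite e addrC addKr; clear -m1 m2; lia].
pose f : {ffun 'I_3 -> 'I_(72 * m).+1} :=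
  [ffun i => inord (absz ((y 0%R i %/ r%:Z)%Z + (36 * m)%:Z)%R)].
have fE i : (net_point f) 0%R i = ((y 0%R i %/ r%:Z)%Z * r%:Z)%R.
  rewrite mxE ffunE inordK; last first.
    by have [h _] := qb i; move: h; move: (divz _ _) => q; clear; lia.
  congr (_ * _)%R; have [h _] := qb i; move: h; move: (divz _ _) => q; clear; lia.
have near : (nrm (y - net_point f)%R <= r)%N.
  rewrite nrm_le; apply/forallP => i; 
  have -> : (y - net_point f)%R 0%R i = (y 0%R i - (net_point f) 0%R i)%R by rewrite !mxE.
  rewrite fE.
  by have [_] := qb i.
have far : (nrm (net_point f) <= nrm y + r)%N.
  by have := nrm_tri (net_point f) y 0; rewrite !subr0 nrm_sym; move: near; clear; lia.
have far' : (nrm y <= nrm (net_point f) + r)%N.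
  by have := nrm_tri y (net_point f) 0; rewrite !subr0; move: near; clear; lia.
have zL : net_point f \in L.
  by rewrite in_cube; move: far y2 rmr nN; rewrite nE; move: (m * r)%N => u; clear; lia.
exists [` zL]%fset => //; rewrite mem_filter; apply/andP; split.
  by move: far' y1 rmr mr0; rewrite /= nE; move: (m * r)%N => u; clear; lia.
rewrite mem_pmap; apply/mapP; exists (net_point f); first by apply: map_f; rewrite mem_enum.
by rewrite insubT.
Qed.

Lemma card_box3 : (#|B| <= 27 * k ^ 3)%N || (k == 0)%N.
Proof.
have [->|k0] := posnP k; first by rewrite orbT.
rewrite orbF; apply: leq_trans (_ : (k + k).+1 ^ 3 <= _)%N.
  apply: leq_trans (card_near L 0 k); apply: subset_leq_card.
  by apply/fintype.subsetP => y; rewrite !inE subr0.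
have -> : (27 * k ^ 3 = (3 * k) ^ 3)%N by rewrite expnMn.
by rewrite leq_exp2r //; clear -k0; lia.
Qed.

(** A point of the net is at distance at least [n / 8] from every [b], as [8 k <= n], so its Green
    function is at most [24 * 8 / n]. *)
Lemma net_hit (z : L) : z \in net ->
  tree_sum om [set: L]%SET (fun f => (descendant B f z)%:R) <= #|B|%:R * (6 * 24 * 8 / n%:R) * treeZ om [set: L]%SET.
Proof.
move=> zn; have := hit_le om_ge0 (Some z) (finset.subsetT B).
have -> : [set: L]%SET :\: B = ~: B by apply/finset.setP => y; rewrite !inE andbT.
move=> /le_trans; apply.
rewrite -mulrA mulr_natl -sumr_const; apply: ler_sum => b; rewrite inE => bk.
rewrite total -!mulrA ler_wpM2l //.
have sp := @space_potential_le R L (killing adj c 0) (fun y => lexx _) [set: L]%SET b (Some z).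
apply: le_trans (sp _) _; first by rewrite inE.
rewrite [X in X <= _]mulrC /= /space_green.
have -> : 24 * (8 * (n%:R^-1 * treeZ om [set: L]%SET)) = 24 * (8 / n%:R) * treeZ om [set: L]%SET by ring.
apply: ler_wpM2r; first exact: treeZ_ge0.
rewrite ler_wpM2l //.
have n0 : (0 < n)%N by move: mr0; rewrite nE; clear; lia.
have n0R : 0 < n%:R / 8 :> R by rewrite divr_gt0 // ltr0n.
have -> : 8 / n%:R = isq ((n%:R / 8) ^+ 2) :> R by rewrite /isq sqrtr_sqr ger0_norm ?(ltW n0R) // invf_div.
apply: isq_mono; first by rewrite exprn_gt0.
have zb : (n <= 8 * nrm (val z - val b)%R)%N.
  have := nrm_tri (val z) (val b) 0; rewrite !subr0; have := net_far zn; move: bk kn.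
  by move: (nrm _) (nrm _) (nrm _) n => u v w n'; clear; lia.
apply: (@le_trans _ _ ((nrm (val z - val b)%R)%:R ^+ 2)); last first.
  by apply: le_trans (@sq_ge _ R _ _ (leqnn _)) _; rewrite lerDl.
rewrite lerXn2r ?nnegrE ?(ltW n0R) // ler_pdivrMr // mulrC -natrM ler_nat //.
Qed.

Definition escape_rate : R := (10 * 6 ^+ 15 * shell_max R r)^-1.

Let rate01 : 0 <= 1 - escape_rate <= 1.
Proof.
have lr : 0 <= ln r%:R :> R by apply: ln_ge0; rewrite ler1n; apply: leq_trans r8.
have S1 : 1 <= shell_max R r by rewrite /shell_max; lra.
have P0 : 0 < 6 ^+ 15 :> R by rewrite exprn_gt0.
have P1 : 1 <= 6 ^+ 15 :> R by rewrite exprn_ege1 //; lra.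
have K0 : 0 < 10 * 6 ^+ 15 * shell_max R r by rewrite !mulr_gt0 // (lt_le_trans ltr01).
rewrite subr_ge0 gerBl invr_ge0 (ltW K0) andbT invf_le1 //.
by rewrite -[X in X <= _]mulr1 ler_pM // mulr_ege1 //; lra.
Qed.

(** At zero dissipation the sink is adjacent only to the boundary of the cube, so a linked point has
    a chain crossing all spheres of radius less than [r] about it. *)
Lemma linked_levels (Q : {set L}) (z : L) : (nrm (val z) + r < N)%N -> linked om Q z ->
  exists a : nat -> 'rV[int]_3, (forall j, (j < r)%N -> nrm (a j - val z) = j) /\
    (forall j (y : L), (j < r)%N -> val y = a j -> y \in Q).
Proof.
move=> zN [y [zQ yQ oy czy]].
pose e (u v : L) := [&& u \in Q, v \in Q & 0 < om u (Some v)].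
have esym : symmetric e.
  move=> u v; rewrite /e /tree_weight /= !inE; case: (u \in Q); case: (v \in Q) => //=.
  by rewrite /edge site_adj_sym.
have cyz : connect e y z by rewrite (sym_connect_sym esym).
have yN : (r <= nrm (val y - val z)%R)%N.
  rewrite leqNgt; apply/negP => h; move: oy; rewrite /tree_weight /= killing_interior ?ltxx // => p /(nrm_nn (val z)) pz.
  have := nrm_tri p (val z) 0; rewrite !subr0 in_cube.
  by move: (nrm _) (nrm _) (nrm _) (nrm _) pz h zN => u1 u2 u3 u4; clear; lia.
have lip u v : e u v -> (nrm (val u - val z)%R <= (nrm (val v - val z)%R).+1)%N.
  rewrite /e /tree_weight /= inE /edge => /and3P[_ _ h]; apply: nrm_nn.
  have [uv|/negbTE uv] := boolP (site_adj u v); last by move: h; rewrite uv ltxx.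
  by move: uv; rewrite /site_adj nn_sym.
have H j : exists p : 'rV[int]_3, (j < r)%N -> nrm (p - val z) = j /\
    forall y : L, val y = p -> y \in Q.
  have [jr|jr] := ltnP j r; last by exists 0.
  have lv : (nrm (val z - val z)%R <= j <= nrm (val y - val z)%R)%N.
    by rewrite subrr nrm0 /=; apply: leq_trans (ltnW jr) yN.
  have [p pj pQ] := chain_levels lip cyz lv.
  exists (val p) => _; split => // y' /val_inj ->.
  by case: pQ => [->//|[w /and3P[]]].
have [a ha] := boolp.choice H; exists a; split => [j jr|j w jr].
  by have [] := ha j jr.
by have [_] := ha j jr; exact.
Qed.

(** The ball of radius [9 m r] about [x] keeps away from the box and consists of [m] layers of width
    [9 r]. Each of its points has a linked net point within [r], and the ball of radius [8 r] about
    the latter stays within the next layer outwards: every layer costs a factor [1 - escape_rate].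
    The 36 is the total weight 6 at [b] times the bound 6 on the Green function. *)
Lemma net_blocked (x : L) (A : {set L}) : nrm (val x) = n -> B \subset A ->
  (forall z, z \in net -> linked om (~: A) z) ->
  tree_sum om A (fun f => (inside B (exit (A :\: B) f (Some x)))%:R) <=
  #|B|%:R * (36 * (1 - escape_rate) ^+ m) * treeZ om A.
Proof.
move=> xn BA lk; apply: le_trans (hit_le om_ge0 (Some x) BA) _.
have /andP[p0 p1] := rate01.
rewrite -mulrA mulr_natl -sumr_const; apply: ler_sum => b bB.
have bA := fintype.subsetP BA _ bB; move: bB; rewrite inE => bk.
have -> : 36 * (1 - escape_rate) ^+ m * treeZ om A = 6 * (6 * treeZ om A * (1 - escape_rate) ^+ m) by ring.
rewrite total ler_wpM2l //.
pose q (v : option L) : R := (v == Some b)%:R.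
have [U [Uq hU]] := dirichlet om_ge0 q (tA (A :\ b)).
rewrite (treeY_harmonic _ hU) => [|w wA]; last by rewrite Uq.
have U1 v : U v <= 1.
  have := @comparison _ _ om om_ge0 (A :\ b) U (fun=> 1) (tA _) _ hU; apply => [y _|w wA].
    by rewrite -mulr_suml.
  by rewrite Uq // /q; case: (_ == _).
have U0 : 0 <= U (Some x).
  have := @comparison _ _ om om_ge0 (A :\ b) (fun=> 0) U (tA _) _ _; apply => [y yA|y _|w wA].
  - by rewrite hU.
  - by rewrite !mulr0 big1 // => v _; rewrite mulr0.
  - by rewrite Uq.
apply: ler_pM => //; [exact: treeZ_ge0|exact: space_diag_le|].
have sep (y : L) : (nrm (val y - val x)%R <= 9 * (m * r))%N -> (9 * (m * r) <= nrm (val y))%N /\ (nrm (val y) <= 27 * (m * r))%N.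
  move=> yx; have := nrm_tri (val y) (val x) 0; have := nrm_tri (val x) (val y) 0.
  rewrite !subr0 (nrm_sym (val x)) xn nE; move: (nrm _) (nrm _) (m * r)%N yx => u v w; clear; lia.
have H i : (i <= m)%N -> forall y : L, (nrm (val y - val x)%R <= (m - i) * (9 * r))%N ->
    U (Some y) <= (1 - escape_rate) ^+ i.
  elim: i => [|i IH] im y yx; first by rewrite expr0.
  have mono j : ((m - j) * (9 * r) <= 9 * (m * r))%N by rewrite mulnCA leq_pmul2l // leq_mul // leq_subr.
  have [y1 y2] := sep y (leq_trans yx (mono _)).
  have [z zn yz] := net_near y1 y2.
  have shell_i : ((m - i) * (9 * r) = (m - i.+1) * (9 * r) + (r + 8 * r))%N.
    by rewrite -mulSnr -[(m - i)%N]prednK ?subn_gt0 // subnS mulSn addnC; congr (_ + _)%N; clear; lia.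
  have zN : (nrm (val z) + r < N)%N.
    have := nrm_tri (val z) (val y) 0; rewrite !subr0 (nrm_sym (val z)).
    move: (nrm _) (nrm _) (nrm _) yz y2 rmr mr0 nN => u v w; rewrite nE; move: (m * r)%N => t; clear; lia.
  have [a [az aQ]] := linked_levels zN (lk z zn).
  have zx (w : 'rV[int]_3) : (nrm (w - val z)%R <= 8 * r)%N -> (nrm (w - val x)%R <= (m - i) * (9 * r))%N.
    move=> wz; rewrite shell_i; have := nrm_tri w (val z) (val x); have := nrm_tri (val z) (val y) (val x).
    rewrite (nrm_sym (val z) (val y)); move: (nrm _) (nrm _) (nrm _) (nrm _) (nrm _) ((m - i.+1) * _)%N yz yx wz => u1 u2 u3 u4 u5 u6.
    clear; lia.
  rewrite exprSr.
  apply: (@space_step R L (A :\ b) U hU tA U1 (val z) a r ((1 - escape_rate) ^+ i) r8 _ az _ _ _ _ y yz).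
  - exact: exprn_ge0.
  - move=> w wz; rewrite in_cube; have := nrm_tri w (val z) 0; rewrite !subr0.
    have := nrm_tri (val z) (val y) 0; rewrite !subr0 (nrm_sym (val z)).
    move: (nrm _) (nrm _) (nrm _) (nrm _) (nrm _) wz yz y2 rmr mr0 nN => u1 u2 u3 u4 u5; rewrite nE; move: (m * r)%N => t; clear; lia.
  - by move=> w wz; apply: IH; [exact: ltnW|exact: zx].
  - move=> w wA wz; rewrite Uq // /q; have [|//] := eqVneq (Some w) (Some b).
    move=> [wb]; have [w1 _] := sep w (leq_trans (zx _ wz) (mono _)).
    by exfalso; move: w1 bk kn mr0; rewrite wb nE; move: (nrm _) (m * r)%N => u v; clear; lia.
  - move=> j w jr wa; have := aQ j w jr wa; rewrite inE => /negbTE h; by rewrite !inE h andbF.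
by apply: H => //; rewrite subrr nrm0.
Qed.

(** The norm drops by at most one along a branch, so the branch from a site beyond radius [n] to [B]
    crosses the sphere of radius [n]; the crossing site is a descendant too. *)
Lemma descendant_level (f : {ffun L -> option L}) (x : L) : weight om [set: L]%SET f != 0 ->
  descendant B f x -> (n <= nrm (val x))%N -> exists2 y, descendant B f y & nrm (val y) = n.
Proof.
move=> /prodf_neq0 wf; have step y w : f y = Some w -> (nrm (val y) <= (nrm (val w)).+1)%N.
  move=> fy; have := wf y; rewrite inE fy => /(_ isT); rewrite /tree_weight /= inE /edge.
  have [yw _|] := boolP (site_adj y w); last by rewrite eqxx.
  by have := @nrm_nn _ (val y) (val w) 0; rewrite !subr0; apply; move: yw; rewrite /site_adj nn_sym.
have kn' : (k <= n)%N by apply: leq_trans kn; rewrite leq_pmull.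
have desc i y : inside B (iter i (next (~: B) f) (Some y)) -> descendant B f y.
  move=> h; rewrite /descendant (exit_iter (k := i)) //.
  by move: h; case: (iter _ _ _) => //= w wB; rewrite inE wB.
suff H i : forall y, inside B (iter i (next (~: B) f) (Some y)) -> (n <= nrm (val y))%N ->
    exists2 y, descendant B f y & nrm (val y) = n by move=> dx; exact: (H #|{: L}| x dx).
elim: i => [|i IH] y hy yn.
  move: (hy); rewrite /= inE => yk; exists y; first exact: (desc 0%N).
  by apply/eqP; rewrite eqn_leq yn andbT (leq_trans yk).
have [e|ne] := eqVneq (nrm (val y)) n; first by exists y => //; exact: (desc i.+1).
have yB : y \in ~: B.
  by rewrite !inE -ltnNge; apply: leq_ltn_trans kn' _; rewrite ltn_neqAle eq_sym ne.
move: hy; rewrite iterSr /= yB; case fy : (f y) => [w|]; last first.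
  by rewrite iter_next_outside.
move=> hw; apply: (IH w hw); rewrite -ltnS; apply: leq_trans (step _ _ fy).
by rewrite ltn_neqAle eq_sym ne.
Qed.

(** Three cases: a net point is a descendant; none is, but a site on the sphere of radius [n] is; or
    all descendants lie within that sphere. The loss is at most 1 in the first two and is bounded by
    the volume in the third. *)
Lemma space_loss t : 0 <= t ->
  expected_loss adj c B 0 t 6 <= (72 * m).+1%:R ^+ 3 * (#|B|%:R * (6 * 24 * 8 / n%:R)) +
    (n + n).+1%:R ^+ 3 * (#|B|%:R * (36 * (1 - escape_rate) ^+ m)) + (n + n).+1%:R ^+ 3 * (t * 6).
Proof.
move=> t0; have /andP[p0 p1] := rate01.
have Z0 : 0 < Ztree adj c 0.
  apply: (@Ztree_gt0 R L adj c (@site_deg_le 3 R L) 0 6) => // kap x kk.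
  by apply: space_diag_le => //; rewrite inE.
rewrite /expected_loss mulrC ler_pdivrMr //.
pose S := [set x : L | nrm (val x) == n]%SET.
pose G f : R := \sum_(z <- net) (descendant B f z)%:R +
  \sum_(x in S) (descendant B f x && all (fun z => ~~ descendant B f z) net)%:R + (n + n).+1%:R ^+ 3 * (t * 6).
have cardS : (#|S|%:R : R) <= (n + n).+1%:R ^+ 3.
  rewrite -natrX ler_nat; apply: leq_trans (card_near L 0 n); apply: subset_leq_card.
  by apply/fintype.subsetP => y; rewrite !inE subr0 => /eqP ->.
apply: (@le_trans _ _ (tree_sum om [set: L]%SET G)).
  apply: ler_tree_sum_support => // f _ wf; rewrite /G.
  have s1 : 0 <= \sum_(z <- net) (descendant B f z)%:R :> R by apply: sumr_ge0.
  have s2 : 0 <= \sum_(x in S) (descendant B f x && all (fun z => ~~ descendant B f z) net)%:R :> R by apply: sumr_ge0.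
  have s3 : 0 <= (n + n).+1%:R ^+ 3 * (t * 6) :> R by rewrite !mulr_ge0 ?exprn_ge0.
  have [/existsP[x /andP[dx xn]]|] := boolP [exists x, descendant B f x && (n <= nrm (val x))%N]; last first.
    rewrite negb_exists => /forallP h.
    rewrite ge_min; apply/orP; right; apply: ler_wpDl; first exact: addr_ge0.
    rewrite ler_wpM2r ?mulr_ge0 // -natrX ler_nat; apply: leq_trans (card_near L 0 n); apply: subset_leq_card.
    apply/fintype.subsetP => y; rewrite !inE subr0 => dy; have := h y.
    by rewrite dy -ltnNge => /ltnW.
  rewrite ge_min; apply/orP; left.
  have [y dy yn] := descendant_level wf dx xn.
  have [al|] := boolP (all (fun z => ~~ descendant B f z) net).
    rewrite (bigD1 y) /= ?inE ?yn // dy /= mulr1n -addrA addrCA -addrA lerDl.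
    by rewrite !addr_ge0 ?sumr_ge0.
  rewrite -has_predC => /hasP[z zn /negPn dz].
  rewrite (big_rem z zn) /= dz mulr1n -!addrA lerDl !addr_ge0 ?sumr_ge0 //.
rewrite /G !tree_sumD mulrDl mulrDl; apply: lerD; first apply: lerD.
- apply: (@le_trans _ _ (\sum_(z <- net) (#|B|%:R * (6 * 24 * 8 / n%:R) * treeZ om [set: L]%SET))).
    elim: (net) (@net_hit) => [|z s IH] hit; last first.
    rewrite big_cons; have -> : tree_sum om [set: L]%SET (fun f => \sum_(w <- z :: s) (descendant B f w)%:R) =
      tree_sum om [set: L]%SET (fun f => (descendant B f z)%:R + \sum_(w <- s) (descendant B f w)%:R).
      by apply: eq_tree_sum => f _ _; rewrite big_cons.
      rewrite tree_sumD; apply: lerD; first by apply: hit; rewrite mem_head.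
      by apply: IH => w ws; apply: hit; rewrite inE ws orbT.
    by rewrite big_nil /tree_sum big1 // => f _; rewrite big_nil mulr0.
  rewrite big_const_seq count_predT iter_addr addr0 -[X in X <= _]mulr_natl -[X in _ <= X]mulrA.
  apply: ler_wpM2r; last by rewrite -natrX ler_nat size_net.
  by apply: mulr_ge0; [rewrite !mulr_ge0 ?invr_ge0|exact: treeZ_ge0].
- rewrite tree_sum_sum; apply: (@le_trans _ _ (\sum_(x in S) (#|B|%:R * (36 * (1 - escape_rate) ^+ m)) * treeZ om [set: L]%SET)).
    apply: ler_sum => x; rewrite inE => /eqP xn; apply: net_descendant_le => //.
      by rewrite !mulr_ge0 ?exprn_ge0.
    by move=> A BA lk; exact: net_blocked.
  rewrite -mulr_suml; apply: ler_wpM2r; first exact: treeZ_ge0.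
  rewrite sumr_const -[X in X <= _]mulr_natl; apply: ler_wpM2r => //.
  by rewrite !mulr_ge0 ?exprn_ge0.
- rewrite /Ztree /treeZ -tree_sumZ; apply: ler_tree_sum => // f _ _.
  by rewrite mulr1.
Qed.
End space_volume.

(** Exponential decay traded for a power, by [1 - p <= e^-p] and [e^(x/q) >= x/q]. *)
Lemma pow_decay (R : realType) (p x : R) (m q : nat) : (0 < q)%N -> 0 <= p <= 1 -> 0 < x -> x <= p * m%:R ->
  (1 - p) ^+ m <= (q%:R / x) ^+ q.
Proof.
move=> q0 /andP[p0 p1] x0 xp.
have q0R : 0 < q%:R :> R by rewrite ltr0n.
apply: (@le_trans _ _ (expR (- x))).
  apply: (@le_trans _ _ (expR (- p) ^+ m)).
    by rewrite lerXn2r ?nnegrE ?subr_ge0 ?expR_ge0 //; exact: expR_ge1Dx.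
  by rewrite -expRM_natl ler_expR mulrN lerN2 mulrC.
have -> : - x = q%:R * - (x / q%:R) by rewrite mulrN mulrC divfK // lt0r_neq0.
rewrite expRM_natl lerXn2r ?nnegrE ?expR_ge0 ?divr_ge0 ?(ltW x0) //.
rewrite expRN -[X in _ <= X]invf_div lef_pV2 ?posrE ?expR_gt0 ?divr_gt0 //.
by apply: le_trans (expR_ge1Dx _); lra.
Qed.

(** * Choice of the net in three dimensions *)

Section space_finite_volume.
Variable R : realType.

(** For [r = 8 l^6] the inverse of [escape_rate] is at most [rate_scale * l], the logarithm in
    [shell_max] being bounded linearly. *)
Definition rate_scale : R := 10 * 6 ^+ 15 * 51.
Definition net_const : R := 73 ^+ 3 * 27 * 8.
Definition blocked_const : R := 289 ^+ 3 * 27 * 36 * (26 * rate_scale) ^+ 26.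
Definition volume_const : R := 289 ^+ 3 * 6.
Definition space_const : R := net_const + blocked_const + volume_const.

Let rate_scale_gt0 : 0 < rate_scale.
Proof. by rewrite /rate_scale !mulr_gt0 // exprn_gt0. Qed.

Let net_const_ge0 : 0 <= net_const.
Proof. by rewrite /net_const mulr_ge0 // mulr_ge0 // exprn_ge0. Qed.
Let blocked_const_ge0 : 0 <= blocked_const.
Proof.
have D : 0 <= (26 * rate_scale) ^+ 26 by rewrite exprn_ge0 // mulr_ge0 // ltW.
by rewrite /blocked_const; apply: mulr_ge0 D; rewrite mulr_ge0 // mulr_ge0 // exprn_ge0.
Qed.
Let volume_const_ge1 : 1 <= volume_const.
Proof. by rewrite /volume_const; apply: mulr_ege1; [apply: exprn_ege1|]; rewrite ler1n. Qed.

Lemma space_const_ge1 : 1 <= space_const.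
Proof. by apply: le_trans volume_const_ge1 _; rewrite lerDr addr_ge0. Qed.

Lemma shell_max_le l : (0 < l)%N -> 1 <= shell_max R (8 * l ^ 6) <= 51 * l%:R.
Proof.
move=> l0; have l1 : 1 <= l%:R :> R by rewrite ler1n.
have lR : 0 < l%:R :> R by rewrite ltr0n.
have e : ln (8 * l ^ 6)%:R = ln 8 + 6 * ln l%:R :> R.
  by rewrite natrM natrX lnM ?posrE ?exprn_gt0 // lnXn // mulr_natl.
have p8 : 0 < 8 :> R by [].
have h8 := ln_leB1 p8; have hl := ln_leB1 lR.
have h8' : 0 <= ln 8 :> R by apply: ln_ge0; lra.
have hl' : 0 <= ln l%:R :> R by exact: ln_ge0.
by rewrite /shell_max e; apply/andP; split; lra.
Qed.

(** The power is [26 = 24 + 2]: it cancels the volume factor [l^24] and leaves [l^-2]. *)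
Lemma escape_rate_decay l : (0 < l)%N ->
  (1 - escape_rate R (8 * l ^ 6)) ^+ (l ^ 2) <= (26 * rate_scale) ^+ 26 / l%:R ^+ 26.
Proof.
move=> l0; have /andP[s1 s2] := shell_max_le l0.
have lR : 0 < l%:R :> R by rewrite ltr0n.
have P0 : 0 < 6 ^+ 15 :> R by rewrite exprn_gt0.
have P1 : 1 <= 6 ^+ 15 :> R by rewrite exprn_ege1 //; lra.
have K0 : 0 < 10 * 6 ^+ 15 * shell_max R (8 * l ^ 6) by rewrite !mulr_gt0 // (lt_le_trans ltr01).
have K1 : 1 <= 10 * 6 ^+ 15 * shell_max R (8 * l ^ 6).
  by rewrite -[X in X <= _]mulr1 ler_pM // mulr_ege1 //; lra.
have x0 : 0 < l%:R / rate_scale by rewrite divr_gt0.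
have D0 := rate_scale_gt0.
have -> : (26 * rate_scale) ^+ 26 / l%:R ^+ 26 = (26%:R / (l%:R / rate_scale)) ^+ 26.
  by rewrite -expr_div_n; congr (_ ^+ _); field; rewrite !lt0r_neq0.
apply: pow_decay => //; first by rewrite invr_ge0 (ltW K0) invf_le1.
rewrite /escape_rate natrX [X in _ <= X]mulrC ler_pdivlMr // mulrAC ler_pdivrMr //.
rewrite /rate_scale; move: (6 ^+ 15) P0 {P1 K0 K1 D0 x0} s2 => P P0 s2.
have h := ler_wpM2l (ltW (mulr_gt0 P0 lR)) s2.
by rewrite expr2; lra.
Qed.

(** With [m = l^2] and [r = 8 l^6], so [n = 144 l^8], the net has order [l^6] points, each a
    descendant with probability of order [k^3 / l^8]. The sphere contributes at the same order by
    [escape_rate_decay], and the volume within it is of order [l^24]. *)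
Lemma space_finite_volume k l N t : (0 < k)%N -> (0 < l)%N -> (k <= 18 * l ^ 8)%N -> (576 * l ^ 8 <= N)%N -> 0 <= t ->
  forall E : set (heights (cube 3 N) R), measurable E ->
  cylindrical [set y : cube 3 N | (nrm (val y) <= k)%N]%SET E ->
  E `<=` low_on_B ((2 * 3)%:R : R) [set y : cube 3 N | (nrm (val y) <= k)%N]%SET ->
  sandpile_mass (@site_adj 3 (cube 3 N)) ((2 * 3)%:R : R) 0 E <=
  sandpile_mass (@site_adj 3 (cube 3 N)) ((2 * 3)%:R : R) t E +
    space_const * (k%:R ^+ 3 / l%:R ^+ 2 + l%:R ^+ 24 * t).
Proof.
move=> k0 l0 kl lN t0 E mE cE El.
have l1 : 1 <= l%:R :> R by rewrite ler1n.
have lR : 0 < l%:R :> R by rewrite ltr0n.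
have nE : (18 * l ^ 2 * (8 * l ^ 6) = 144 * l ^ 8)%N.
  by rewrite mulnACA -expnD.
have := @sandpile_mass_comparison R (cube 3 N) (@site_adj 3 (cube 3 N)) (2 * 3)%:R
  (@site_adj_sym 3 _) (@site_deg_le 3 R _) [set y : cube 3 N | (nrm (val y) <= k)%N]%SET 0 t 6
  (lexx 0) t0 (ler0n _ 6).
move=> /(_ _ E mE cE El); rewrite lerBlDr add0r => h.
apply: le_trans (h _) _ => [kap x kk|]; first by apply: space_diag_le => //; rewrite inE.
rewrite lerD2l.
apply: le_trans (@space_loss R N k (l ^ 2) (8 * l ^ 6) _ _ _ _ t t0) _.
- by rewrite leq_pmulr // expn_gt0 l0.
- by rewrite expn_gt0 l0.
- by rewrite nE (_ : 144 = 8 * 18)%N // -mulnA leq_pmul2l.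
- by rewrite nE mulnA.
rewrite nE.
set Bc : R := #|_|%:R; set esc := (1 - _) ^+ _.
have Bk : Bc <= 27 * k%:R ^+ 3.
  have := card_box3 N k; rewrite (negbTE (lt0n_neq0 k0)) orbF => hb.
  by rewrite /Bc -natrX -(natrM _ 27) ler_nat.
have B0 : 0 <= Bc by rewrite /Bc.
have K0 : 0 <= k%:R ^+ 3 :> R by rewrite exprn_ge0.
have e0 : 0 <= esc.
  have /andP[s1 s2] := shell_max_le l0.
  rewrite exprn_ge0 // subr_ge0 invf_le1; last by rewrite !mulr_gt0 ?exprn_gt0 // (lt_le_trans ltr01).
  have P1 : 1 <= 6 ^+ 15 :> R by rewrite exprn_ege1 //; lra.
  by rewrite -[X in X <= _]mulr1 ler_pM // mulr_ege1 //; lra.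
have esc_le : esc <= (26 * rate_scale) ^+ 26 / l%:R ^+ 26 by exact: escape_rate_decay.
have a1 : (72 * l ^ 2).+1%:R <= 73 * l%:R ^+ 2 :> R.
  by rewrite -natrX -(natrM _ 73) ler_nat; have : (0 < l ^ 2)%N by [rewrite expn_gt0 l0]; clear; lia.
have a2 : (144 * l ^ 8 + 144 * l ^ 8).+1%:R <= 289 * l%:R ^+ 8 :> R.
  by rewrite -natrX -(natrM _ 289) ler_nat; have : (0 < l ^ 8)%N by [rewrite expn_gt0 l0]; clear; lia.
have p1 : (72 * l ^ 2).+1%:R ^+ 3 <= (73 * l%:R ^+ 2) ^+ 3 :> R by rewrite lerXn2r ?nnegrE // mulr_ge0 ?exprn_ge0.
have p2 : (144 * l ^ 8 + 144 * l ^ 8).+1%:R ^+ 3 <= (289 * l%:R ^+ 8) ^+ 3 :> R.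
  by rewrite lerXn2r ?nnegrE // mulr_ge0 ?exprn_ge0.
have q0 : 0 <= k%:R ^+ 3 / l%:R ^+ 2 :> R by rewrite divr_ge0 ?exprn_ge0.
have t1 : (72 * l ^ 2).+1%:R ^+ 3 * (Bc * (6 * 24 * 8 / (144 * l ^ 8)%:R)) <= net_const * (k%:R ^+ 3 / l%:R ^+ 2).
  apply: le_trans (_ : (73 * l%:R ^+ 2) ^+ 3 * (27 * k%:R ^+ 3 * (8 / l%:R ^+ 8)) <= _).
    apply: ler_pM p1 _; rewrite ?exprn_ge0 ?mulr_ge0 ?invr_ge0 //.
    apply: ler_pM Bk _; rewrite ?mulr_ge0 ?invr_ge0 //.
    rewrite natrM natrX le_eqVlt; apply/orP; left; apply/eqP; field.
    by rewrite lt0r_neq0.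
  by rewrite /net_const le_eqVlt; apply/orP; left; apply/eqP; field; rewrite lt0r_neq0.
have t2 : (144 * l ^ 8 + 144 * l ^ 8).+1%:R ^+ 3 * (Bc * (36 * esc)) <=
    blocked_const * (k%:R ^+ 3 / l%:R ^+ 2).
  apply: le_trans (_ : (289 * l%:R ^+ 8) ^+ 3 * (27 * k%:R ^+ 3 * (36 * ((26 * rate_scale) ^+ 26 / l%:R ^+ 26))) <= _).
    apply: ler_pM p2 _; rewrite ?exprn_ge0 ?mulr_ge0 //.
    by apply: ler_pM Bk _; rewrite ?mulr_ge0 // ler_wpM2l.
  rewrite /blocked_const; move: ((26 * rate_scale) ^+ 26) => Q.
  by rewrite le_eqVlt; apply/orP; left; apply/eqP; field; rewrite lt0r_neq0.
have t3 : (144 * l ^ 8 + 144 * l ^ 8).+1%:R ^+ 3 * (t * 6) <= volume_const * (l%:R ^+ 24 * t).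
  apply: le_trans (ler_wpM2r _ p2) _; first by rewrite mulr_ge0.
  by rewrite /volume_const le_eqVlt; apply/orP; left; apply/eqP; ring.
apply: le_trans (lerD (lerD t1 t2) t3) _.
have Y0 : 0 <= l%:R ^+ 24 * t by rewrite mulr_ge0 // exprn_ge0.
rewrite /space_const; move: (_ / _) (_ * t) q0 Y0 => X Y X0 Y0.
move: net_const blocked_const volume_const net_const_ge0 blocked_const_ge0 (le_trans ler01 volume_const_ge1) => a b c a0 b0 c0.
have := mulr_ge0 a0 Y0; have := mulr_ge0 b0 Y0; have := mulr_ge0 c0 X0; lra.
Qed.
End space_finite_volume.

(** * Infinite volume *)

Section bridge.
Variables (R : realType) (d N : nat) (g : R).
Hypotheses (d_gt0 : (0 < d)%N) (g_ge0 : 0 <= g).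
Local Notation L := (cube d N).
Local Notation adj := (@site_adj d L).
Local Notation c := ((2 * d)%:R : R).

Lemma allowedE : @allowed R d g L = recurrent adj c g.
Proof.
have cardE (W : {set L}) (y : L) :
    #|[pred z in W | nearest_neighbours (val z) (val y)]|%:R = \sum_(z in W) edge R adj y z.
  by rewrite -sum1_card natr_sum big_mkcondr; apply: eq_bigr => z _; rewrite /edge /site_adj; case: ifP.
apply/seteqP; split => h [sh fh]; split => // W W0 hW; apply: (fh W W0) => y yW; first by rewrite cardE; exact: hW.
by rewrite -cardE; exact: hW.
Qed.

Lemma cube_Ztree_gt0 : 0 < Ztree adj c g.
Proof.
apply: (@Ztree_gt0 R L adj c (@site_deg_le d R L) g (d%:R * N.+1%:R ^+ 2)) => //.
move=> k x kk; apply: cube_green_bound => // y; apply: le_trans (kk y).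
by rewrite /killing lerD2r lerD2l.
Qed.

Lemma sandpile_measureE (A : set (heights L R)) : measurable A ->
  sandpile_measure g L A = (sandpile_mass adj c g A)%:E.
Proof.
move=> mA.
have ev : (mrestr (@lebesgue_heights L R) (@measurable_allowed R d g L) : {measure set _ -> \bar R}) setT = (Ztree adj c g)%:E.
  rewrite /= /mrestr setTI [X in lebesgue_heights X = _]allowedE lebesgue_recurrent //.
  by move=> y; exact: site_deg_le.
have -> : sandpile_measure g L A = mnormalize (mrestr (@lebesgue_heights L R) (@measurable_allowed R d g L)) point A by [].
rewrite /mnormalize ev eqe gt_eqF ?cube_Ztree_gt0 //= /mrestr allowedE.
rewrite -[X in (X * _)%E]fineK -?EFinM //.
by apply: lebesgue_recurrent_fin => // y; exact: site_deg_le.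
Qed.

End bridge.

Section restriction.
Variables (R : realType) (d k : nat).

Definition box_restrict (h : heights 'rV[int]_d R) : heights (box d k) R := fun x => h (sval x).

Let measurable_box_restrict : measurable_fun setT box_restrict.
Proof. by apply: measurable_fun_heights => x; exact: measurable_height. Qed.

HB.instance Definition _ := isMeasurableFun.Build _ _ _ _ box_restrict measurable_box_restrict.

Lemma measurable_cylinder (E0 : set (heights (box d k) R)) : measurable E0 -> measurable (cylinder E0).
Proof.
move=> mE; rewrite (_ : cylinder E0 = box_restrict @^-1` E0) //.
by rewrite -[X in measurable X]setTI; exact: measurable_box_restrict.
Qed.

Lemma box_nrm (x : box d k) : (nrm (sval x) <= k)%N.
Proof.
case: x => x /= /forallP h; rewrite nrm_le; apply/forallP => i; have := h i.
by move: (x 0%R i) => m; lia.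
Qed.

Lemma nrm_box (x : 'rV[int]_d) : (nrm x <= k)%N -> exists y : box d k, sval y = x.
Proof.
rewrite nrm_le => /forallP h; have xb : [forall i, `|x 0 i| <= k%:Z].
  by apply/forallP => i; have := h i; move: (x 0%R i) => m; lia.
by exists (exist _ x xb).
Qed.

Variables (N : nat) (g eps : R).
Hypotheses (d_gt0 : (0 < d)%N) (g_ge0 : 0 <= g).
Local Notation L := (cube d N).
Local Notation adj := (@site_adj d L).
Local Notation c := ((2 * d)%:R : R).
Local Notation B := [set y : L | (nrm (val y) <= k)%N]%SET.

(** At zero dissipation heights are below [2 d], so [E0] may be cut down to [stable d 0], which
    ensures [low_on_B]; at dissipation [g] the cut can only lower the mass. *)
Lemma cube_transfer :
  (forall E : set (heights L R), measurable E -> cylindrical B E -> E `<=` low_on_B c B ->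
     sandpile_mass adj c 0 E <= sandpile_mass adj c g E + eps) ->
  forall E0 : set (heights (box d k) R), measurable E0 ->
  fine (extended_sandpile_measure 0 L (cylinder E0)) <=
  fine (extended_sandpile_measure g L (cylinder E0)) + eps.
Proof.
move=> cmp E0 mE0.
have mext (A : set (heights (box d k) R)) : measurable A -> measurable (@extend_by_zero R d L @^-1` cylinder A).
  move=> mA; rewrite -[X in measurable X]setTI.
  by apply: (measurable_funPT (@extend_by_zero R d L)) => //; exact: measurable_cylinder.
have extE (s : R) (A : set (heights (box d k) R)) : 0 <= s -> measurable A -> fine (extended_sandpile_measure s L (cylinder A)) =
    sandpile_mass adj c s (@extend_by_zero R d L @^-1` cylinder A).
  move=> s0 mA; rewrite /extended_sandpile_measure /= /distribution /pushforward sandpile_measureE //.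
  exact: mext.
pose S : set (heights (box d k) R) := E0 `&` stable d 0.
have mS : measurable S by apply: measurableI => //; exact: measurable_stable.
have dl := @site_deg_le d R L.
rewrite !extE //; apply: le_trans (_ : sandpile_mass adj c 0 (@extend_by_zero R d L @^-1` cylinder S) <= _).
  rewrite le_eqVlt; apply/orP; left; apply/eqP; congr (fine (lebesgue_heights _) / _).
  apply/seteqP; split => h [hE hr]; split => //; last by case: hE.
  split => // x; rewrite /extend_by_zero; case: (insub _) => [u|].
    by case: hr => hr _; have := hr u.
  (* Box sites outside the cube carry the height 0, which is stable because [d > 0]. *)
  by rewrite lexx addr0 ltr0n muln_gt0.
apply: le_trans (cmp _ (mext _ mS) _ _) _.
- move=> h h' hh [h1 h2]; have e : (fun x : box d k => extend_by_zero h (sval x)) = (fun x : box d k => extend_by_zero h' (sval x)).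
    apply/funext => x; rewrite /extend_by_zero; case: insubP => //= u _ ux.
    apply: hh; rewrite !inE negbK; have -> : val u = sval x by exact: ux.
    exact: box_nrm.
  by split; rewrite /= -?e.
- move=> h [_ hs] b; rewrite inE => /nrm_box[x xb].
  by have := hs x; rewrite /= addr0 xb /extend_by_zero valK.
rewrite lerD2r; apply: sandpile_mass_le => //; first exact: mext.
  exact: mext.
by move=> h [].
Qed.
End restriction.

(** * Continuous approximation of indicators *)

Section continuous_functions.
Variables (T : topologicalType) (R : realType).
Implicit Types F G : T -> R.

Lemma continuous_complement F : continuous F -> continuous (fun x => 1 - F x).
Proof. by move=> cF x; apply: cvgB; [exact: cvg_cst|exact: cF]. Qed.

Lemma continuous_join F G : continuous F -> continuous G -> continuous (fun x => F x + G x - F x * G x).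
Proof.
move=> cF cG x; apply: cvgB; first by apply: cvgD; [exact: cF|exact: cG].
by apply: cvgM; [exact: cF|exact: cG].
Qed.

Lemma continuous_affine F (a b : R) : continuous F -> continuous (fun x => a * F x + b).
Proof.
move=> cF x; apply: cvgD; last exact: cvg_cst.
by apply: cvgM; [exact: cvg_cst|exact: cF].
Qed.

(** Truncation to [[0, 1]], written with absolute values so that continuity is immediate. *)
Definition clamp (t : R) := (`|t| - `|t - 1| + 1) / 2.

Lemma continuous_clamp : continuous clamp.
Proof.
move=> t; rewrite /clamp; apply: cvgM; last exact: cvg_cst.
apply: cvgD; last exact: cvg_cst.
apply: cvgB; first by apply: cvg_norm; exact: cvg_id.
by apply: cvg_norm; apply: cvgB; [exact: cvg_id|exact: cvg_cst].
Qed.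

Lemma clamp01 t : 0 <= clamp t <= 1.
Proof.
by rewrite /clamp; case: (ger0P t) => h; case: (ger0P (t - 1)) => h'; apply/andP; split; lra.
Qed.

Lemma clamp_le0 t : t <= 0 -> clamp t = 0.
Proof.
move=> t0; have t1 : t - 1 <= 0 by lra.
by rewrite /clamp (ler0_norm t0) (ler0_norm t1); lra.
Qed.

Lemma clamp_ge1 t : 1 <= t -> clamp t = 1.
Proof.
move=> t1; have t0 : 0 <= t by lra. have t2 : 0 <= t - 1 by lra.
by rewrite /clamp (ger0_norm t0) (ger0_norm t2); lra.
Qed.

Lemma continuous_clamp_comp F : continuous F -> continuous (clamp \o F).
Proof. by move=> cF x; apply: continuous_comp; [exact: cF|exact: continuous_clamp]. Qed.

Lemma measurable_clamp (d : measure_display) (X : measurableType d) (f : X -> R) :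
  measurable_fun setT f -> measurable_fun setT (clamp \o f).
Proof.
by move=> mf; apply: measurableT_comp => //; apply: continuous_measurable_fun; exact: continuous_clamp.
Qed.

Lemma measurable_affine (d : measure_display) (X : measurableType d) (f : X -> R) (a b : R) :
  measurable_fun setT f -> measurable_fun setT (fun x => a * f x + b).
Proof. by move=> mf; apply: measurable_funD => //; exact: measurable_funM. Qed.

End continuous_functions.

Section approximation.
Variables (I : Type) (R : realType) (Q : {measure set (heights I R) -> \bar R}).
Hypothesis Q_fin : (Q setT < +oo)%E.
Implicit Types (A D : set (heights I R)) (F G : heights I R -> R).

Definition continuous_indicator A D F := [/\ continuous F, measurable_fun setT F,
  forall x, 0 <= F x <= 1 & forall x, ~ D x -> F x = \1_A x].

(** A Lusin property of indicators: the approximating function is exact off a set of small measure.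
    It is stable under complements and countable unions, so it extends from rays to the whole
    sigma-algebra. *)
Definition approximable A := measurable A /\ forall e : R, 0 < e ->
  exists F D, [/\ continuous_indicator A D F, measurable D & (Q D <= e%:E)%E].

Lemma measure_vanish (D : nat -> set (heights I R)) (e : R) : (forall n, measurable (D n)) ->
  (forall n m, (n <= m)%N -> D m `<=` D n) -> \bigcap_n D n = set0 -> 0 < e ->
  exists n, (Q (D n) <= e%:E)%E.
Proof.
move=> mD nD D0 e0.
have : (Q \o D) x @[x --> \oo] --> Q (\bigcap_n D n).
  apply: nonincreasing_cvg_mu => //.
  - by apply: le_lt_trans Q_fin; apply: le_measure; rewrite ?inE.
  - by rewrite D0.
  - by move=> n m nm; rewrite subsetEset; exact: nD.
rewrite D0 measure0 => /fine_cvgP[fin /cvgr_lt/(_ e e0) lt].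
have [n _ /(_ n (leqnn n))[f1 f2]] := filterI fin lt.
exists n; have -> : Q (D n) = (fine ((Q \o D) n))%:E by rewrite fineK.
by rewrite lee_fin ltW.
Qed.

Lemma approximable0 : approximable set0.
Proof.
split=> // e e0; exists (fun=> 0), set0; split; rewrite ?measure0 ?lee_fin ?ltW //.
split => // [|x|x _]; first exact: cst_continuous.
  by rewrite lexx ler01.
by rewrite indic0.
Qed.

Lemma approximableC A : approximable A -> approximable (~` A).
Proof.
move=> [mA hA]; split; first exact: measurableC.
move=> e /hA[F [D [[cF mF F01 FA] mD QD]]]; exists (fun x => 1 - F x), D; split => //.
split => [||x|x Dx].
- exact: continuous_complement.
- by apply: measurable_funB.
- by have /andP[h1 h2] := F01 x; rewrite subr_ge0 h2 gerBl.
rewrite FA // !indicE in_setC; case: (x \in A); rewrite /= ?subrr ?subr0 //.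
Qed.

Lemma approximableU A A' : approximable A -> approximable A' -> approximable (A `|` A').
Proof.
move=> [mA hA] [mA' hA']; split; first exact: measurableU.
move=> e e0; have e2 : 0 < e / 2 by rewrite divr_gt0.
have [F [D [[cF mF F01 FA] mD QD]]] := hA _ e2.
have [G [D' [[cG mG G01 GA] mD' QD']]] := hA' _ e2.
exists (fun x => F x + G x - F x * G x), (D `|` D'); split.
- split => [||x|x DDx].
  + exact: continuous_join.
  + by apply: measurable_funB; [exact: measurable_funD|exact: measurable_funM].
  + have /andP[h1 h2] := F01 x; have /andP[h3 h4] := G01 x; apply/andP; split; nra.
  + have nD : ~ D x by move=> h; apply: DDx; left.
    have nD' : ~ D' x by move=> h; apply: DDx; right.
    rewrite (FA _ nD) (GA _ nD').
    rewrite !indicE in_setU; case: (x \in A); case: (x \in A'); rewrite /=; ring.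
- exact: measurableU.
- apply: le_trans (measureU2 _ mD mD') _.
  by apply: le_trans (leeD QD QD') _; rewrite -EFinD -splitr.
Qed.

(** A finite union is approximated; the remaining part has small measure by continuity from above
    and joins the exceptional set. *)
Lemma approximable_bigcup (A : nat -> set (heights I R)) : (forall n, approximable (A n)) ->
  approximable (\bigcup_n A n).
Proof.
move=> hA; have mA n : measurable (A n) by case: (hA n).
have mU : measurable (\bigcup_n A n) by exact: bigcupT_measurable.
pose U n := \big[setU/set0]_(i < n) A i.
have hU n : approximable (U n).
  rewrite /U; elim: n => [|n IH]; first by rewrite big_ord0; exact: approximable0.
  by rewrite big_ord_recr; exact: approximableU.
have UE n : U n = \bigcup_(i < n) A i by rewrite /U -bigcup_mkord.
split => // e e0; have e2 : 0 < e / 2 by rewrite divr_gt0.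
have mUn n : measurable (U n) by case: (hU n).
have [n Qn] := @measure_vanish (fun n => \bigcup_n A n `\` U n) _
  (fun n => measurableD mU (mUn n)) (ltac:(
    move=> n m nm x [Ax nU]; split => //; rewrite UE => -[i /= ni Ai]; apply: nU;
    rewrite UE; exists i => //; exact: leq_trans nm)) (ltac:(
    apply/seteqP; split => // x Ax; have [[i _ Ai] _] := Ax 0%N Logic.I;
    have [_] := Ax i.+1 Logic.I; apply; rewrite UE; exists i => //=)) e2.
have [_ /(_ _ e2)[F [D [[cF mF F01 FA] mD QD]]]] := hU n.
exists F, (D `|` (\bigcup_n A n `\` U n)); split.
- split => // x /not_orP[nD nAU]; rewrite FA // !indicE.
  have [Ux|nUx] := boolP (x \in U n).
    rewrite mem_set //; move: Ux; rewrite inE UE => -[i _ Ai]; by exists i.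
  rewrite memNset // => Ax; apply: nAU; split => //.
  by move/negP: nUx => h /mem_set.
- by apply: measurableU => //; exact: measurableD.
- apply: le_trans (measureU2 _ mD (measurableD mU (mUn n))) _.
  by apply: le_trans (leeD QD Qn) _; rewrite -EFinD -splitr.
Qed.

End approximation.

Section approximation_coordinates.
Variables (I : eqType) (R : realType) (Q : {measure set (heights I R) -> \bar R}).
Hypothesis Q_fin : (Q setT < +oo)%E.

Lemma continuous_height (i : I) : continuous (fun h : heights I R => h i).
Proof. exact: (@proj_continuous I (fun=> R) i). Qed.

(** A ramp of slope [n.+1] starting at [q]; its error lives on a strip that shrinks to the empty
    set. *)
Lemma approximable_ray (i : I) (q : R) : approximable Q [set h : heights I R | q < h i].
Proof.
have mray (a b : itv_bound R) : measurable [set h : heights I R | h i \in Interval a b].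
  rewrite -[X in measurable X]setTI.
  exact: (@measurable_height I R i measurableT [set` Interval a b] (measurable_itv _)).
have set_ray : [set h : heights I R | q < h i] = [set h | h i \in `]q, +oo[].
  by apply/seteqP; split => h /=; rewrite in_itv /= andbT.
split; first by rewrite set_ray; exact: mray.
move=> e e0.
pose D n : set (heights I R) := [set h | h i \in `]q, q + n.+1%:R^-1[].
have mD n : measurable (D n) by exact: mray.
have nD n m : (n <= m)%N -> D m `<=` D n.
  move=> nm h; rewrite /D /= !in_itv /= => /andP[-> h2] /=; apply: lt_le_trans h2 _.
  by rewrite lerD2l lef_pV2 ?posrE // ler_nat.
have D0 : \bigcap_n D n = set0.
  apply/seteqP; split => // h hD.
  have qh : 0 < h i - q by have := hD 0%N Logic.I; rewrite /D /= in_itv /= => /andP[qh _]; rewrite subr_gt0.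
  pose n := Num.truncn (h i - q)^-1.
  have := hD n Logic.I; rewrite /D /= in_itv /= => /andP[_]; rewrite -ltrBlDl => hn.
  have : (h i - q)^-1 < n.+1%:R by exact: truncnS_gt.
  by rewrite -ltf_pV2 ?posrE ?invr_gt0 // invrK => /(lt_trans hn); rewrite ltxx.
have [n Qn] := measure_vanish Q_fin mD nD D0 e0.
exists (clamp (R := R) \o (fun h : heights I R => n.+1%:R * h i + - (n.+1%:R * q))), (D n); split => //.
split.
- by apply: continuous_clamp_comp; apply: continuous_affine; exact: continuous_height.
- by apply: measurable_clamp; apply: measurable_affine; exact: measurable_height.
- by move=> h /=; exact: clamp01.
- move=> h /negP; rewrite /D /= in_itv /= negb_and -!leNgt -mulrBr => hD.
  rewrite indicE; have [hq|hq] := lerP (h i) q.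
    rewrite memNset; last by rewrite /= ltNge hq.
    by rewrite clamp_le0 // pmulr_rle0 // subr_le0.
  rewrite mem_set // clamp_ge1 //.
  move: hD; rewrite leNgt hq /= -lerBrDl => h2.
  by rewrite mulrC -ler_pdivrMr // div1r.
Qed.

Lemma approximable_measurable A : measurable A -> approximable Q A.
Proof.
have sa : sigma_algebra setT (approximable Q).
  split; first exact: approximable0.
    by move=> A' hA; rewrite setTD; exact: approximableC.
  by move=> F hF; exact: approximable_bigcup.
move=> mA; apply: (@smallest_sub _ (sigma_algebra setT) _ _ sa _ A mA).
move=> _ [i _ [B mB <-]]; rewrite setTI.
have sb : sigma_algebra setT [set B | approximable Q ((fun h : heights I R => h i) @^-1` B)].
  split => /=; first by rewrite preimage_set0; exact: approximable0.
    by move=> A0 hA; rewrite setTD preimage_setC; exact: approximableC.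
  by move=> F hF; rewrite preimage_bigcup; exact: approximable_bigcup.
have : (@RGenOInfty.G R).-sigma.-measurable B by rewrite -RGenOInfty.measurableE.
apply: (@smallest_sub _ (sigma_algebra setT) _ _ sb).
move=> _ [q ->] /=; have -> : (fun h : heights I R => h i) @^-1` `]q, +oo[ = [set h | q < h i].
  by apply/seteqP; split => h /=; rewrite in_itv /= andbT.
exact: approximable_ray.
Qed.
End approximation_coordinates.

Lemma continuous_into_ptws (R : realType) (T : topologicalType) (J : Type) (f : T -> {ptws J -> R}) :
  (forall j, continuous (fun t => f t j)) -> continuous f.
Proof.
move=> cf t; apply/cvg_sup => j U [? /= [[W oW <-]]] /= Wf /filterS; apply.
by apply: (cf j t); exact: open_nbhs_nbhs.
Qed.

(** * Passage to the weak limit *)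

Section limit_transfer.
Variables (R : realType) (d k : nat).
Local Notation Zd := 'rV[int]_d.
Local Notation X := (heights Zd R).
Local Notation res := (@box_restrict R d k).

Lemma continuous_box_restrict (F : heights (box d k) R -> R) : continuous F -> continuous (F \o res).
Proof.
move=> cF h; apply: continuous_comp; last exact: cF.
apply: (@continuous_into_ptws R X (box d k) res) => x.
exact: (@continuous_height Zd R (sval x)).
Qed.

Lemma integral_ge_prob (P : probability X R) (F : X -> R) (S : set X) : measurable_fun setT F -> measurable S ->
  (forall x, 0 <= F x) -> (forall x, S x -> 1 <= F x) -> (P S <= \int[P]_x (F x)%:E)%E.
Proof.
move=> mF mS F0 FS.
have -> : P S = (\int[P]_x (\1_S x)%:E)%E by rewrite integral_indic // setIT.
have mFE : measurable_fun setT (EFin \o F) by exact: measurableT_comp.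
have mI : measurable_fun setT (EFin \o (\1_S : X -> R)).
  by apply: measurableT_comp => //; exact/measurable_indicP.
apply: ge0_le_integral; [exact: measurableT| |exact: mI|exact: mFE|].
- by move=> x _; rewrite lee_fin indicE.
- move=> x _; rewrite lee_fin indicE; have [Sx|Sx] := pselect (S x).
    by rewrite mem_set //=; exact: FS.
  by rewrite memNset //=; exact: F0.
Qed.

Lemma integral_le_prob (P : probability X R) (F : X -> R) (S : set X) : measurable_fun setT F -> measurable S ->
  (forall x, 0 <= F x <= 1) -> (forall x, ~ S x -> F x <= 0) -> (\int[P]_x (F x)%:E <= P S)%E.
Proof.
move=> mF mS F01 FS.
have -> : P S = (\int[P]_x (\1_S x)%:E)%E by rewrite integral_indic // setIT.
have mFE : measurable_fun setT (EFin \o F) by exact: measurableT_comp.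
have mI : measurable_fun setT (EFin \o (\1_S : X -> R)).
  by apply: measurableT_comp => //; exact/measurable_indicP.
apply: ge0_le_integral; [exact: measurableT| |exact: mFE|exact: mI|].
- by move=> x _; rewrite lee_fin; case/andP: (F01 x).
- move=> x _; rewrite lee_fin indicE; have [Sx|Sx] := pselect (S x).
    by rewrite mem_set //=; case/andP: (F01 x).
  by rewrite memNset //=; exact: FS.
Qed.

Variables (mu0 mu1 : nat -> probability X R) (m0 m1 : probability X R) (eps : R).
Hypotheses (w0 : weak_cvg mu0 m0) (w1 : weak_cvg mu1 m1).
Hypothesis cmp : exists N, forall n, (N <= n)%N -> forall E0 : set (heights (box d k) R), measurable E0 ->
  fine (mu0 n (cylinder E0)) <= fine (mu1 n (cylinder E0)) + eps.

(** With [S] the event [F >= 1/2], its indicator lies between [clamp (2 F - 1)] and [clamp (2 F)].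
    The finite-volume comparison is applied to [S], and the two continuous bounds pass to the
    limit. *)
Lemma weak_transfer (E0 : set (heights (box d k) R)) : measurable E0 ->
  fine (m0 (cylinder E0)) <= fine (m1 (cylinder E0)) + eps.
Proof.
move=> mE0; have [N hN] := cmp.
(* The sum of both marginals, so that one exceptional set is small for the two limits at once. *)
pose Q : {measure set (heights (box d k) R) -> \bar R} :=
  measure_add (distribution m0 res) (distribution m1 res).
have QE A : Q A = (m0 (cylinder A) + m1 (cylinder A))%E by exact: measure_addE.
have Qfin : (Q setT < +oo)%E.
  by rewrite QE; apply: lte_add_pinfty; apply: le_lt_trans (probability_le1 _ _) _; rewrite ?ltry //; exact: measurable_cylinder.
have finP (P : probability X R) (A : set (heights (box d k) R)) : measurable A -> P (cylinder A) \is a fin_num.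
  by move=> mA; apply: fin_num_measure; exact: measurable_cylinder.
apply/ler_addgt0Pr => e e0; have e2 : 0 < e / 2 by rewrite divr_gt0.
have [_ /(_ _ e2)[F [D [[cF mF F01 FA] mD QD]]]] := approximable_measurable Qfin mE0.
pose S : set (heights (box d k) R) := [set x | 1 / 2 <= F x].
have mS : measurable S.
  rewrite (_ : S = setT `&` F @^-1` `[1 / 2, +oo[); first by apply: mF => //; exact: measurable_itv.
  by apply/seteqP; split => x; rewrite /S /= in_itv /= andbT => // -[].
pose F1 := clamp (R := R) \o (fun x => 2 * F x + 0).
pose F2 := clamp (R := R) \o (fun x => 2 * F x + (- 1)).
have c1 : continuous F1 by apply: continuous_clamp_comp; exact: continuous_affine.
have c2 : continuous F2 by apply: continuous_clamp_comp; exact: continuous_affine.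
have mres : measurable_fun setT res by exact: (measurable_funPT res).
have mf1 : measurable_fun setT (F1 \o res).
  by apply: measurableT_comp mres; apply: measurable_clamp; exact: measurable_affine.
have mf2 : measurable_fun setT (F2 \o res).
  by apply: measurableT_comp mres; apply: measurable_clamp; exact: measurable_affine.
have bnd (G : heights (box d k) R -> R) : exists M, forall h, `|((clamp (R := R) \o G) \o res) h| <= M.
  by exists 1 => h; have /andP[h1 h2] := clamp01 (G (res h)); rewrite /= ger0_norm.
have l0 := w0 (continuous_box_restrict c2) (bnd _).
have l1 := w1 (continuous_box_restrict c1) (bnd _).
have mem_cyl (A : set (heights (box d k) R)) h : cylinder A h <-> A (res h) by [].
have step n : (N <= n)%N -> (\int[mu0 n]_h ((F2 \o res) h)%:E <= \int[mu1 n]_h ((F1 \o res) h)%:E + eps%:E)%E.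
  move=> Nn; apply: (@le_trans _ _ (mu0 n (cylinder S))).
    apply: integral_le_prob => // [|h|h hS]; first exact: measurable_cylinder.
      exact: clamp01.
    by rewrite /F2 /= clamp_le0 //; move: hS => /negP; rewrite /cylinder /= -ltNge -/(res h); lra.
  apply: (@le_trans _ _ (mu1 n (cylinder S) + eps%:E)%E).
    by rewrite -(fineK (finP (mu0 n) _ mS)) -(fineK (finP (mu1 n) _ mS)) -EFinD lee_fin; exact: hN.
  apply: leeD => //; apply: integral_ge_prob => // [|h|h hS]; first exact: measurable_cylinder.
    by case/andP: (clamp01 (2 * F (res h) + 0)).
  by rewrite /F1 /= clamp_ge1 //; move: hS; rewrite /cylinder /S /= -/(res h); lra.
have lim_le : (\int[m0]_h ((F2 \o res) h)%:E <= \int[m1]_h ((F1 \o res) h)%:E + eps%:E)%E.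
  have l1' : (\int[mu1 n]_h ((F1 \o res) h)%:E + eps%:E)%E @[n --> \oo] --> (\int[m1]_h ((F1 \o res) h)%:E + eps%:E)%E.
    by apply: cvgeD l1 (cvg_cst _); rewrite fin_num_adde_defl.
  rewrite -(cvg_lim (@ereal_hausdorff R) l0) -(cvg_lim (@ereal_hausdorff R) l1').
  apply: lee_lim; [by apply/cvg_ex; eexists; exact: l0|by apply/cvg_ex; eexists; exact: l1'|].
  by exists N => // n /= Nn; exact: step.
have u0 : (m0 (cylinder (E0 `\` D)) <= \int[m0]_h ((F2 \o res) h)%:E)%E.
  apply: integral_ge_prob => // [|h|h [hE hD]]; first by apply: measurable_cylinder; exact: measurableD.
    by case/andP: (clamp01 (2 * F (res h) + (- 1))).
  by rewrite /F2 /= (FA _ hD) indicE mem_set // clamp_ge1 //=; lra.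
have u1 : (\int[m1]_h ((F1 \o res) h)%:E <= m1 (cylinder (E0 `|` D)))%E.
  apply: integral_le_prob => // [|h|h hED]; first by apply: measurable_cylinder; exact: measurableU.
    exact: clamp01.
  have nD : ~ D (res h) by move=> hD; apply: hED; right.
  have nE : ~ E0 (res h) by move=> hE; apply: hED; left.
  by rewrite /F1 /= (FA _ nD) indicE (memNset nE) clamp_le0 //=; lra.
have v0 : (m0 (cylinder E0) <= m0 (cylinder (E0 `\` D)) + m0 (cylinder D))%E.
  apply: le_trans (measureU2 _ _ _); [|by apply: measurable_cylinder; exact: measurableD|exact: measurable_cylinder].
  apply: le_measure; rewrite ?inE; [exact: measurable_cylinder| |].
    by apply: measurableU; apply: measurable_cylinder => //; exact: measurableD.
  by move=> h hE; have [hD|hD] := pselect (D (res h)); [right|left].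
have v1 : (m1 (cylinder (E0 `|` D)) <= m1 (cylinder E0) + m1 (cylinder D))%E.
  by apply: measureU2; exact: measurable_cylinder.
have mED : measurable (E0 `\` D) by exact: measurableD.
have mEU : measurable (E0 `|` D) by exact: measurableU.
have all_le := le_trans u0 (le_trans lim_le (leeD (le_trans u1 v1) (lexx _))).
move: v0 all_le QD; rewrite QE.
rewrite -(fineK (finP m0 _ mE0)) -(fineK (finP m0 _ mED)) -(fineK (finP m0 _ mD)).
rewrite -(fineK (finP m1 _ mE0)) -(fineK (finP m1 _ mD)) -!EFinD !lee_fin /=.
have : 0 <= fine (m0 (cylinder D)) by exact: fine_ge0.
have : 0 <= fine (m1 (cylinder D)) by exact: fine_ge0.
by move: (fine _) (fine _) (fine _) (fine _) (fine _) => a b x y z; lra.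
Qed.
End limit_transfer.

Lemma exhausting_cube d : exhausting (cube d).
Proof.
split => [n|x]; last by exists (nrm x); rewrite in_cube.
by apply/fsubsetP => x; rewrite !in_cube; exact: leqW.
Qed.

Lemma limit_difference (R : realType) d k (g eps : R) (m0 m1 : probability (heights 'rV[int]_d R) R) :
  (0 < d)%N -> 0 <= g -> infinite_volume_limit 0 m0 -> infinite_volume_limit g m1 ->
  (exists N0, forall N, (N0 <= N)%N -> forall E : set (heights (cube d N) R), measurable E ->
     cylindrical [set y : cube d N | (nrm (val y) <= k)%N]%SET E ->
     E `<=` low_on_B ((2 * d)%:R : R) [set y : cube d N | (nrm (val y) <= k)%N]%SET ->
     sandpile_mass (@site_adj d (cube d N)) ((2 * d)%:R : R) 0 E <=
     sandpile_mass (@site_adj d (cube d N)) ((2 * d)%:R : R) g E + eps) ->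
  forall E0 : set (heights (box d k) R), measurable E0 ->
  `|fine (m1 (cylinder E0)) - fine (m0 (cylinder E0))| <= eps.
Proof.
move=> d0 g0 [_ lim0] [_ lim1] [N0 cmp] E0 mE0.
have H := @weak_transfer R d k _ _ m0 m1 eps (lim0 _ (exhausting_cube d)) (lim1 _ (exhausting_cube d)).
have {}H (E1 : set (heights (box d k) R)) : measurable E1 ->
    fine (m0 (cylinder E1)) <= fine (m1 (cylinder E1)) + eps.
  by apply: H; exists N0 => N NN0 E2 mE2; apply: cube_transfer => // E; exact: cmp.
have mC : measurable (cylinder E0) by exact: measurable_cylinder.
have finP (P : probability (heights 'rV[int]_d R) R) : P (cylinder E0) \is a fin_num by exact: fin_num_measure.
have compl (P : probability (heights 'rV[int]_d R) R) : fine (P (cylinder (~` E0))) = 1 - fine (P (cylinder E0)).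
  rewrite (_ : cylinder (~` E0) = ~` cylinder E0) // probability_setC //.
  by rewrite -(fineK (finP P)) -EFinB.
have h1 := H _ mE0; have := H _ (measurableC mE0); rewrite !compl => h2.
by rewrite ler_norml; apply/andP; split; lra.
Qed.

(** * Choice of scales and exponents *)

Section numerics.
Variable R : realType.

Lemma powR_expR (x a : R) : 0 < x -> x `^ a = expR (a * ln x).
Proof. by move=> x0; rewrite /powR gt_eqF. Qed.

(* [l] is of order [g^(-1/26)], which balances [l^-2] and [l^24 g]. *)
Lemma space_scale (k : nat) (g : R) : (0 < k)%N -> 0 < g < 1 -> exists2 l, (0 < l)%N &
  ((k <= 18 * l ^ 8)%N -> k%:R ^+ 3 / l%:R ^+ 2 + l%:R ^+ 24 * g <= 5 * (k%:R * expR (ln g / 39)) ^+ 3) /\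
  ((18 * l ^ 8 < k)%N -> 1 <= 5 * (k%:R * expR (ln g / 39)) ^+ 3).
Proof.
move=> k0 /andP[g0 g1].
(* With [y ^+ 78 = g] all exponents are integers: [l] is about [y ^- 3], that is [g^(-1/26)], and
   [g^(1/39)] is [y ^+ 2]. *)
pose y := expR (ln g / 78).
have y0 : 0 < y by exact: expR_gt0.
have yE n : y ^+ n = expR (n%:R * (ln g / 78)) by rewrite expRM_natl.
have gE : g = y ^+ 78.
  by rewrite yE mulrC divfK ?lnK // lt0r_neq0.
have y1 : y <= 1.
  by rewrite -expR0 ler_expR pmulr_lle0 ?invr_gt0 // ltW // ln_lt0 // g0.
have y2 : expR (ln g / 39) = y ^+ 2 by rewrite yE; congr expR; field.
have y30 : 0 < y ^+ 3 by rewrite exprn_gt0.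
have y31 : 1 <= (y ^+ 3)^-1 by rewrite invf_ge1 // exprn_ile1 // ltW.
pose l := Num.truncn (y ^+ 3)^-1.
have l0 : (0 < l)%N by rewrite truncn_gt0.
have lR : 0 < l%:R :> R by rewrite ltr0n.
have l1 : 1 <= l%:R :> R by rewrite ler1n.
have ly : l%:R * y ^+ 3 <= 1.
  have h : 0 <= (y ^+ 3)^-1 by rewrite invr_ge0 ltW.
  by rewrite -ler_pdivlMr // div1r; have /andP[] := truncn_itv h.
have ly2 : 1 <= 2 * (l%:R * y ^+ 3).
  have : (y ^+ 3)^-1 < l.+1%:R by exact: truncnS_gt.
  rewrite -div1r ltr_pdivrMr // -(natr1 l) mulrDl mul1r => h.
  have h2 : y ^+ 3 <= l%:R * y ^+ 3 by rewrite ler_peMl // ltW.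
  lra.
have K1 : 1 <= k%:R :> R by rewrite ler1n.
have y6 : y ^+ 6 = y ^+ 3 * y ^+ 3 by rewrite -exprD.
have y60 : 0 <= y ^+ 6 by rewrite exprn_ge0 // ltW.
have K3 : 1 <= k%:R ^+ 3 :> R by rewrite exprn_ege1.
have w : 1 <= 4 * (l%:R ^+ 2 * y ^+ 6).
  have -> : 4 * (l%:R ^+ 2 * y ^+ 6) = (2 * (l%:R * y ^+ 3)) ^+ 2 by rewrite y6; ring.
  by rewrite exprn_ege1.
exists l => //; rewrite y2 exprMn -exprM; split => [_|kl].
  have a1 : k%:R ^+ 3 / l%:R ^+ 2 <= 4 * (k%:R ^+ 3 * y ^+ 6).
    rewrite ler_pdivrMr ?exprn_gt0 // -[X in X <= _]mulr1.
    have -> : 4 * (k%:R ^+ 3 * y ^+ 6) * l%:R ^+ 2 = k%:R ^+ 3 * (4 * (l%:R ^+ 2 * y ^+ 6)) by ring.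
    by rewrite ler_wpM2l // exprn_ge0.
  have a2 : l%:R ^+ 24 * g <= k%:R ^+ 3 * y ^+ 6.
    have -> : l%:R ^+ 24 * g = (l%:R * y ^+ 3) ^+ 24 * y ^+ 6.
      have -> : g = (y ^+ 3) ^+ 24 * y ^+ 6.
        by rewrite [LHS]gE -(exprM y 3 24) -(exprD y (3 * 24) 6).
      by rewrite [in RHS]exprMn mulrA.
    by apply: ler_wpM2r => //; apply: le_trans K3; rewrite exprn_ile1 // mulr_ge0 // ltW.
  by apply: le_trans (lerD a1 a2) _; move: (_ * y ^+ 6) => z; lra.
(* For a box too large for the net, the claimed bound exceeds one. *)
have kl' : l%:R ^+ 2 <= k%:R ^+ 3 :> R.
  rewrite -!natrX ler_nat; apply: leq_trans (_ : l ^ 8 <= _)%N; first by rewrite leq_pexp2l.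
  apply: leq_trans (_ : k ^ 1 <= _)%N; last by rewrite leq_pexp2l.
  by rewrite expn1; apply: leq_trans (ltnW kl); rewrite leq_pmull.
by apply: le_trans w _; apply: ler_pM => //; [rewrite mulr_ge0 // exprn_ge0|lra|rewrite ler_wpM2r].
Qed.

(** If [x > 1] the bound is weaker than [D <= 1], otherwise the square dominates the cube. For
    [x = k g^(1/39)] this lowers the power of [k] from 3 to 2. *)
Lemma cube_to_square (C D x : R) : 1 <= C -> 0 <= x -> D <= 1 -> D <= C * x ^+ 3 -> D <= C * x ^+ 2.
Proof.
move=> C1 x0 D1 h; have [x1|x1] := lerP x 1.
  by apply: le_trans h _; rewrite ler_wpM2l ?(le_trans ler01) // exprS ler_piMl // exprn_ge0.
by apply: le_trans D1 _; rewrite mulr_ege1 // exprn_ege1 // ltW.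
Qed.

Lemma plane_scale (g : R) : 0 < g <= 80^-1 -> exists2 J, (0 < J)%N &
  (80 ^+ J.+1)^-1 <= g <= (80 ^+ J)^-1 /\ (6 / 7) ^+ J <= 2 * expR (ln g / 40).
Proof.
move=> /andP[g0 g80].
pose n := Num.truncn g^-1.
have gi : 80 <= g^-1 by rewrite -[80]invrK lef_pV2 ?posrE ?invr_gt0.
have n80 : (80 <= n)%N by rewrite truncn_ge_nat // invr_ge0 ltW.
have n0 : (0 < n)%N by exact: leq_trans n80.
pose J := trunc_log 80 n.
have nJ : (80 ^ J <= n)%N by exact: trunc_logP.
have Jn : (n < 80 ^ J.+1)%N by exact: trunc_log_ltn.
have J0 : (0 < J)%N by rewrite /J trunc_log_gt0 /=.
have gl : (80 ^+ J.+1)^-1 <= g.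
  rewrite -[g]invrK lef_pV2 ?posrE ?invr_gt0 ?exprn_gt0 //.
  have : g^-1 < n.+1%:R by exact: truncnS_gt.
  move=> /ltW/le_trans; apply; rewrite -(natrX _ 80) ler_nat //.
have gu : g <= (80 ^+ J)^-1.
  rewrite -[g]invrK lef_pV2 ?posrE ?invr_gt0 ?exprn_gt0 //.
  apply: le_trans (_ : n%:R <= _); first by rewrite -(natrX _ 80) ler_nat.
  have h : 0 <= g^-1 by rewrite invr_ge0 ltW.
  by have /andP[] := truncn_itv h.
exists J => //; split; first by rewrite gl.
(* [(6/7)^5 <= 1/2] and [2^8 >= 80] give [(6/7)^40 <= 1/80], the origin of the exponent [1/40]. *)
have l67 : 40 * ln (6 / 7) <= - ln 80 :> R.
  have q0 : 0 < 6 / 7 :> R by rewrite divr_gt0.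
  rewrite -lnV ?posrE // mulr_natl -lnXn //; apply: ln_le_mono; first by rewrite exprn_gt0.
  rewrite (_ : 40 = 5 * 8)%N // exprM.
  apply: le_trans (_ : (1 / 2) ^+ 8 <= _).
    by rewrite lerXn2r ?nnegrE ?exprn_ge0 ?divr_ge0 // expr_div_n ler_pdivrMr ?exprn_gt0 //; lra.
  rewrite expr_div_n expr1n div1r lef_pV2 ?posrE ?exprn_gt0 //; lra.
have lg : - (J.+1%:R * ln 80) <= ln g.
  have -> : - (J.+1%:R * ln 80) = ln ((80 ^+ J.+1)^-1) :> R.
    by rewrite lnV ?posrE ?exprn_gt0 // lnXn // mulr_natl.
  by apply: ln_le_mono; rewrite // invr_gt0 exprn_gt0.
have h : (6 / 7) ^+ J.+1 <= expR (ln g / 40).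
  have q0 : 0 < 6 / 7 :> R by rewrite divr_gt0.
  rewrite -[6 / 7]lnK ?posrE // -expRM_natl ler_expR ler_pdivlMr // -mulrA [ln _ * 40]mulrC.
  apply: le_trans lg; rewrite -mulrN ler_wpM2l //.
move: h; rewrite exprS; have : 0 <= (6 / 7) ^+ J :> R by rewrite exprn_ge0 // divr_ge0.
by move: ((6 / 7) ^+ J) (expR _) => a b; lra.
Qed.

(* [334 * (1/40 - 1/46) >= 2 - 21/23] *)
Lemma plane_exponents (k : nat) (g o : R) : (0 < k)%N -> 0 < g -> g <= k%:R `^ (- 334) -> 0 <= o -> g <= 1 ->
  k%:R ^+ 2 * expR (ln g / 40) <= k%:R `^ (21 / 23) * g `^ (1 / 46 - o).
Proof.
move=> k0 g0 gk o0 g1; have kR : 0 < k%:R :> R by rewrite ltr0n.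
have lk : 0 <= ln k%:R :> R by apply: ln_ge0; rewrite ler1n.
have lg : ln g <= - 334 * ln k%:R.
  by rewrite -[X in _ <= X]expRK -powR_expR //; exact: ln_le_mono.
have lg0 : ln g <= 0 by apply: ln_le0.
rewrite !powR_expR // -[X in X ^+ 2](lnK (x := k%:R)) ?posrE // -expRM_natl -!expRD ler_expR.
have : 0 <= o * - ln g by rewrite mulr_ge0 // oppr_ge0.
by rewrite mulrBl mulrN; move: (o * ln g) => z; lra.
Qed.
End numerics.

Theorem theorem1 (R : realType)
    (m : forall d : nat, R -> probability (heights 'rV[int]_d R) R)
    (m_limit : forall (d : nat) (gamma : R), (2 <= d)%N -> 0 <= gamma ->
       infinite_volume_limit gamma (m d gamma)) :
  (exists C eta : R, 0 < eta /\
     forall (k : nat) (E0 : set (heights (box 3 k) R)) (gamma : R),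
       (1 <= k)%N -> measurable E0 -> E0 `<=` stable 3 0 ->
       0 < gamma < 1 ->
       `|fine (m 3%N gamma (cylinder E0)) - fine (m 3%N 0 (cylinder E0))|
         <= C * k%:R ^+ 2 * gamma `^ eta + C * k%:R ^+ 5 * ln k%:R * gamma)
  /\
  (exists (c0 C C0 : R) (o : R -> R),
     [/\ 0 < c0,
         forall gamma, 0 < gamma -> 0 < o gamma,
         o gamma @[gamma --> 0^'+] --> (0 : R)
       & forall (k : nat) (E0 : set (heights (box 2 k) R)) (gamma : R),
           (1 <= k)%N -> measurable E0 -> E0 `<=` stable 2 0 ->
           0 < gamma <= c0 * k%:R `^ (- C0) ->
           `|fine (m 2%N gamma (cylinder E0)) - fine (m 2%N 0 (cylinder E0))|
             <= C * k%:R `^ (21 / 23) * gamma `^ (1 / 46 - o gamma)]).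
Proof.
split.
  have C1 := space_const_ge1 R; pose C := space_const R * 5.
  have C5 : 1 <= C by rewrite mulr_ege1 //; lra.
  (* The bound is the cube of [k g^(1/39)], weakened to its square. *)
  exists C, (2 / 39); split => [|k E0 g k0 mE0 _ g01]; first by rewrite divr_gt0.
  have /andP[g0 g1] := g01; have lk : 0 <= ln k%:R :> R by apply: ln_ge0; rewrite ler1n.
  have C0 : 0 <= C by apply: le_trans C5.
  have err0 : 0 <= C * k%:R ^+ 5 * ln k%:R * g.
    by apply: mulr_ge0 (ltW g0); apply: mulr_ge0 lk; apply: mulr_ge0 C0 _; exact: exprn_ge0.
  apply: ler_wpDr err0 _.
  set D := `|_|; pose x := k%:R * expR (ln g / 39).
  have x0 : 0 <= x by rewrite mulr_ge0 ?expR_ge0.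
  have -> : C * k%:R ^+ 2 * g `^ (2 / 39) = C * x ^+ 2.
    have e : 2 / 39 * ln g = 2%:R * (ln g / 39) by rewrite mulrAC mulrA.
    by rewrite /x exprMn powR_expR // e expRM_natl -[LHS]mulrA.
  have D1 : D <= 1.
    have mC : measurable (cylinder E0) by exact: measurable_cylinder.
    have P01 (P : probability (heights 'rV[int]_3 R) R) : 0 <= fine (P (cylinder E0)) <= 1.
      have fP : P (cylinder E0) \is a fin_num by exact: fin_num_measure.
      by rewrite fine_ge0 //= -lee_fin fineK // probability_le1.
    have /andP[a0 a1] := P01 (m 3%N g); have /andP[b0 b1] := P01 (m 3%N 0).
    by rewrite /D ler_norml; apply/andP; split; lra.
  apply: cube_to_square => //.
  have [l l0 [small large]] := space_scale k0 g01.
  have [kl|kl] := leqP k (18 * l ^ 8); last first.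
    apply: le_trans D1 _; apply: le_trans (large kl) _.
    by rewrite ler_wpM2r ?exprn_ge0 // /C ler_peMl.
  apply: le_trans (_ : space_const R * (k%:R ^+ 3 / l%:R ^+ 2 + l%:R ^+ 24 * g) <= _); last first.
    by rewrite /C -mulrA ler_wpM2l ?small // (le_trans ler01).
  have lim0 : infinite_volume_limit 0 (m 3%N 0) by exact: m_limit.
  have limg : infinite_volume_limit g (m 3%N g) by apply: m_limit => //; exact: ltW.
  rewrite /D; apply: (limit_difference _ (ltW g0) lim0 limg _ mE0) => //.
  exists (576 * l ^ 8)%N => N lN E mE cE El.
  exact: space_finite_volume (ltW g0) E mE cE El.
pose C : R := 7 * (80 * 90 * 84 * 36).
have C0 : 0 <= C by rewrite /C !mulr_ge0.
(* The bound [1/80] makes room for a scale [J >= 1]; 334 is the power of [k] that [plane_exponents]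
   asks for in passing from [1/40] to [1/46]. The identity serves as [o]: it only enlarges the
   right-hand side, as [g <= 1]. *)
exists 80^-1, (C * 2), 334, id; split => //.
  by apply: cvg_at_right_filter; exact: cvg_id.
move=> k E0 g k0 mE0 _ /andP[g0 gk].
have kp : 0 < (k%:R : R) `^ (- 334) <= 1.
  rewrite powR_expR ?ltr0n // expR_gt0 /= -[X in _ <= X]expR0 ler_expR mulNr oppr_le0.
  by rewrite mulr_ge0 ?ler0n // ln_ge0 // ler1n.
have /andP[kp0 kp1] := kp.
have g80 : 0 < g <= 80^-1.
  by rewrite g0 /=; apply: le_trans gk _; rewrite ler_piMr // invr_ge0.
have gk' : g <= k%:R `^ (- 334).
  by apply: le_trans gk _; rewrite ler_piMl ?(ltW kp0) // invf_le1 //; lra.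
have g1 : g <= 1 by exact: le_trans gk' kp1.
have [J J0 [gJ qJ]] := plane_scale g80.
apply: le_trans (_ : C * k%:R ^+ 2 * (6 / 7) ^+ J <= _); last first.
  apply: le_trans (_ : C * 2 * (k%:R ^+ 2 * expR (ln g / 40)) <= _).
    have -> : C * 2 * (k%:R ^+ 2 * expR (ln g / 40)) = C * k%:R ^+ 2 * (2 * expR (ln g / 40)) by ring.
    by rewrite ler_wpM2l // mulr_ge0 ?exprn_ge0.
  rewrite -[X in _ <= X]mulrA ler_wpM2l ?mulr_ge0 //.
  by apply: plane_exponents => //; exact: ltW.
have lim0 : infinite_volume_limit 0 (m 2%N 0) by exact: m_limit.
have limg : infinite_volume_limit g (m 2%N g) by apply: m_limit => //; exact: ltW.
apply: (limit_difference _ (ltW g0) lim0 limg _ mE0) => //.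
exists k => N kN E mE cE El.
exact: plane_finite_volume.
Qed.
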